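(* Let $\mathcal{X}$ be a complex Banach space and let $A,B\in\mathcal{B}(\mathcal{X})$ be such that $\angle\big(\mathscr{N}(\delta_{A,B}),\mathscr{R}(\delta_{A,B})\big)>0$. (i) If $f$ is an injective holomorphic function on an open neighborhood of $\sigma(A)\cup\sigma(B)$, then $\angle\big(\mathscr{N}(\delta_{f(A),f(B)}),\mathscr{R}(\delta_{f(A),f(B)})\big)>0$, and consequently, $\operatorname{asc}(\delta_{f(A),f(B)})=1$. (ii) If $f$ is a holomorphic function in a neighborhood of $z=0$ and $f'(0)\neq 0$, then there exists a constant $c>0$ such that $\angle\big(\mathscr{N}(\delta_{f(\lambda A),f(\lambda B)}),\mathscr{R}(\delta_{f(\lambda A),f(\lambda B)})\big)>0$, and consequently, $\operatorname{asc}(\delta_{f(\lambda A),f(\lambda B)})=1$ for all complex numbers $\lambda$ such that $|\lambda|<c$.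
   Context: $\mathcal{B}(\mathcal{X})$ is the Banach algebra of all bounded linear operators on $\mathcal{X}$; $\sigma(A)$ is the spectrum of $A$. For $A,B\in\mathcal{B}(\mathcal{X})$, the generalized derivation $\delta_{A,B}\colon\mathcal{B}(\mathcal{X})\to\mathcal{B}(\mathcal{X})$ is $\delta_{A,B}(X)=AX-XB$. $\mathscr{N}(T)$ and $\mathscr{R}(T)$ denote the null space and the range of $T$. Operators such as $f(A)$ are defined by the Riesz (holomorphic) functional calculus. For nonzero linear submanifolds (not necessarily closed) $\mathscr{K},\mathscr{M}$ of a Banach space, the angle $\angle(\mathscr{K},\mathscr{M})\in[0,\pi/2]$ is defined by $\sin(\angle(\mathscr{K},\mathscr{M}))=\inf\{\|x-y\| : x\in\mathscr{K},\ \|x\|=1,\ y\in\mathscr{M}\}$. If $\mathscr{K}=\{0\}$ or $\mathscr{M}=\{0\}$, then by convention $\sin(\angle(\mathscr{K},\mathscr{M}))=1$. The ascent $\operatorname{asc}(T)$ is the smallest non-negative integer $k$ such that $\mathscr{N}(T^k)=\mathscr{N}(T^{k+1})$ (with $T^0=I$), and $\infty$ if no such $k$ exists.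
   Formalization: In (i) and (ii), asc = 1 is asserted only when the null space of the generalized derivation is nonzero; if it is {0} the angle is positive by convention but the ascent is 0 (e.g. X = ℂ, A = 0, B = 1, f(z) = z), so the claim as written fails. *)

(* Defs.v *)
From Stdlib Require Import Reals Lra List Permutation.
From Stdlib Require Import ClassicalEpsilon FunctionalExtensionality ProofIrrelevance.
From Coquelicot Require Import Coquelicot.
Set Implicit Arguments.
Unset Strict Implicit.
Unset Printing Implicit Defensive.
Open Scope R_scope.

(** * Restriction of scalars from C to R

    Coquelicot integrates functions [R -> V] only for normed modules [V] over
    the reals; the norm and the uniform structure are those of [V]. *)
Section Restrict.
Variable V : NormedModule C_AbsRing.

Definition restrict_scal (r : R) (v : V) : V := scal (RtoC r : C_AbsRing) v.

Lemma restrict_scal_assoc (x y : R) (u : V) :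
  restrict_scal x (restrict_scal y u) = restrict_scal (x * y) u.
Proof.
  unfold restrict_scal; rewrite scal_assoc, RtoC_mult; reflexivity.
Qed.

Lemma restrict_scal_one (u : V) : restrict_scal 1 u = u.
Proof. exact (scal_one u). Qed.

Lemma restrict_scal_distr_l (x : R) (u v : V) :
  restrict_scal x (plus u v) = plus (restrict_scal x u) (restrict_scal x v).
Proof. exact (scal_distr_l (RtoC x : C_AbsRing) u v). Qed.

Lemma restrict_scal_distr_r (x y : R) (u : V) :
  restrict_scal (x + y) u = plus (restrict_scal x u) (restrict_scal y u).
Proof.
  unfold restrict_scal; rewrite RtoC_plus.
  exact (scal_distr_r (RtoC x : C_AbsRing) (RtoC y : C_AbsRing) u).
Qed.

Definition restrict_ModuleSpace_class : ModuleSpace.class_of R_Ring V :=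
  ModuleSpace.Class R_Ring V (AbelianGroup.class V)
    (ModuleSpace.Mixin R_Ring (AbelianGroup.Pack V (AbelianGroup.class V) V) restrict_scal restrict_scal_assoc
       restrict_scal_one restrict_scal_distr_l restrict_scal_distr_r).

Definition restrict_NormedModuleAux_class :
  NormedModuleAux.class_of R_AbsRing V :=
  NormedModuleAux.Class R_AbsRing V restrict_ModuleSpace_class
    (UniformSpace.class V).

Lemma restrict_norm_scal (l : R) (x : V) :
  norm (restrict_scal l x) <= Rabs l * norm x.
Proof.
  rewrite <- Cmod_R; exact (norm_scal (RtoC l : C_AbsRing) x).
Qed.

Definition restrict_NormedModule_mixin :
  NormedModule.mixin_of R_AbsRing
    (NormedModuleAux.Pack R_AbsRing V restrict_NormedModuleAux_class V) :=
  NormedModule.Mixin R_AbsRing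
    (NormedModuleAux.Pack R_AbsRing V restrict_NormedModuleAux_class V)
    (@norm _ V) (@norm_factor _ V)
    (@norm_triangle _ V) restrict_norm_scal
    (@norm_compat1 _ V) (@norm_compat2 _ V) (@norm_eq_zero _ V).

Definition restrict_R : NormedModule R_AbsRing :=
  NormedModule.Pack R_AbsRing V
    (NormedModule.Class R_AbsRing V restrict_NormedModuleAux_class
       restrict_NormedModule_mixin) V.
End Restrict.

(** * The normed algebra of bounded operators *)

(** [is_linear] is Coquelicot's predicate "linear and bounded". *)
Record bounded_op (X : NormedModule C_AbsRing) := BoundedOp {
  bop_fun :> X -> X;
  bop_lin : is_linear bop_fun }.

Section BopAlgebra.
Variable X : NormedModule C_AbsRing.
Implicit Types A B : bounded_op X.

Lemma bop_ext A B : (forall x, A x = B x) -> A = B.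
Proof.
  destruct A as [a la], B as [b lb]; simpl; intros H.
  assert (a = b) as -> by (apply functional_extensionality; exact H).
  f_equal; apply proof_irrelevance.
Qed.

Lemma bop_plus_lin A B : is_linear (fun x => plus (A x) (B x)).
Proof.
  exact (is_linear_comp (fun x => (A x, B x)) (fun p : X * X => plus (fst p) (snd p))
           (is_linear_prod _ _ (bop_lin A) (bop_lin B)) is_linear_plus).
Qed.

Lemma bop_scal_lin (k : C) A : is_linear (fun x => scal (k : C_AbsRing) (A x)).
Proof.
  apply (is_linear_comp A (fun x : X => scal (k : C_AbsRing) x) (bop_lin A)).
  apply is_linear_scal_r; exact Cmult_comm.
Qed.

Definition bop_zero : bounded_op X := BoundedOp is_linear_zero.
Definition bop_id : bounded_op X := BoundedOp is_linear_id.
Definition bop_plus A B : bounded_op X := BoundedOp (bop_plus_lin A B).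
Definition bop_scal (k : C) A : bounded_op X := BoundedOp (bop_scal_lin k A).
Definition bop_opp A : bounded_op X :=
  BoundedOp (is_linear_comp A opp (bop_lin A) is_linear_opp).
Definition bop_comp A B : bounded_op X :=
  BoundedOp (is_linear_comp B A (bop_lin B) (bop_lin A)).

Definition op_norm A : R :=
  real (Lub_Rbar (fun r => exists x : X, norm x <= 1 /\ r = norm (A x))).

Lemma op_norm_is_lub A :
  is_lub_Rbar (fun r => exists x : X, norm x <= 1 /\ r = norm (A x)) (op_norm A).
Proof.
  unfold op_norm; destruct (Lub_Rbar_correct
    (fun r => exists x : X, norm x <= 1 /\ r = norm (A x))) as [ub lub].
  destruct (linear_norm _ (bop_lin A)) as [M [M0 HM]].
  assert (h0 : Rbar_le 0 (Lub_Rbar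
    (fun r => exists x : X, norm x <= 1 /\ r = norm (A x)))).
  { apply ub; exists zero; rewrite (linear_zero _ (bop_lin A)), !norm_zero.
    split; [lra | reflexivity]. }
  assert (hM : Rbar_le (Lub_Rbar
    (fun r => exists x : X, norm x <= 1 /\ r = norm (A x))) M).
  { apply lub; intros r [x [hx ->]]; simpl.
    specialize (HM x); apply Rle_trans with (1 := HM).
    rewrite <- (Rmult_1_r M) at 2; apply Rmult_le_compat_l; lra. }
  destruct (Lub_Rbar _) as [r| |]; simpl in *; try contradiction.
  split; assumption.
Qed.

Lemma op_norm_ge_0 A : 0 <= op_norm A.
Proof.
  apply (proj1 (op_norm_is_lub A)); exists zero.
  rewrite (linear_zero _ (bop_lin A)), !norm_zero; split; [lra | reflexivity].
Qed.

Lemma op_norm_bound A (x : X) : norm (A x) <= op_norm A * norm x.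
Proof.
  destruct (Req_dec (norm x) 0) as [h0 | h0].
  { rewrite (norm_eq_zero x h0), (linear_zero _ (bop_lin A)), !norm_zero; lra. }
  assert (hx : 0 < norm x) by (pose proof (norm_ge_0 x); lra).
  assert (hinv : Cmod (RtoC (/ norm x)) = / norm x).
  { rewrite Cmod_R; apply Rabs_pos_eq, Rlt_le, Rinv_0_lt_compat, hx. }
  set (y := scal (RtoC (/ norm x) : C_AbsRing) x).
  assert (hy : norm y <= 1).
  { apply Rle_trans with (1 := norm_scal _ _).
    change (abs (RtoC (/ norm x) : C_AbsRing)) with (Cmod (RtoC (/ norm x))).
    rewrite hinv, Rinv_l; lra. }
  assert (hAy : norm (A y) <= op_norm A).
  { apply (proj1 (op_norm_is_lub A)); exists y; split; [exact hy | reflexivity]. }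
  assert (hxy : x = scal (RtoC (norm x) : C_AbsRing) y).
  { unfold y; rewrite scal_assoc.
    change (mult (RtoC (norm x) : C_AbsRing) (RtoC (/ norm x)))
      with (Cmult (RtoC (norm x)) (RtoC (/ norm x))).
    rewrite <- RtoC_mult, Rinv_r by exact h0.
    symmetry; exact (scal_one x). }
  rewrite hxy at 1; rewrite (linear_scal _ (bop_lin A)).
  apply Rle_trans with (1 := norm_scal _ _).
  change (abs (RtoC (norm x) : C_AbsRing)) with (Cmod (RtoC (norm x))).
  rewrite Cmod_R, Rabs_pos_eq by lra.
  rewrite Rmult_comm; apply Rmult_le_compat_r; lra.
Qed.

Lemma op_norm_least A (M : R) :
  0 <= M -> (forall x : X, norm (A x) <= M * norm x) -> op_norm A <= M.
Proof.
  intros M0 HM; apply (proj2 (op_norm_is_lub A) M); intros r [x [hx ->]]; simpl.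
  apply Rle_trans with (1 := HM x).
  rewrite <- (Rmult_1_r M) at 2; apply Rmult_le_compat_l; lra.
Qed.

Lemma bop_plus_comm A B : bop_plus A B = bop_plus B A.
Proof. apply bop_ext; intros x; apply plus_comm. Qed.

Lemma bop_plus_assoc A B D :
  bop_plus A (bop_plus B D) = bop_plus (bop_plus A B) D.
Proof. apply bop_ext; intros x; apply plus_assoc. Qed.

Lemma bop_plus_zero A : bop_plus A bop_zero = A.
Proof. apply bop_ext; intros x; apply plus_zero_r. Qed.

Lemma bop_plus_opp A : bop_plus A (bop_opp A) = bop_zero.
Proof. apply bop_ext; intros x; exact (plus_opp_r (A x)). Qed.

Definition bop_AbelianMonoid_mixin : AbelianMonoid.mixin_of (bounded_op X) :=
  AbelianMonoid.Mixin (bounded_op X) bop_plus bop_zero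
    bop_plus_comm bop_plus_assoc bop_plus_zero.

Canonical bop_AbelianMonoid :=
  AbelianMonoid.Pack (bounded_op X) bop_AbelianMonoid_mixin (bounded_op X).

Definition bop_AbelianGroup_class : AbelianGroup.class_of (bounded_op X) :=
  AbelianGroup.Class (bounded_op X) bop_AbelianMonoid_mixin
    (AbelianGroup.Mixin bop_AbelianMonoid bop_opp bop_plus_opp).

Canonical bop_AbelianGroup :=
  AbelianGroup.Pack (bounded_op X) bop_AbelianGroup_class (bounded_op X).

Lemma bop_scal_assoc (x y : C) A :
  bop_scal x (bop_scal y A) = bop_scal (Cmult x y) A.
Proof. apply bop_ext; intros u; exact (scal_assoc (x : C_AbsRing) y (A u)). Qed.

Lemma bop_scal_one A : bop_scal (RtoC 1) A = A.
Proof. apply bop_ext; intros u; exact (scal_one (A u)). Qed.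

Lemma bop_scal_distr_l (x : C) A B :
  bop_scal x (bop_plus A B) = bop_plus (bop_scal x A) (bop_scal x B).
Proof. apply bop_ext; intros u; exact (scal_distr_l (x : C_AbsRing) (A u) (B u)). Qed.

Lemma bop_scal_distr_r (x y : C) A :
  bop_scal (Cplus x y) A = bop_plus (bop_scal x A) (bop_scal y A).
Proof. apply bop_ext; intros u; exact (scal_distr_r (x : C_AbsRing) y (A u)). Qed.

Definition bop_ModuleSpace_class : ModuleSpace.class_of C_Ring (bounded_op X) :=
  ModuleSpace.Class C_Ring (bounded_op X) bop_AbelianGroup_class
    (ModuleSpace.Mixin C_Ring bop_AbelianGroup bop_scal bop_scal_assoc
       bop_scal_one bop_scal_distr_l bop_scal_distr_r).

Canonical bop_ModuleSpace :=
  ModuleSpace.Pack C_Ring (bounded_op X) bop_ModuleSpace_class (bounded_op X).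

Lemma op_norm_triangle A B : op_norm (plus A B) <= op_norm A + op_norm B.
Proof.
  pose proof (op_norm_ge_0 A); pose proof (op_norm_ge_0 B).
  apply op_norm_least; [lra | intros x].
  apply Rle_trans with (1 := norm_triangle (A x) (B x)).
  rewrite Rmult_plus_distr_r; apply Rplus_le_compat; apply op_norm_bound.
Qed.

Lemma op_norm_scal (k : C_AbsRing) A : op_norm (scal k A) <= abs k * op_norm A.
Proof.
  apply op_norm_least.
  - apply Rmult_le_pos; [apply abs_ge_0 | apply op_norm_ge_0].
  - intros x; apply Rle_trans with (1 := norm_scal k (A x)).
    rewrite Rmult_assoc; apply Rmult_le_compat_l;
      [apply abs_ge_0 | apply op_norm_bound].
Qed.

Lemma op_norm_zero : op_norm (zero : bounded_op X) = 0.
Proof.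
  apply Rle_antisym; [|apply op_norm_ge_0].
  apply op_norm_least; [lra | intros x].
  change (norm (zero : X) <= 0 * norm x); rewrite norm_zero; lra.
Qed.

Lemma op_norm_eq_zero A : op_norm A = 0 -> A = zero.
Proof.
  intros h; apply bop_ext; intros x; change (A x = zero); apply norm_eq_zero.
  apply Rle_antisym; [|apply norm_ge_0].
  pose proof (op_norm_bound A x) as hb; rewrite h, Rmult_0_l in hb; exact hb.
Qed.

Definition bop_ball A (e : R) B : Prop := op_norm (minus B A) < e.

Lemma bop_ball_center A (e : posreal) : bop_ball A e A.
Proof.
  unfold bop_ball; rewrite minus_eq_zero.
  apply Rle_lt_trans with (1 := Req_le _ _ op_norm_zero); apply cond_pos.
Qed.

Lemma op_norm_opp A : op_norm (opp A) <= op_norm A.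
Proof.
  apply op_norm_least; [apply op_norm_ge_0 | intros x].
  change (norm (opp (A x)) <= op_norm A * norm x).
  rewrite norm_opp; apply op_norm_bound.
Qed.

Lemma bop_ball_sym A B (e : R) : bop_ball A e B -> bop_ball B e A.
Proof.
  unfold bop_ball; intros h; rewrite <- opp_minus.
  apply Rle_lt_trans with (1 := op_norm_opp _); exact h.
Qed.

Lemma bop_ball_triangle A B D (e1 e2 : R) :
  bop_ball A e1 B -> bop_ball B e2 D -> bop_ball A (e1 + e2) D.
Proof.
  unfold bop_ball; intros h1 h2; rewrite (minus_trans B D A).
  apply Rle_lt_trans with (1 := op_norm_triangle _ _); lra.
Qed.

Definition bop_UniformSpace_mixin : UniformSpace.mixin_of (bounded_op X) :=
  UniformSpace.Mixin (bounded_op X) bop_zero bop_ball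
    bop_ball_center bop_ball_sym bop_ball_triangle.

Canonical bop_UniformSpace :=
  UniformSpace.Pack (bounded_op X) bop_UniformSpace_mixin (bounded_op X).

Definition bop_NormedModuleAux_class :
  NormedModuleAux.class_of C_AbsRing (bounded_op X) :=
  NormedModuleAux.Class C_AbsRing (bounded_op X)
    bop_ModuleSpace_class bop_UniformSpace_mixin.

Canonical bop_NormedModuleAux :=
  NormedModuleAux.Pack C_AbsRing (bounded_op X) bop_NormedModuleAux_class (bounded_op X).

Lemma bop_norm_compat1 A B (e : R) : op_norm (minus B A) < e -> ball A e B.
Proof. exact (fun h => h). Qed.

Lemma bop_norm_compat2 A B (e : posreal) :
  ball A e B -> op_norm (minus B A) < 1 * e.
Proof. rewrite Rmult_1_l; exact (fun h => h). Qed.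

Definition bop_NormedModule_mixin :
  NormedModule.mixin_of C_AbsRing bop_NormedModuleAux :=
  NormedModule.Mixin C_AbsRing bop_NormedModuleAux op_norm 1
    op_norm_triangle op_norm_scal bop_norm_compat1 bop_norm_compat2
    op_norm_eq_zero.

Canonical bop_NormedModule : NormedModule C_AbsRing :=
  NormedModule.Pack C_AbsRing (bounded_op X)
    (NormedModule.Class C_AbsRing (bounded_op X) bop_NormedModuleAux_class
       bop_NormedModule_mixin) (bounded_op X).

Definition is_inverse A B : Prop :=
  bop_comp A B = bop_id /\ bop_comp B A = bop_id.

Definition spectrum A (z : C) : Prop :=
  ~ exists B, is_inverse (minus (bop_scal z bop_id) A) B.

(** Arbitrary value at the points of the spectrum. *)
Definition resolvent A (z : C) : bounded_op X :=
  epsilon (inhabits bop_zero) (is_inverse (minus (bop_scal z bop_id) A)).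

Definition delta A B (Y : bounded_op X) : bounded_op X := minus (bop_comp A Y) (bop_comp Y B).
End BopAlgebra.

(** * Contour integration *)

(** Only the values on [[0, 1]] matter: a curve that is C^1 on [[0, 1]] with
    one-sided derivatives at the ends has such an extension to [R]. *)
Record C1_arc := C1Arc {
  arc :> R -> C;
  darc : R -> C;
  arc_is_derive : forall t, 0 <= t <= 1 ->
    is_derive (K := R_AbsRing) (V := C_R_NormedModule) arc t (darc t);
  darc_continuous : forall t, 0 <= t <= 1 ->
    continuous (U := C_UniformSpace) darc t }.

Definition chain := list C1_arc.

(** Vanishing boundary: every point is as often the origin as the end of an
    arc, i.e. the arcs can be joined into piecewise C^1 closed curves. *)
Definition is_cycle (G : chain) : Prop :=
  Permutation (map (fun g : C1_arc => g 0) G) (map (fun g : C1_arc => g 1) G).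

Definition trace (G : chain) (z : C) : Prop :=
  exists g : C1_arc, In g G /\ exists t, 0 <= t <= 1 /\ z = g t.

Section ContourIntegral.
Variable V : NormedModule C_AbsRing.

Definition is_arc_int (F : C -> V) (g : C1_arc) (I : V) : Prop :=
  is_RInt (V := restrict_R V)
    (fun t => scal (darc g t : C_AbsRing) (F (g t))) 0 1 I.

Fixpoint is_chain_int (F : C -> V) (G : chain) (I : V) : Prop :=
  match G with
  | nil => I = zero
  | g :: G' => exists I1 I2 : V,
      is_arc_int F g I1 /\ is_chain_int F G' I2 /\ I = plus I1 I2
  end.
End ContourIntegral.

Definition two_pi_i : C := (0, 2 * PI).

Definition is_winding_number (G : chain) (w n : C) : Prop :=
  is_chain_int (V := C_NormedModule) (fun z : C => Cinv (Cminus z w)) G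
    (Cmult two_pi_i n).

(** [G] is a cycle in [U] minus [K] that surrounds [K] once inside [U]. *)
Definition surrounds (G : chain) (K U : C -> Prop) : Prop :=
  is_cycle G /\
  (forall z, trace G z -> U z /\ ~ K z) /\
  (forall w, K w -> is_winding_number G w (RtoC 1)) /\
  (forall w, ~ U w -> is_winding_number G w (RtoC 0)).

(** [is_riesz U f A T]: [T] is the value [f(A)] of the Riesz functional calculus
    for [f] holomorphic on the open set [U] containing the spectrum of [A], i.e.
    2 i pi [T] is the integral of f(z) (z - A)^-1 dz over a cycle surrounding
    the spectrum in [U].  Such a cycle exists, and [T] does not depend on it. *)
Definition is_riesz (X : NormedModule C_AbsRing) (U : C -> Prop) (f : C -> C)
    (A T : bounded_op X) : Prop :=
  exists G : chain, surrounds G (spectrum A) U /\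
    is_chain_int (fun z : C => scal (f z : C_AbsRing) (resolvent A z)) G
      (scal (two_pi_i : C_AbsRing) T).

Definition holomorphic_on (U : C -> Prop) (f : C -> C) : Prop :=
  forall z : C, U z ->
    ex_derive (K := C_AbsRing) (V := C_NormedModule) f z.

Definition injective_on (U : C -> Prop) (f : C -> C) : Prop :=
  forall z w : C, U z -> U w -> f z = f w -> z = w.

(** * Angle and ascent *)

Section AngleAscent.
Variable V : NormedModule C_AbsRing.

Definition null_space (T : V -> V) (x : V) : Prop := T x = zero.
Definition range (T : V -> V) (y : V) : Prop := exists x, y = T x.

Definition is_trivial (K : V -> Prop) : Prop := forall x, K x -> x = zero.

Definition sin_angle (K M : V -> Prop) : R :=
  if excluded_middle_informative (is_trivial K \/ is_trivial M) then 1
  else real (Glb_Rbar (fun r =>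
    exists x y : V, K x /\ norm x = 1 /\ M y /\ r = norm (minus x y))).

Definition angle (K M : V -> Prop) : R := asin (sin_angle K M).

Definition null_stable (T : V -> V) (k : nat) : Prop :=
  forall x, null_space (Nat.iter k T) x <-> null_space (Nat.iter (S k) T) x.

Definition is_asc (T : V -> V) (k : nat) : Prop :=
  null_stable T k /\ forall j : nat, null_stable T j -> (k <= j)%nat.

(** [None] stands for an infinite ascent. *)
Definition asc (T : V -> V) : option nat :=
  match excluded_middle_informative (exists k, is_asc T k) with
  | left h => Some (proj1_sig (constructive_indefinite_description _ h))
  | right _ => None
  end.
End AngleAscent.

(* Main.v *)
Require Import Defs.
From Stdlib Require Import Reals ZArith Lra Lia List Permutation Classical ClassicalEpsilon.
From Stdlib Require Import FunctionalExtensionality PropExtensionality.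
From Coquelicot Require Import Coquelicot.
Set Implicit Arguments.
Unset Strict Implicit.
Unset Printing Implicit Defensive.
Open Scope R_scope.

(** Let [h(z, w) = (f z - f w) / (z - w)].  Integrating [h(z, w) R_A(z) Y R_B(w)] over two
    cycles gives an operator [D] on B(X), formally [h(L_A, R_B)], which commutes with
    [delta A B] and satisfies [delta f(A) f(B) = D o delta A B]; hence the null space of
    [delta A B] lies in that of [delta f(A) f(B)] and the range of the latter in that of the
    former.  If [f] is injective, [h] has no zero (on the diagonal by Hurwitz' argument), and
    [1 / h] provides in the same way an inverse of [D], so the two null spaces agree.  The
    angle can then only grow, and a positive angle forbids a nonzero element in the
    intersection of null space and range, which is ascent 1.  For (ii), [h(0, 0) = f'(0)]
    is nonzero, so [h] has no zero near [(0, 0)] and the cycles may be replaced by a small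
    circle.

    The cycles are arbitrary, so Cauchy's theorem is needed in its homology form.  Dixon's
    proof is used: the integral of [h(., w)] extends to an entire function of [w] vanishing
    at infinity.  Liouville's theorem is applied to functions that are only known to be
    continuous and to have the mean value property on small circles; both survive
    integration in a parameter, by Fubini, without any differentiation under the integral. *)

(** In place of multiplicativity of the calculus, each operator identity arises by splitting an
    integrand, with the resolvent equation, into a part whose integral is known and a part that
    Cauchy's theorem kills; besides f(A) and f(B), the only values computed are those of 1 and z.
    Cauchy's theorem is proved for scalar functions: Fubini brings an operator integral down to a
    scalar one, the resolvent being a factor independent of the inner variable. The exception is the
    integral of the resolvent itself, where the cycle winds around the singularities and Liouville's
    theorem is applied to an operator-valued function.

    Likewise 1/h is used only as far as the null spaces require: if f(A) Y = Y f(B), an integral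
    known to vanish is computed to be a nonzero multiple of A Y - Y B.

    In (ii) the values of the calculus come from cycles in all of U, where h may vanish, so
    independence of the cycle has to be proved; it is the inclusion of null spaces for the pair (A,
    A), taken at the identity operator. *)

Notation CU := C_UniformSpace.
Notation CU2 := (prod_UniformSpace CU CU).
Notation CV := C_CompleteNormedModule.
Notation fstC := (fst : CU * CU -> CU).
Notation sndC := (snd : CU * CU -> CU).

(** * Continuity and parameter integrals *)

(** Integrability of continuous functions rests on completeness. Restriction of scalars keeps the
    uniform structure, so the completeness of [V] is reused as it stands. *)
Definition real_module (V : CompleteNormedModule C_AbsRing) : CompleteNormedModule R_AbsRing :=
  CompleteNormedModule.Pack R_AbsRing V
    (CompleteNormedModule.Class R_AbsRing V (NormedModule.class R_AbsRing (restrict_R V))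
       (CompleteNormedModule.mixin _ _ (CompleteNormedModule.class C_AbsRing V))) V.

Lemma locally_Cmod (z : C) (P : C -> Prop) :
  locally (T := CU) z P <-> exists d, 0 < d /\ forall y, Cmod (y - z) < d -> P y.
Proof.
  rewrite locally_C; split.
  - intros [d Hd]; exists d; split; [apply cond_pos | exact Hd].
  - intros [d [d0 Hd]]; exists (mkposreal d d0); exact Hd.
Qed.

Lemma continuous_norm_iff (K : AbsRing) (T : UniformSpace) (V : NormedModule K) (f : T -> V) (x : T) :
  continuous f x <-> forall e, 0 < e -> locally x (fun y => norm (minus (f y) (f x)) < e).
Proof.
  unfold continuous; rewrite filterlim_locally; split; intros H.
  - intros e e0.
    assert (h0 := @norm_factor_gt_0 _ V).
    assert (h : 0 < e / @norm_factor _ V) by (apply Rdiv_lt_0_compat; lra).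
    generalize (H (mkposreal _ h)); apply filter_imp; intros y hy.
    apply norm_compat2 in hy; simpl in hy.
    replace e with (@norm_factor _ V * (e / @norm_factor _ V)) by (field; lra); exact hy.
  - intros e; generalize (H e (cond_pos e)); apply filter_imp; intros y hy.
    apply norm_compat1; exact hy.
Qed.

(** [C] carries two uniform structures, that of its absolute value and the product one of
    [C_UniformSpace]. They have the same neighbourhoods; scalar functions are taken with the second
    throughout. *)
Lemma continuous_scal_C (T : UniformSpace) (V : NormedModule C_AbsRing) (k : T -> C) (f : T -> V) (x : T) :
  continuous (U := CU) k x -> continuous f x ->
  continuous (fun y => scal (k y : C_AbsRing) (f y)) x.
Proof.
  intros hk hf; apply (continuous_scal (K := C_AbsRing) k f x); [|exact hf].
  intros P HP; apply hk; apply locally_C; exact HP.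
Qed.

(** Tube lemma: compactness of [[a, b]] makes the continuity along the slice at [s0] uniform in
    [t]. *)
Lemma tube_ball (T U : UniformSpace) (F : R -> T -> U) (a b : R) (s0 : T) :
  (forall t, a <= t <= b -> continuous (fun p : R * T => F (fst p) (snd p)) (t, s0)) ->
  forall e : posreal, locally s0 (fun s => forall t, a <= t <= b -> ball (F t s0) e (F t s)).
Proof.
  intros HF e.
  assert (H : forall t, exists d : posreal, a <= t <= b ->
    forall t' s, Rabs (t' - t) < d -> ball s0 d s -> ball (F t s0) (pos_div_2 e) (F t' s)).
  { intros t; destruct (classic (a <= t <= b)) as [ht|ht].
    - specialize (HF t ht); unfold continuous in HF.
      rewrite filterlim_locally in HF; destruct (HF (pos_div_2 e)) as [d hd].
      exists d; intros _ t' s h1 h2; apply (hd (t', s)); split; [exact h1|exact h2].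
    - exists (mkposreal 1 Rlt_0_1); intros h; contradiction. }
  set (delta t := proj1_sig (constructive_indefinite_description _ (H t))).
  assert (Hd : forall t, a <= t <= b -> forall t' s, Rabs (t' - t) < delta t -> ball s0 (delta t) s ->
     ball (F t s0) (pos_div_2 e) (F t' s)).
  { intros t; exact (proj2_sig (constructive_indefinite_description _ (H t))). }
  destruct (compactness_value_1d a b delta) as [d hd].
  exists d; intros s hs t ht.
  (* [compactness_value_1d] yields the covering point [u] only under a double negation. *)
  apply NNPP; intros hn; apply (hd t ht); intros [u [hu [h1 h2]]]; apply hn.
  replace (pos e) with (pos_div_2 e + pos_div_2 e) by (simpl; field).
  apply ball_triangle with (F u s0).
  - apply ball_sym, Hd; [exact hu|exact h1|apply ball_center].
  - apply Hd; [exact hu|exact h1|]. apply ball_le with d; [exact h2|exact hs].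
Qed.

Lemma tube_norm (K : AbsRing) (T : UniformSpace) (V : NormedModule K) (F : R -> T -> V) (a b : R) (s0 : T) :
  (forall t, a <= t <= b -> continuous (fun p : R * T => F (fst p) (snd p)) (t, s0)) ->
  forall e, 0 < e -> locally s0 (fun s => forall t, a <= t <= b -> norm (minus (F t s) (F t s0)) < e).
Proof.
  intros HF e e0.
  assert (h0 := @norm_factor_gt_0 _ V).
  assert (h : 0 < e / @norm_factor _ V) by (apply Rdiv_lt_0_compat; lra).
  generalize (tube_ball HF (mkposreal _ h)); apply filter_imp; intros s hs t ht.
  specialize (hs t ht); apply norm_compat2 in hs; simpl in hs.
  replace e with (@norm_factor _ V * (e / @norm_factor _ V)) by (field; lra); exact hs.
Qed.

Lemma continuous_slice (S T U : UniformSpace) (F : S -> T -> U) (s : S) (t : T) :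
  continuous (fun p : S * T => F (fst p) (snd p)) (s, t) -> continuous (fun x => F x t) s.
Proof.
  intros H; apply (continuous_comp_2 (fun x => x) (fun _ => t) F s).
  - apply continuous_id. - apply continuous_const. - exact H.
Qed.

Lemma continuous_slice2 (S T U : UniformSpace) (F : S -> T -> U) (s : S) (t : T) :
  continuous (fun p : S * T => F (fst p) (snd p)) (s, t) -> continuous (fun x => F s x) t.
Proof.
  intros H; apply (continuous_comp_2 (fun _ => s) (fun x => x) F t).
  - apply continuous_const. - apply continuous_id. - exact H.
Qed.

Section RealIntegral.
Variable V : CompleteNormedModule R_AbsRing.

Lemma norm_RInt_const (f : R -> V) (a b M : R) :
  a <= b -> (forall t, a <= t <= b -> continuous f t) ->
  (forall t, a <= t <= b -> norm (f t) <= M) -> norm (RInt f a b) <= M * (b - a).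
Proof.
  intros hab hc hM.
  apply (norm_RInt_le f (fun _ => M) a b); [exact hab|exact hM| |].
  - apply (RInt_correct f), ex_RInt_continuous; rewrite Rmin_left, Rmax_right by lra; exact hc.
  - rewrite Rmult_comm; exact (is_RInt_const a b M).
Qed.

(** Continuity is asked at all parameters near [s0], so that the integrals being compared exist. *)
Lemma continuous_RInt_param (T : UniformSpace) (F : R -> T -> V) (a b : R) (s0 : T) :
  a <= b ->
  locally s0 (fun s => forall t, a <= t <= b -> continuous (fun p : R * T => F (fst p) (snd p)) (t, s)) ->
  continuous (fun s => RInt (fun t => F t s) a b) s0.
Proof.
  intros hab hl.
  assert (h0 := locally_singleton _ _ hl); cbv beta in h0.
  apply (proj2 (continuous_norm_iff (K := R_AbsRing) (V := V) _ s0)); intros e e0.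
  (* The [1 +] keeps the denominator positive when [a = b]. *)
  assert (h : 0 < e / (1 + (b - a))) by (apply Rdiv_lt_0_compat; lra).
  generalize (filter_and _ _ hl (tube_norm h0 h)); apply filter_imp; intros s [hs1 hs2].
  assert (ex : forall s, (forall t, a <= t <= b -> continuous (fun p : R * T => F (fst p) (snd p)) (t, s)) ->
     forall t, a <= t <= b -> continuous (fun t => F t s) t).
  { intros s' hs' t ht; apply (continuous_slice (F := F)), hs', ht. }
  rewrite <- (RInt_minus (V := V)).
  2,3: apply (@ex_RInt_continuous V); rewrite Rmin_left, Rmax_right by lra; apply ex; assumption.
  apply Rle_lt_trans with (e / (1 + (b - a)) * (b - a)).
  - apply norm_RInt_const; [exact hab| |intros t ht; apply Rlt_le, hs2, ht].
    intros t ht; apply (continuous_minus (V := V)); apply ex; assumption.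
  - apply Rlt_le_trans with (e / (1 + (b - a)) * (1 + (b - a))); [|right; field; lra].
    apply Rmult_lt_compat_l; lra.
Qed.

(** Fubini by the fundamental theorem of calculus: as a function [Q] of its outer limit [d], the
    right-hand side has the inner integral of the left-hand side as derivative, and it vanishes at
    [c]. *)
Lemma RInt_swap (F : R -> R -> V) (a b c d : R) :
  a <= b -> c <= d ->
  (forall t s, continuous (fun p : R * R => F (fst p) (snd p)) (t, s)) ->
  RInt (fun s => RInt (fun t => F t s) a b) c d = RInt (fun t => RInt (fun s => F t s) c d) a b.
Proof.
  intros hab hcd HF.
  assert (c1 : forall s t, continuous (fun t => F t s) t) by (intros; apply (continuous_slice (F := F)), HF).
  assert (c2 : forall s t, continuous (fun s => F t s) s) by (intros; apply (continuous_slice2 (F := F)), HF).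
  assert (e1 : forall s a b, ex_RInt (fun t => F t s) a b) by (intros; apply (@ex_RInt_continuous V); intros; apply c1).
  assert (e2 : forall t c d, ex_RInt (fun s => F t s) c d) by (intros; apply (@ex_RInt_continuous V); intros; apply c2).
  assert (ci : forall s, continuous (fun s => RInt (fun t => F t s) a b) s).
  { intros s; apply continuous_RInt_param; [exact hab|apply filter_forall; intros; apply HF]. }
  assert (cj : forall u v t, continuous (fun t => RInt (fun s => F t s) u v) t).
  { assert (cj0 : forall u v t, u <= v -> continuous (fun t => RInt (fun s => F t s) u v) t).
    { intros u v t huv; apply (@continuous_RInt_param _ (fun s t => F t s)); [exact huv|].
      apply filter_forall; intros t' s' _.
      apply (continuous_comp_2 (fun p : R * R => snd p) (fun p : R * R => fst p) F (s', t')).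
      - apply continuous_snd. - apply continuous_fst. - apply HF. }
    intros u v t; destruct (Rle_dec u v) as [h|h]; [apply cj0, h|].
    apply continuous_ext with (fun t => opp (RInt (fun s => F t s) v u)).
    { intros x; apply (opp_RInt_swap (V := V)), e2. }
    apply (continuous_opp (V := V)), cj0; lra. }
  set (Q := fun x => RInt (fun t => RInt (fun s => F t s) c x) a b).
  assert (dQ : forall x, is_derive Q x (RInt (fun t => F t x) a b)).
  { intros x; split; [apply (is_linear_scal_l (K := R_AbsRing) (V := V))|].
    intros x' hx'; apply (@is_filter_lim_locally_unique _ R_NormedModule) in hx'; subst x'.
    intros e.
    assert (h : 0 < e / (1 + (b - a))) by (apply Rdiv_lt_0_compat; [apply cond_pos|lra]).
    pose proof (@tube_norm _ _ V F a b x (fun t _ => HF t x) _ h) as [r hr].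
    exists r; intros y hy.
    change (norm (minus (minus (Q y) (Q x)) (scal (y - x) (RInt (fun t => F t x) a b))) <= e * Rabs (y - x)).
    (* The error of the linear approximation is the double integral of [F t s - F t x] for [s]
       between [x] and [y], where the tube lemma makes the integrand small. *)
    assert (E : minus (minus (Q y) (Q x)) (scal (y - x) (RInt (fun t => F t x) a b)) =
       RInt (fun t => RInt (fun s => minus (F t s) (F t x)) x y) a b).
    { unfold Q.
      rewrite <- (RInt_minus (V := V)) by (apply (@ex_RInt_continuous V); intros; apply cj).
      rewrite <- (RInt_scal (V := V)) by apply e1.
      rewrite <- (RInt_minus (V := V)).
      - apply (RInt_ext (V := V)); intros t _.
        rewrite (RInt_minus (V := V)); [|apply e2|apply ex_RInt_const].
        rewrite (RInt_const (V := V)); f_equal.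
        unfold minus; rewrite (opp_RInt_swap (V := V)) by apply e2.
        rewrite plus_comm; apply (RInt_Chasles (V := V)); apply e2.
      - apply (@ex_RInt_continuous V); intros t _; apply (continuous_minus (V := V)); apply cj.
      - apply (@ex_RInt_continuous V); intros t _; apply (continuous_scal_r (V := V)), c1. }
    rewrite E.
    apply Rle_trans with (e / (1 + (b - a)) * Rabs (y - x) * (b - a)).
    - apply norm_RInt_const; [exact hab| |].
      + intros t _.
        apply continuous_ext with (fun t => minus (RInt (fun s => F t s) x y) (scal (y - x) (F t x))).
        { intros u; rewrite (RInt_minus (V := V)); [|apply e2|apply ex_RInt_const].
          rewrite (RInt_const (V := V)); reflexivity. }
        apply (continuous_minus (V := V)); [apply cj|apply (continuous_scal_r (V := V)), c1].
      + intros t ht.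
        assert (cm : forall s, continuous (fun s => minus (F t s) (F t x)) s).
        { intros s; apply (continuous_minus (V := V)); [apply c2|apply continuous_const]. }
        destruct (Rle_dec x y) as [hxy|hxy].
        * rewrite Rabs_pos_eq by lra; apply norm_RInt_const; [exact hxy|intros; apply cm|].
          intros s hs; apply Rlt_le, hr; [|exact ht].
          change (Rabs (s - x) < r); change (Rabs (y - x) < r) in hy.
          rewrite Rabs_pos_eq in hy |- * by lra; lra.
        * rewrite <- (opp_RInt_swap (V := V)) by (apply (@ex_RInt_continuous V); intros; apply cm).
          rewrite (@norm_opp R_AbsRing V), Rabs_minus_sym, Rabs_pos_eq by lra; apply norm_RInt_const; [lra|intros; apply cm|].
          intros s hs; apply Rlt_le, hr; [|exact ht].
          change (Rabs (s - x) < r); change (Rabs (y - x) < r) in hy.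
          rewrite Rabs_minus_sym, Rabs_pos_eq in hy |- * by lra; lra.
    - pose proof (Rabs_pos (y - x)); pose proof (cond_pos e).
      apply Rle_trans with (e / (1 + (b - a)) * (1 + (b - a)) * Rabs (y - x)); [|right; field; lra].
      nra. }
  apply is_RInt_unique.
  replace (RInt (fun t => RInt (fun s => F t s) c d) a b) with (minus (Q d) (Q c)).
  - apply is_RInt_derive; intros x _; [apply dQ|apply ci].
  - unfold Q; replace (RInt (fun t => RInt (fun s => F t s) c c) a b) with (@zero V).
    + exact (minus_zero_r _).
    + rewrite (RInt_ext (V := V) _ (fun _ => zero)), (RInt_const (V := V)); [symmetry; apply (@scal_zero_r _ V)|].
      intros; apply (RInt_point (V := V)).
Qed.

End RealIntegral.

(** * Linear combinations *)

Section ModuleReflection.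
Variable V : ModuleSpace C_Ring.

Inductive mexp :=
  | MZero | MAtom (n : nat) | MPlus (a b : mexp) | MMinus (a b : mexp) | MOpp (a : mexp)
  | MScal (k : C) (a : mexp).

Fixpoint mdenote (l : list V) (e : mexp) : V :=
  match e with
  | MZero => zero
  | MAtom n => nth n l zero
  | MPlus a b => plus (mdenote l a) (mdenote l b)
  | MMinus a b => minus (mdenote l a) (mdenote l b)
  | MOpp a => opp (mdenote l a)
  | MScal k a => scal (k : C_Ring) (mdenote l a)
  end.

Fixpoint mcoef (e : mexp) (i : nat) : C :=
  match e with
  | MZero => RtoC 0
  | MAtom n => if Nat.eqb n i then RtoC 1 else RtoC 0
  | MPlus a b => Cplus (mcoef a i) (mcoef b i)
  | MMinus a b => Cminus (mcoef a i) (mcoef b i)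
  | MOpp a => Copp (mcoef a i)
  | MScal k a => Cmult k (mcoef a i)
  end.

Fixpoint lincomb (l : list V) (c : nat -> C) : V :=
  match l with
  | nil => zero
  | v :: l => plus (scal (c 0%nat : C_Ring) v) (lincomb l (fun i => c (S i)))
  end.

(** Recursion on the number of atoms, so that it computes to a conjunction with one scalar equation
    for each atom. *)
Fixpoint msame (n : nat) (a b : mexp) : Prop :=
  match n with
  | O => True
  | S n => mcoef a n = mcoef b n /\ msame n a b
  end.

Lemma lincomb_ext l : forall c d, (forall i, (i < length l)%nat -> c i = d i) -> lincomb l c = lincomb l d.
Proof.
  induction l as [|v l IH]; simpl; intros c d H; [reflexivity|].
  rewrite (H 0%nat) by lia; f_equal; apply IH; intros i hi; apply H; lia.
Qed.

Lemma lincomb_zero l : lincomb l (fun _ => RtoC 0) = zero.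
Proof.
  induction l as [|v l IH]; simpl; [reflexivity|].
  rewrite IH, plus_zero_r; exact (scal_zero_l v).
Qed.

Lemma lincomb_plus l : forall c d, lincomb l (fun i => Cplus (c i) (d i)) = plus (lincomb l c) (lincomb l d).
Proof.
  induction l as [|v l IH]; simpl; intros c d; [symmetry; apply plus_zero_r|].
  rewrite IH. etransitivity; [apply f_equal2; [exact (scal_distr_r (c 0%nat : C_Ring) (d 0%nat) v)|reflexivity]|].
  rewrite <- !plus_assoc; f_equal; rewrite !plus_assoc; f_equal; apply plus_comm.
Qed.

Lemma lincomb_scal l k : forall c, lincomb l (fun i => Cmult k (c i)) = scal (k : C_Ring) (lincomb l c).
Proof.
  induction l as [|v l IH]; simpl; intros c; [symmetry; apply (scal_zero_r (V := V))|].
  rewrite IH, scal_distr_l, scal_assoc; reflexivity.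
Qed.

Lemma mdenote_lincomb l e : mdenote l e = lincomb l (mcoef e).
Proof.
  assert (opp_case : forall e, mdenote l e = lincomb l (mcoef e) ->
    opp (mdenote l e) = lincomb l (fun i => Copp (mcoef e i))).
  { intros a ->; rewrite <- (scal_opp_one (K := C_Ring)), <- (lincomb_scal l (opp one : C_Ring)).
    apply lincomb_ext; intros i _; change (opp one : C_Ring) with (Copp (RtoC 1)); ring. }
  induction e as [|n|a IHa b IHb|a IHa b IHb|a IHa|k a IHa]; simpl.
  - symmetry; apply lincomb_zero.
  - revert n; induction l as [|v l' IH]; intros n; simpl.
    + destruct n; reflexivity.
    + destruct n as [|n]; simpl.
      * rewrite lincomb_zero, plus_zero_r; symmetry; exact (scal_one v).
      * rewrite (scal_zero_l v : scal (RtoC 0 : C_Ring) v = zero), plus_zero_l; apply IH.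
        (* [opp_case] depends on the list, so the induction hypothesis asks for it again on the
           tail. *)
        intros a Ha; clear -Ha opp_case.
        rewrite Ha, <- (scal_opp_one (K := C_Ring)), <- (lincomb_scal l' (opp one : C_Ring)).
        apply lincomb_ext; intros i _; change (opp one : C_Ring) with (Copp (RtoC 1)); ring.
  - rewrite IHa, IHb; symmetry; apply lincomb_plus.
  - unfold minus; rewrite opp_case, IHa by assumption; rewrite <- lincomb_plus; reflexivity.
  - apply opp_case, IHa.
  - rewrite IHa; symmetry; apply lincomb_scal.
Qed.

Lemma msame_correct l a b : msame (length l) a b -> mdenote l a = mdenote l b.
Proof.
  intros H; rewrite !mdenote_lincomb; apply lincomb_ext.
  revert H; induction (length l) as [|n IH]; intros H i hi; [lia|].
  destruct H as [h1 h2]; destruct (Nat.eq_dec i n) as [->|]; [exact h1|apply IH; [exact h2|lia]].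
Qed.
End ModuleReflection.

Ltac mem_index x l :=
  match l with
  | cons x _ => constr:(O)
  | cons _ ?l' => let n := mem_index x l' in constr:(S n)
  end.
Ltac madd x l :=
  match l with
  | context [cons x _] => l
  | _ => constr:(cons x l)
  end.
Ltac matoms e l :=
  lazymatch e with
  | zero => l
  | plus ?a ?b => let l := matoms a l in matoms b l
  | minus ?a ?b => let l := matoms a l in matoms b l
  | opp ?a => matoms a l
  | scal _ ?a => matoms a l
  | _ => madd e l
  end.
Ltac mreify e l :=
  lazymatch e with
  | zero => constr:(MZero)
  | plus ?a ?b => let a := mreify a l in let b := mreify b l in constr:(MPlus a b)
  | minus ?a ?b => let a := mreify a l in let b := mreify b l in constr:(MMinus a b)
  | opp ?a => let a := mreify a l in constr:(MOpp a)
  | scal ?k ?a => let a := mreify a l in constr:(MScal k a)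
  | _ => let n := mem_index e l in constr:(MAtom n)
  end.
(** Decides equalities between C-linear combinations, leaving the comparison of
    the coefficients that [ring] does not settle. *)
Ltac mod_eq V :=
  lazymatch goal with
  | |- ?a = ?b =>
    let l := matoms a (@nil V) in let l := matoms b l in
    let ea := mreify a l in let eb := mreify b l in
    refine (@msame_correct V l ea eb _); cbn [msame mcoef length Nat.eqb];
    repeat split; try ring
  end.

(** * Chain integrals *)

Section ContinuousC.
Variable T : UniformSpace.
Implicit Types (f g : T -> C) (x : T).

Lemma continuous_pair (U W : UniformSpace) (f : T -> U) (g : T -> W) (x : T) :
  continuous f x -> continuous g x -> continuous (fun y => (f y, g y)) x.
Proof.
  intros hf hg; pose proof (proj1 (filterlim_locally f (f x)) hf) as hf'; pose proof (proj1 (filterlim_locally g (g x)) hg) as hg'.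
  apply (proj2 (filterlim_locally (U := prod_UniformSpace U W) (fun y => (f y, g y)) (f x, g x))); intros e.
  generalize (filter_and _ _ (hf' e) (hg' e)); apply filter_imp; intros y [h1 h2]; split; assumption.
Qed.

Lemma continuous_Re (f : T -> C) x : continuous (U := CU) f x -> continuous (fun y => Re (f y)) x.
Proof. intros h; apply (continuous_comp f (fst : CU -> R) x h), continuous_fst. Qed.

Lemma continuous_Im (f : T -> C) x : continuous (U := CU) f x -> continuous (fun y => Im (f y)) x.
Proof. intros h; apply (continuous_comp f (snd : CU -> R) x h), continuous_snd. Qed.

Lemma continuous_Cplus f g x : continuous (U := CU) f x -> continuous (U := CU) g x ->
  continuous (U := CU) (fun y => Cplus (f y) (g y)) x.
Proof. exact (@continuous_plus _ _ C_NormedModule f g x). Qed.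

Lemma continuous_Copp f x : continuous (U := CU) f x ->
  continuous (U := CU) (fun y => Copp (f y)) x.
Proof. exact (@continuous_opp _ _ C_NormedModule f x). Qed.

Lemma continuous_Cminus f g x : continuous (U := CU) f x -> continuous (U := CU) g x ->
  continuous (U := CU) (fun y => Cminus (f y) (g y)) x.
Proof. exact (@continuous_minus _ _ C_NormedModule f g x). Qed.

Lemma continuous_Cmult f g x : continuous (U := CU) f x -> continuous (U := CU) g x ->
  continuous (U := CU) (fun y => Cmult (f y) (g y)) x.
Proof. exact (@continuous_scal_C _ C_NormedModule f g x). Qed.

Lemma continuous_Cinv f x : f x <> RtoC 0 -> continuous (U := CU) f x ->
  continuous (U := CU) (fun y => Cinv (f y)) x.
Proof.
  intros h0 hf.
  assert (hn : Re (f x) ^ 2 + Im (f x) ^ 2 <> 0).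
  { intros h; apply h0; destruct (f x) as [a b]; unfold Re, Im in h; simpl in h.
    assert (a = 0 /\ b = 0) as [-> ->] by (split; nra); reflexivity. }
  pose proof (continuous_Re hf) as hr; pose proof (continuous_Im hf) as hi.
  assert (hd : continuous (fun y : T => / (Re (f y) ^ 2 + Im (f y) ^ 2)) x).
  { apply (continuous_comp (U := T) (V := R_UniformSpace) (W := R_UniformSpace) (fun y : T => (Re (f y) ^ 2 + Im (f y) ^ 2)%R) Rinv); [|apply continuous_Rinv, hn].
    apply (continuous_plus (V := R_NormedModule) (fun y : T => Re (f y) ^ 2) (fun y => Im (f y) ^ 2)); simpl;
      apply (continuous_mult (K := R_AbsRing)); try assumption; apply (continuous_mult (K := R_AbsRing)); try assumption; apply continuous_const. }
  apply (continuous_pair (f := fun y : T => Re (f y) / (Re (f y) ^ 2 + Im (f y) ^ 2)) (g := fun y : T => - Im (f y) / (Re (f y) ^ 2 + Im (f y) ^ 2))).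
  - apply (continuous_mult (K := R_AbsRing)); assumption.
  - apply (continuous_mult (K := R_AbsRing)); [apply (continuous_opp (V := R_NormedModule))|]; assumption.
Qed.

Lemma continuous_Cdiv f g x : g x <> RtoC 0 -> continuous (U := CU) f x ->
  continuous (U := CU) g x -> continuous (U := CU) (fun y => Cdiv (f y) (g y)) x.
Proof. intros; apply continuous_Cmult; [|apply continuous_Cinv]; assumption. Qed.

Lemma continuous_linear (K : AbsRing) (V W : NormedModule K) (l : V -> W) (f : T -> V) (x : T) :
  is_linear l -> continuous f x -> continuous (fun y => l (f y)) x.
Proof.
  intros hl hf; apply (continuous_comp f l x hf), linear_cont, hl.
Qed.
End ContinuousC.

Lemma continuous_Csub (c : C) (z : CU) : continuous (T := CU) (U := CU) (fun y => Cminus y c) z.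
Proof. apply continuous_Cminus; [exact (continuous_id z)|exact (continuous_const c z)]. Qed.

Lemma continuous_C_iff (V : NormedModule C_AbsRing) (f : C -> V) (z : C) :
  continuous (T := CU) f z <->
  forall e, 0 < e -> exists d, 0 < d /\ forall y, Cmod (y - z) < d -> norm (minus (f y) (f z)) < e.
Proof.
  rewrite (continuous_norm_iff (T := CU)); split; intros H e e0.
  - apply locally_Cmod, H, e0. - apply locally_Cmod, H, e0.
Qed.

Lemma open_Cmod (U : C -> Prop) :
  open (U : CU -> Prop) <-> forall z, U z -> exists d, 0 < d /\ forall y, Cmod (y - z) < d -> U y.
Proof.
  split; intros H z hz; [apply locally_Cmod, H, hz|apply locally_Cmod, H, hz].
Qed.

(** Retraction of the line onto [[0, 1]]. Arcs are controlled on [[0, 1]] only; composing with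
    [clamp] makes their data continuous on all of R, as [RInt_swap] requires. *)
Definition clamp (t : R) : R := Rmax 0 (Rmin 1 t).

Lemma clamp_range t : 0 <= clamp t <= 1.
Proof. unfold clamp, Rmax, Rmin; repeat destruct Rle_dec; lra. Qed.

Lemma clamp_id t : 0 <= t <= 1 -> clamp t = t.
Proof. intros h; unfold clamp; rewrite Rmin_right, Rmax_right; lra. Qed.

Lemma clamp_continuous t : continuous clamp t.
Proof.
  unfold continuous; rewrite filterlim_locally; intros e; exists e; intros y hy.
  change (Rabs (clamp y - clamp t) < e); change (Rabs (y - t) < e) in hy.
  apply Rle_lt_trans with (2 := hy).
  unfold clamp, Rmax, Rmin; repeat destruct Rle_dec; unfold Rabs; repeat destruct Rcase_abs; lra.
Qed.

Lemma arc_continuous (g : C1_arc) t : 0 <= t <= 1 -> continuous (U := CU) g t.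
Proof.
  intros ht; apply (ex_derive_continuous (K := R_AbsRing) (V := C_R_NormedModule)).
  exists (darc g t); apply arc_is_derive, ht.
Qed.

Lemma continuous_clamp (U : UniformSpace) (f : R -> U) t :
  (forall t, 0 <= t <= 1 -> continuous f t) -> continuous (fun t => f (clamp t)) t.
Proof.
  intros H; apply (continuous_comp clamp f t); [apply clamp_continuous|apply H, clamp_range].
Qed.

Lemma trace_arc (g : C1_arc) G t : In g G -> 0 <= t <= 1 -> trace G (g t).
Proof. intros hg ht; exists g; split; [exact hg|exists t; split; [exact ht|reflexivity]]. Qed.

Section ChainIntegral.
Variable V : CompleteNormedModule C_AbsRing.

(** Total counterparts of the relations [is_arc_int] and [is_chain_int], identified with them by
    [is_chain_int_unique]. *)
Definition arc_int (F : C -> V) (g : C1_arc) : V :=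
  RInt (V := real_module V) (fun t => scal (darc g t : C_AbsRing) (F (g t))) 0 1.

Fixpoint chain_int (F : C -> V) (G : chain) : V :=
  match G with
  | nil => zero
  | g :: G' => plus (arc_int F g) (chain_int F G')
  end.

Definition cont_on (S : C -> Prop) (F : C -> V) : Prop :=
  forall z, S z -> continuous (T := CU) F z.

Lemma arc_integrand_continuous (F : C -> V) (g : C1_arc) :
  (forall t, 0 <= t <= 1 -> continuous (T := CU) F (g t)) ->
  forall t, 0 <= t <= 1 -> continuous (fun t => scal (darc g t : C_AbsRing) (F (g t))) t.
Proof.
  intros hF t ht; apply continuous_scal_C; [apply darc_continuous, ht|].
  apply (continuous_comp (g : R -> CU) F t); [apply arc_continuous, ht|apply hF, ht].
Qed.

Lemma ex_RInt_01 (f : R -> V) : (forall t, 0 <= t <= 1 -> continuous f t) ->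
  ex_RInt (V := restrict_R V) f 0 1.
Proof.
  intros h; apply (@ex_RInt_continuous (real_module V)).
  rewrite Rmin_left, Rmax_right by lra; exact h.
Qed.

Lemma cont_on_arc F g G : In g G -> cont_on (trace G) F ->
  forall t, 0 <= t <= 1 -> continuous (T := CU) F (g t).
Proof. intros hg hF t ht; apply hF, trace_arc; assumption. Qed.

Lemma cont_on_tail F g G : cont_on (trace (g :: G)) F -> cont_on (trace G) F.
Proof. intros h z [g' [hg' ht]]; apply h; exists g'; split; [right; exact hg'|exact ht]. Qed.

Lemma is_chain_int_unique F G I : is_chain_int F G I -> I = chain_int F G.
Proof.
  revert I; induction G as [|g G IH]; simpl; intros I; [tauto|].
  intros [I1 [I2 [h1 [h2 ->]]]]; rewrite (IH _ h2); f_equal; symmetry.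
  apply (is_RInt_unique (V := real_module V)), h1.
Qed.

Lemma chain_int_ext F F' G : (forall z, trace G z -> F z = F' z) -> chain_int F G = chain_int F' G.
Proof.
  induction G as [|g G IH]; simpl; intros H; [reflexivity|]; f_equal.
  - apply (RInt_ext (V := real_module V)); rewrite Rmin_left, Rmax_right by lra; intros t ht.
    rewrite H; [reflexivity|apply (trace_arc (G := g :: G)); [left; reflexivity|lra]].
  - apply IH; intros z [g' [hg' ht]]; apply H; exists g'; split; [right; exact hg'|exact ht].
Qed.

Lemma chain_int_plus F F' G : cont_on (trace G) F -> cont_on (trace G) F' ->
  chain_int (fun z => plus (F z) (F' z)) G = plus (chain_int F G) (chain_int F' G).
Proof.
  induction G as [|g G IH]; simpl; intros hF hF'; [symmetry; apply plus_zero_r|].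
  rewrite IH by (eapply cont_on_tail; eassumption).
  assert (e : arc_int (fun z => plus (F z) (F' z)) g = plus (arc_int F g) (arc_int F' g)).
  { unfold arc_int; etransitivity; [|apply (RInt_plus (V := real_module V));
      apply ex_RInt_01, arc_integrand_continuous; eapply (cont_on_arc (G := g :: G)); [left; reflexivity| eassumption |left; reflexivity| eassumption]].
    apply (RInt_ext (V := real_module V)); intros t _; exact (scal_distr_l (darc g t : C_AbsRing) (F (g t)) (F' (g t))). }
  rewrite e; mod_eq V.
Qed.
End ChainIntegral.

(** A linear map sends Riemann sums to Riemann sums, and being bounded it passes to their limit. *)
Lemma is_RInt_linear (V W : NormedModule R_AbsRing) (l : V -> W) (f : R -> V) a b I :
  is_linear l -> is_RInt f a b I -> is_RInt (fun t => l (f t)) a b (l I).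
Proof.
  intros hl h; unfold is_RInt in h |- *.
  apply filterlim_ext with (2 := filterlim_comp _ _ _ _ _ _ _ _ h (linear_cont l I hl)); intros ptd.
  rewrite (linear_scal _ hl); f_equal.
  apply (SF_cons_ind (fun s => l (Riemann_sum f s) = Riemann_sum (fun t => l (f t)) s)).
  - intros x0; apply (linear_zero l hl).
  - intros h0 s0 e; rewrite !Riemann_sum_cons, (linear_plus _ hl), (linear_scal _ hl), e; reflexivity.
Qed.

Lemma RInt_linear (V W : CompleteNormedModule C_AbsRing) (l : V -> W) (f : R -> V) :
  is_linear l -> (forall t, 0 <= t <= 1 -> continuous f t) ->
  RInt (V := real_module W) (fun t => l (f t)) 0 1 = l (RInt (V := real_module V) f 0 1).
Proof.
  intros hl hf; apply (is_RInt_unique (V := real_module W)).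
  apply (is_RInt_linear (V := restrict_R V) (W := restrict_R W) (l := l)).
  - split; [apply (linear_plus _ hl)|intros k x; apply (linear_scal _ hl)|exact (linear_norm _ hl)].
  - apply (RInt_correct (V := real_module V)), ex_RInt_01, hf.
Qed.

Lemma is_linear_scal_C (V : NormedModule C_AbsRing) (k : C) : is_linear (fun v : V => scal (k : C_AbsRing) v).
Proof. apply is_linear_scal_r, Cmult_comm. Qed.

Lemma chain_int_linear (V W : CompleteNormedModule C_AbsRing) (l : V -> W) (F : C -> V) G :
  is_linear l -> cont_on (trace G) F -> chain_int (fun z => l (F z)) G = l (chain_int F G).
Proof.
  intros hl; induction G as [|g G IH]; simpl; intros hF; [symmetry; apply (linear_zero l hl)|].
  rewrite (linear_plus _ hl), IH by (eapply cont_on_tail; eassumption); f_equal.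
  unfold arc_int; rewrite <- (RInt_linear hl).
  - apply (RInt_ext (V := real_module W)); intros t _; symmetry; apply (linear_scal _ hl).
  - apply (arc_integrand_continuous (cont_on_arc (in_eq g G) hF)).
Qed.

(** [L] adds up bounds of the velocities, so it is chosen before the module and the integrand and
    serves scalar and operator integrals alike. *)
Lemma chain_int_bound (G : chain) : exists L, 0 <= L /\
  forall (V : CompleteNormedModule C_AbsRing) (F : C -> V) (M : R), 0 <= M ->
    cont_on (trace G) F -> (forall z, trace G z -> norm (F z) <= M) -> norm (chain_int F G) <= L * M.
Proof.
  induction G as [|g G [L [L0 IH]]].
  { exists 0; split; [lra|intros V F M _ _ _; rewrite Rmult_0_l; right; exact (@norm_zero _ V)]. }
  destruct (bounded_continuity (V := C_NormedModule) (darc g) 0 1 (darc_continuous (c := g))) as [D HD].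
  assert (D0 : 0 <= D).
  { apply Rlt_le, Rle_lt_trans with (2 := HD 0 ltac:(lra)); apply norm_ge_0. }
  exists (D + L); split; [lra|intros V F M M0 hF hM; simpl].
  apply Rle_trans with (1 := @norm_triangle _ V (arc_int F g) (chain_int F G)).
  rewrite Rmult_plus_distr_r; apply Rplus_le_compat.
  - unfold arc_int.
    pose proof (cont_on_arc (g := g) (in_eq g G) hF) as hg.
    apply Rle_trans with (D * M * (1 - 0)); [|lra].
    apply (norm_RInt_const (V := real_module V)); [lra|apply arc_integrand_continuous, hg|].
    intros t ht; apply Rle_trans with (1 := norm_scal (darc g t : C_AbsRing) (F (g t))).
    apply Rmult_le_compat; [apply abs_ge_0|apply norm_ge_0| |].
    + apply Rlt_le, HD, ht.
    + apply hM, (trace_arc (G := g :: G)); [left; reflexivity|exact ht].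
  - apply IH; [exact M0|exact (cont_on_tail hF)|].
    intros z [g' [hg' ht]]; apply hM; exists g'; split; [right; exact hg'|exact ht].
Qed.

Lemma chain_int_param (V : CompleteNormedModule C_AbsRing) (T : UniformSpace) (F : T -> C -> V) G (s0 : T) :
  locally s0 (fun s => forall z, trace G z -> continuous (T := prod_UniformSpace T CU) (fun p => F (fst p) (snd p)) (s, z)) ->
  continuous (fun s => chain_int (F s) G) s0.
Proof.
  induction G as [|g G IH]; simpl; intros H; [apply continuous_const|].
  apply (continuous_plus (V := V)).
  - apply (continuous_RInt_param (V := real_module V) (F := fun t s => scal (darc g t : C_AbsRing) (F s (g t)))); [lra|].
    revert H; apply filter_imp; intros s hs t ht.
    apply (@continuous_scal_C (prod_UniformSpace R_UniformSpace T) V (fun p => darc g (fst p)) (fun p => F (snd p) (g (fst p))) (t, s)).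
    + apply (continuous_comp fst (darc g : R -> CU)); [apply continuous_fst|apply darc_continuous, ht].
    + apply (continuous_comp_2 snd (fun p => g (fst p) : CU) F).
      * apply continuous_snd.
      * apply (continuous_comp fst (g : R -> CU)); [apply continuous_fst|apply arc_continuous, ht].
      * apply hs, (trace_arc (G := g :: G)); [left; reflexivity|exact ht].
  - apply IH; revert H; apply filter_imp; intros s hs z [g' [hg' ht]]; apply hs; exists g'; split; [right; exact hg'|exact ht].
Qed.

(** * Fubini's theorem for chain integrals *)

Section Swap.
Variable V : CompleteNormedModule C_AbsRing.
Variables D1 D2 : C -> Prop.
Hypothesis D1_open : open (D1 : CU -> Prop).
Hypothesis D2_open : open (D2 : CU -> Prop).
Variable F : C -> C -> V.
Hypothesis F_cont : forall z w, D1 z -> D2 w ->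
  continuous (T := CU2) (fun p => F (fst p) (snd p)) (z, w).

Lemma continuous_flip z w : D1 z -> D2 w ->
  continuous (T := CU2) (fun p => F (snd p) (fst p)) (w, z).
Proof.
  intros hz hw; apply (continuous_comp_2 sndC fst F (w, z)).
  - apply continuous_snd. - apply continuous_fst. - apply F_cont; assumption.
Qed.

Lemma cont_on_chain_int G1 : (forall z, trace G1 z -> D1 z) ->
  cont_on D2 (fun w => chain_int (fun z => F z w) G1).
Proof.
  intros h1 w hw; apply (chain_int_param (T := CU) (F := fun w z => F z w)).
  generalize (D2_open hw); apply filter_imp; intros w' hw' z hz; apply continuous_flip; [apply h1|]; assumption.
Qed.

Lemma cont_on_chain_int2 G2 : (forall w, trace G2 w -> D2 w) ->
  cont_on D1 (fun z => chain_int (fun w => F z w) G2).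
Proof.
  intros h1 w hw; apply (chain_int_param (T := CU) (F := F)).
  generalize (D1_open hw); apply filter_imp; intros w' hw' z hz; apply F_cont; [|apply h1]; assumption.
Qed.

Lemma cont_on_slice1 w : D2 w -> cont_on D1 (fun z => F z w).
Proof. intros hw z hz; apply (continuous_slice (S := CU) (T := CU)), F_cont; assumption. Qed.

Lemma cont_on_slice2 z : D1 z -> cont_on D2 (fun w => F z w).
Proof. intros hz w hw; apply (continuous_slice2 (S := CU) (T := CU)), F_cont; assumption. Qed.

Lemma arc_int_swap (g1 g2 : C1_arc) : (forall t, 0 <= t <= 1 -> D1 (g1 t)) -> (forall t, 0 <= t <= 1 -> D2 (g2 t)) ->
  arc_int (fun w => arc_int (fun z => F z w) g1) g2 = arc_int (fun z => arc_int (fun w => F z w) g2) g1.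
Proof.
  intros h1 h2; unfold arc_int.
  (* Clamping leaves the integrand unchanged on the unit square and makes it continuous on the
     plane. *)
  set (F' (t s : R) := scal (darc g1 (clamp t) : C_AbsRing) (scal (darc g2 (clamp s) : C_AbsRing) (F (g1 (clamp t)) (g2 (clamp s))))).
  assert (hF' : forall t s, continuous (fun p : R * R => F' (fst p) (snd p)) (t, s)).
  { intros t s; unfold F'.
    assert (hd : forall (g : C1_arc) t, continuous (U := CU) (fun t => darc g (clamp t)) t).
    { intros g t'; apply (continuous_clamp (U := CU)), darc_continuous. }
    assert (hg : forall (g : C1_arc) t, continuous (U := CU) (fun t => g (clamp t)) t).
    { intros g t'; apply (continuous_clamp (U := CU)), arc_continuous. }
    apply continuous_scal_C; [|apply continuous_scal_C].
    - apply (continuous_comp fst (fun t => darc g1 (clamp t) : CU)); [apply continuous_fst|apply hd].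
    - apply (continuous_comp snd (fun t => darc g2 (clamp t) : CU)); [apply continuous_snd|apply hd].
    - apply (continuous_comp_2 (fun p : R * R => g1 (clamp (fst p)) : CU) (fun p => g2 (clamp (snd p)) : CU) F (t, s)).
      + apply (continuous_comp fst (fun t => g1 (clamp t) : CU)); [apply continuous_fst|apply hg].
      + apply (continuous_comp snd (fun t => g2 (clamp t) : CU)); [apply continuous_snd|apply hg].
      + apply F_cont; [apply h1, clamp_range|apply h2, clamp_range]. }
  transitivity (RInt (V := real_module V) (fun s => RInt (V := real_module V) (fun t => F' t s) 0 1) 0 1).
  - apply (RInt_ext (V := real_module V)); rewrite Rmin_left, Rmax_right by lra; intros s hs.
    rewrite <- (RInt_linear (is_linear_scal_C V _)).
    + apply (RInt_ext (V := real_module V)); rewrite Rmin_left, Rmax_right by lra; intros t ht.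
      unfold F'; rewrite !clamp_id by lra; mod_eq V.
    + apply (arc_integrand_continuous (V := V) (F := fun z => F z (g2 s))); intros t ht; apply cont_on_slice1; [apply h2; lra|apply h1, ht].
  - rewrite (RInt_swap (V := real_module V)) by (lra || exact hF').
    apply (RInt_ext (V := real_module V)); rewrite Rmin_left, Rmax_right by lra; intros t ht.
    rewrite <- (RInt_linear (is_linear_scal_C V _)).
    + apply (RInt_ext (V := real_module V)); rewrite Rmin_left, Rmax_right by lra; intros s hs.
      unfold F'; rewrite !clamp_id by lra; reflexivity.
    + apply (arc_integrand_continuous (V := V) (F := fun w => F (g1 t) w)); intros s hs; apply cont_on_slice2; [apply h1; lra|apply h2, hs].
Qed.

Lemma trace_cons (g : C1_arc) G z : trace (g :: G) z <-> (exists t, 0 <= t <= 1 /\ z = g t) \/ trace G z.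
Proof.
  split.
  - intros [g' [[<-|hg'] ht]]; [left; exact ht|right; exists g'; split; assumption].
  - intros [ht|[g' [hg' ht]]]; [exists g; split; [left; reflexivity|exact ht]|exists g'; split; [right; exact hg'|exact ht]].
Qed.

Lemma chain_int_const_zero G : chain_int (fun _ => zero : V) G = zero.
Proof.
  rewrite (@chain_int_linear V V (fun _ => zero) (fun _ => zero)); [reflexivity|exact (@is_linear_zero C_AbsRing V V)|].
  intros z _; apply continuous_const.
Qed.

Lemma chain_int_swap G1 G2 : (forall z, trace G1 z -> D1 z) -> (forall w, trace G2 w -> D2 w) ->
  chain_int (fun w => chain_int (fun z => F z w) G1) G2 = chain_int (fun z => chain_int (fun w => F z w) G2) G1.
Proof.
  intros h1 h2; induction G1 as [|g1 G1 IH1]; simpl; [apply chain_int_const_zero|].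
  assert (h1a : forall t, 0 <= t <= 1 -> D1 (g1 t)).
  { intros t ht; apply h1, trace_cons; left; exists t; split; [exact ht|reflexivity]. }
  assert (h1b : forall z, trace G1 z -> D1 z).
  { intros z hz; apply h1, trace_cons; right; exact hz. }
  (* An arc integral is the chain integral over a one-element chain, so the continuity already
     proved for chains applies. *)
  assert (ca : cont_on D2 (fun w => arc_int (fun z => F z w) g1)).
  { intros w hw; apply (continuous_ext (fun w => chain_int (fun z => F z w) (g1 :: nil))).
    - intros w'; simpl; apply plus_zero_r.
    - apply cont_on_chain_int; [|exact hw]; intros z hz; apply trace_cons in hz.
      destruct hz as [[t [ht ->]]|[g [[] _]]]; apply h1a, ht. }
  rewrite chain_int_plus, IH1 by (exact h1b || (intros w hw; apply ca, h2, hw) ||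
    (intros w hw; apply cont_on_chain_int; [exact h1b|apply h2, hw])).
  f_equal.
  clear IH1; induction G2 as [|g2 G2 IH2]; simpl.
  - unfold arc_int; symmetry; rewrite (RInt_ext (V := real_module V) _ (fun _ => zero)).
    + rewrite (RInt_const (V := real_module V)); apply (@scal_zero_r _ (restrict_R V)).
    + intros t _; apply (@scal_zero_r _ V).
  - assert (h2a : forall t, 0 <= t <= 1 -> D2 (g2 t)).
    { intros t ht; apply h2, trace_cons; left; exists t; split; [exact ht|reflexivity]. }
    assert (h2b : forall z, trace G2 z -> D2 z).
    { intros z hz; apply h2, trace_cons; right; exact hz. }
    rewrite IH2, arc_int_swap by assumption.
    assert (cb : forall t, 0 <= t <= 1 -> continuous (T := CU) (fun z => arc_int (fun w => F z w) g2) (g1 t)).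
    { intros t ht; apply (continuous_ext (fun z => chain_int (fun w => F z w) (g2 :: nil))).
      - intros w'; simpl; apply plus_zero_r.
      - apply cont_on_chain_int2; [|apply h1a, ht]; intros z hz; apply trace_cons in hz.
        destruct hz as [[s [hs ->]]|[g [[] _]]]; apply h2a, hs. }
    symmetry; unfold arc_int at 1; rewrite (RInt_ext (V := real_module V) _
      (fun t => plus (scal (darc g1 t : C_AbsRing) (arc_int (fun w => F (g1 t) w) g2)) (scal (darc g1 t : C_AbsRing) (chain_int (fun w => F (g1 t) w) G2)))).
    + apply (RInt_plus (V := real_module V)).
      * exact (ex_RInt_01 (V := V) (arc_integrand_continuous (V := V) (F := fun z => arc_int (fun w => F z w) g2) cb)).
      * apply (ex_RInt_01 (V := V)), (arc_integrand_continuous (V := V) (F := fun z => chain_int (fun w => F z w) G2)); intros t ht; apply cont_on_chain_int2; [exact h2b|apply h1a, ht].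
    + intros t _; apply (@scal_distr_l _ V).
Qed.
End Swap.

(** * Complex differentiability *)

(** Caratheodory's formulation turns the rules for derivatives into rules for continuous
    functions. *)
Definition cdiff (f : C -> C) (z d : C) : Prop :=
  exists p : C -> C, continuous (T := CU) (U := CU) p z /\ p z = d /\
    forall y, f y = Cplus (f z) (Cmult (p y) (Cminus y z)).

Lemma Cminus_eq_0 (a b : C) : Cminus a b = RtoC 0 -> a = b.
Proof. intros h; replace a with (Cplus (Cminus a b) b) by ring; rewrite h; ring. Qed.

Lemma Cminus_neq_0 (a b : C) : a <> b -> Cminus a b <> RtoC 0.
Proof. intros h h'; apply h, Cminus_eq_0, h'. Qed.

Lemma is_derive_C_iff (V : NormedModule R_AbsRing) (f : R -> V) (t : R) (l : V) :
  is_derive f t l <-> forall e, 0 < e -> exists d, 0 < d /\ forall s, Rabs (s - t) < d ->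
    norm (minus (minus (f s) (f t)) (scal (s - t) l)) <= e * Rabs (s - t).
Proof.
  split.
  - intros [_ h] e e0.
    destruct (h t (fun P H => H) (mkposreal e e0)) as [d hd].
    exists d; split; [apply cond_pos|exact hd].
  - intros h; split; [apply (is_linear_scal_l (K := R_AbsRing) (V := V))|].
    intros x hx e; apply (@is_filter_lim_locally_unique _ R_NormedModule) in hx; subst x.
    destruct (h e (cond_pos e)) as [d [d0 hd]]; exists (mkposreal d d0); exact hd.
Qed.

Lemma norm_C_R (z : C) : norm (z : C_R_NormedModule) = Cmod z.
Proof.
  destruct z as [a b].
  change (sqrt (Rabs a ^ 2 + Rabs b ^ 2) = sqrt (a ^ 2 + b ^ 2)); rewrite !pow2_abs; reflexivity.
Qed.

Lemma arc_derive (g : C1_arc) t : 0 <= t <= 1 ->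
  forall e, 0 < e -> exists d, 0 < d /\ forall s, Rabs (s - t) < d ->
    Cmod (Cminus (Cminus (g s) (g t)) (Cmult (RtoC (s - t)) (darc g t))) <= e * Rabs (s - t).
Proof.
  intros ht e e0; destruct (proj1 (is_derive_C_iff _ _ _) (@arc_is_derive g t ht) e e0) as [d [d0 hd]].
  exists d; split; [exact d0|intros s hs; specialize (hd s hs)].
  rewrite norm_C_R in hd.
  replace (Cminus (Cminus (g s) (g t)) (Cmult (RtoC (s - t)) (darc g t)))
    with (minus (minus (g s) (g t)) (scal (s - t) (darc g t) : C_R_NormedModule) : C_R_NormedModule); [exact hd|].
  apply injective_projections; simpl; unfold minus, plus, opp, scal, mult; simpl; unfold mult; simpl; ring.
Qed.

Lemma Cmod_minus_sym a b : Cmod (Cminus a b) = Cmod (Cminus b a).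
Proof. rewrite <- Cmod_opp; f_equal; ring. Qed.

Lemma is_derive_comp_arc (P : C -> C) (g : C1_arc) t d : 0 <= t <= 1 -> cdiff P (g t) d ->
  is_derive (V := restrict_R C_NormedModule) (fun s => P (g s)) t (Cmult (darc g t) d).
Proof.
  intros ht [p [hp [<- hP]]]; apply is_derive_C_iff; intros e e0.
  pose proof (continuous_comp (g : R -> CU) (p : CU -> CU) t (@arc_continuous g t ht) hp) as hc.
  (* [M] bounds the slope [p] along the arc near [t], and [N] bounds the velocity at [t]; the [+ 1]
     also makes both positive. *)
  set (M := Cmod (p (g t)) + 1); set (N := Cmod (darc g t) + 1).
  assert (hM : 0 < M) by (unfold M; pose proof (Cmod_ge_0 (p (g t))); lra).
  assert (hN : 0 < N) by (unfold N; pose proof (Cmod_ge_0 (darc g t)); lra).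
  pose proof (proj1 (continuous_norm_iff (V := C_NormedModule) _ _) hc) as hc'.
  destruct (hc' 1 Rlt_0_1) as [d1 h1].
  destruct (hc' (e / (2 * N))) as [d2 h2]; [apply Rdiv_lt_0_compat; lra|].
  destruct (@arc_derive g t ht (e / (2 * M))) as [d3 [d30 h3]]; [apply Rdiv_lt_0_compat; lra|].
  exists (Rmin (Rmin d1 d2) d3); split; [repeat apply Rmin_pos; try apply cond_pos; exact d30|].
  intros s hs.
  specialize (h1 s (Rlt_le_trans _ _ _ hs (Rle_trans _ _ _ (Rmin_l _ _) (Rmin_l _ _)))).
  specialize (h2 s (Rlt_le_trans _ _ _ hs (Rle_trans _ _ _ (Rmin_l _ _) (Rmin_r _ _)))).
  specialize (h3 s (Rlt_le_trans _ _ _ hs (Rmin_r _ _))).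
  change (Cmod (Cminus (p (g s)) (p (g t))) < 1) in h1.
  change (Cmod (Cminus (p (g s)) (p (g t))) < e / (2 * N)) in h2.
  change (Cmod (Cminus (Cminus (P (g s)) (P (g t))) (Cmult (RtoC (s - t)) (Cmult (darc g t) (p (g t))))) <= e * Rabs (s - t)).
  rewrite (hP (g s)).
  replace (Cminus _ (Cmult (RtoC (s - t)) (Cmult (darc g t) (p (g t))))) with
    (Cplus (Cmult (p (g s)) (Cminus (Cminus (g s) (g t)) (Cmult (RtoC (s - t)) (darc g t))))
       (Cmult (RtoC (s - t)) (Cmult (Cminus (p (g s)) (p (g t))) (darc g t)))) by ring.
  apply Rle_trans with (1 := Cmod_triangle _ _).
  rewrite !Cmod_mult, Cmod_R.
  assert (hps : Cmod (p (g s)) <= M).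
  { unfold M; replace (p (g s)) with (Cplus (p (g t)) (Cminus (p (g s)) (p (g t)))) by ring.
    apply Rle_trans with (1 := Cmod_triangle _ _); lra. }
  pose proof (Rabs_pos (s - t)); pose proof (Cmod_ge_0 (darc g t)).
  apply Rle_trans with (M * (e / (2 * M) * Rabs (s - t)) + Rabs (s - t) * (e / (2 * N) * N)).
  - apply Rplus_le_compat.
    + apply Rmult_le_compat; [apply Cmod_ge_0|apply Cmod_ge_0|exact hps|exact h3].
    + apply Rmult_le_compat_l; [assumption|].
      apply Rmult_le_compat; [apply Cmod_ge_0|apply Cmod_ge_0|lra|unfold N; lra].
  - right; field; lra.
Qed.

Lemma arc_int_derive (P F : C -> C) (g : C1_arc) :
  (forall t, 0 <= t <= 1 -> cdiff P (g t) (F (g t))) ->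
  (forall t, 0 <= t <= 1 -> continuous (T := CU) (U := CU) F (g t)) ->
  arc_int (V := CV) F g = Cminus (P (g 1)) (P (g 0)).
Proof.
  intros hP hF; apply (is_RInt_unique (V := real_module CV)).
  apply (is_RInt_derive (V := real_module CV) (fun t => P (g t)));
    rewrite Rmin_left, Rmax_right by lra; intros t ht.
  - exact (is_derive_comp_arc ht (hP t ht)).
  - exact (arc_integrand_continuous (V := CV) hF ht).
Qed.

Fixpoint Csum (l : list C) : C := match l with nil => RtoC 0 | x :: l => Cplus x (Csum l) end.

Lemma Csum_perm l l' : Permutation l l' -> Csum l = Csum l'.
Proof. induction 1; simpl; [reflexivity|congruence|ring|congruence]. Qed.

(** The integral is the sum of [P] over the ends of the arcs minus the sum over their origins, and a
    vanishing boundary says that these are the same points with the same multiplicities. *)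
Lemma chain_int_derive (P F : C -> C) (G : chain) : is_cycle G ->
  (forall z, trace G z -> cdiff P z (F z)) -> cont_on (V := CV) (trace G) F ->
  chain_int (V := CV) F G = RtoC 0.
Proof.
  intros hG hP hF.
  assert (h : chain_int (V := CV) F G = Cminus (Csum (map P (map (fun g : C1_arc => g 1) G))) (Csum (map P (map (fun g : C1_arc => g 0) G)))).
  { clear hG; induction G as [|g G IH]; [simpl; change (RtoC 0 = Cminus (RtoC 0) (RtoC 0)); ring|].
    simpl; rewrite IH.
    - rewrite (@arc_int_derive P F g).
      + assert (e : forall a b c d : C, Cplus (Cminus a b) (Cminus c d) = Cminus (Cplus a c) (Cplus b d)) by (intros; ring).
        apply e.
      + intros t ht; apply hP, (trace_arc (G := g :: G)); [apply in_eq|exact ht].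
      + intros t ht; apply hF, (trace_arc (G := g :: G)); [apply in_eq|exact ht].
    - intros z hz; apply hP, trace_cons; right; exact hz.
    - intros z hz; apply hF, trace_cons; right; exact hz. }
  rewrite h, (Csum_perm (Permutation_map P hG)); exact (Cplus_opp_r _).
Qed.

Lemma cdiff_id z : cdiff (fun y => y) z (RtoC 1).
Proof.
  exists (fun _ => RtoC 1); split; [apply continuous_const|split; [reflexivity|intros; ring]].
Qed.

Lemma cdiff_const c z : cdiff (fun _ => c) z (RtoC 0).
Proof.
  exists (fun _ => RtoC 0); split; [apply continuous_const|split; [reflexivity|intros; ring]].
Qed.

Lemma cdiff_continuous f z d : cdiff f z d -> continuous (T := CU) (U := CU) f z.
Proof.
  intros [p [hp [_ hf]]].
  apply (continuous_ext (U := CU) (fun y => Cplus (f z) (Cmult (p y) (Cminus y z)))).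
  - intros y; symmetry; apply hf.
  - apply continuous_Cplus; [apply continuous_const|apply continuous_Cmult; [exact hp|]].
    apply continuous_Csub.
Qed.

Lemma cdiff_mult f g z d e : cdiff f z d -> cdiff g z e ->
  cdiff (fun y => Cmult (f y) (g y)) z (Cplus (Cmult d (g z)) (Cmult (f z) e)).
Proof.
  intros [p [hp [<- hf]]] cg; pose proof (cdiff_continuous cg) as hgc; destruct cg as [q [hq [<- hg]]].
  exists (fun y => Cplus (Cmult (p y) (g y)) (Cmult (f z) (q y))); split; [|split; [reflexivity|]].
  - apply continuous_Cplus; apply continuous_Cmult; try assumption; apply continuous_const.
  - intros y; rewrite (hf y), (hg y); ring.
Qed.

Lemma cdiff_minus f g z d e : cdiff f z d -> cdiff g z e -> cdiff (fun y => Cminus (f y) (g y)) z (Cminus d e).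
Proof.
  intros [p [hp [<- hf]]] [q [hq [<- hg]]]; exists (fun y => Cminus (p y) (q y)); split; [|split; [reflexivity|]].
  - apply continuous_Cminus; assumption.
  - intros y; rewrite (hf y), (hg y); ring.
Qed.

(** The factorisation in [cdiff] holds on all of C, so outside the disc where [f] and [g] agree the
    slope is replaced by the difference quotient of [g]. *)
Lemma cdiff_ext_loc f g z d : (exists e, 0 < e /\ forall y, Cmod (Cminus y z) < e -> f y = g y) -> cdiff f z d -> cdiff g z d.
Proof.
  intros [e [e0 he]] [p [hp [<- hf]]].
  assert (hz : f z = g z). { apply he; replace (Cminus z z) with (RtoC 0) by ring; rewrite Cmod_0; exact e0. }
  exists (fun y => if excluded_middle_informative (Cmod (Cminus y z) < e) then p y else Cdiv (Cminus (g y) (g z)) (Cminus y z)).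
  split; [|split].
  - apply (@continuous_ext_loc CU CU _ p z); [|exact hp].
    apply locally_Cmod; exists e; split; [exact e0|].
    intros y hy; destruct excluded_middle_informative; [reflexivity|contradiction].
  - destruct excluded_middle_informative as [_|h]; [reflexivity|].
    elim h; replace (Cminus z z) with (RtoC 0) by ring; rewrite Cmod_0; exact e0.
  - intros y; destruct excluded_middle_informative as [h|h].
    + rewrite <- (he y h), hf, hz; reflexivity.
    + field; apply Cminus_neq_0; intros ->; apply h.
      replace (Cminus z z) with (RtoC 0) by ring; rewrite Cmod_0; exact e0.
Qed.

Lemma Cmod_pos_neq z : 0 < Cmod z -> z <> RtoC 0.
Proof. intros h ->; rewrite Cmod_0 in h; lra. Qed.

Lemma continuous_C_nonzero (f : C -> C) z : continuous (T := CU) (U := CU) f z -> f z <> RtoC 0 ->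
  exists d, 0 < d /\ forall y, Cmod (Cminus y z) < d -> f y <> RtoC 0.
Proof.
  intros hf h0; pose proof (proj1 (Cmod_gt_0 (f z)) h0) as h.
  destruct (proj1 (continuous_C_iff (V := C_NormedModule) f z) hf _ h) as [d [d0 hd]].
  exists d; split; [exact d0|intros y hy e].
  specialize (hd y hy); change (Cmod (Cminus (f y) (f z)) < Cmod (f z)) in hd.
  rewrite e in hd; replace (Cminus (RtoC 0) (f z)) with (Copp (f z)) in hd by ring; rewrite Cmod_opp in hd; lra.
Qed.

Lemma cdiff_inv f z d : f z <> RtoC 0 -> cdiff f z d -> cdiff (fun y => Cinv (f y)) z (Copp (Cdiv d (Cmult (f z) (f z)))).
Proof.
  intros h0 cf; pose proof (cdiff_continuous cf) as hc; destruct cf as [p [hp [<- hf]]].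
  destruct (continuous_C_nonzero hc h0) as [e [e0 he]].
  set (q y := Copp (Cdiv (p y) (Cmult (f y) (f z)))).
  (* Far from [z] the function [f] may vanish, and the formula for the slope [q] is wrong there; it
     is verified on the disc where [f] has no zero. *)
  apply (@cdiff_ext_loc (fun y => Cplus (Cinv (f z)) (Cmult (q y) (Cminus y z)))).
  - exists e; split; [exact e0|intros y hy; specialize (he y hy); unfold q].
    assert (hd : Cmult (p y) (Cminus y z) = Cminus (f y) (f z)) by (rewrite (hf y); ring).
    replace (Cmult (Copp (Cdiv (p y) (Cmult (f y) (f z)))) (Cminus y z)) with
      (Copp (Cdiv (Cmult (p y) (Cminus y z)) (Cmult (f y) (f z)))) by (field; split; assumption).
    rewrite hd; field; split; assumption.
  - exists q; split; [|split; [reflexivity|intros y; ring]].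
    apply continuous_Copp, continuous_Cdiv; [apply Cmult_neq_0; assumption|exact hp|].
    apply continuous_Cmult; [exact hc|apply continuous_const].
Qed.

Lemma ex_derive_cdiff (f : C -> C) z l : is_derive (K := C_AbsRing) (V := C_NormedModule) f z l -> cdiff f z l.
Proof.
  intros [_ h].
  exists (fun y => if excluded_middle_informative (@eq C y z) then l else Cdiv (Cminus (f y) (f z)) (Cminus y z)).
  split; [|split].
  - apply (proj2 (continuous_C_iff (V := C_NormedModule) _ z)); intros e e0.
    assert (e2 : 0 < e / 2) by lra.
    destruct (h z (fun P H => H) (mkposreal _ e2)) as [d hd].
    exists d; split; [apply cond_pos|intros y hy; specialize (hd y hy)].
    destruct (excluded_middle_informative (@eq C z z)) as [_|n]; [|elim n; reflexivity].
    destruct (excluded_middle_informative (@eq C y z)) as [->|n].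
    + match goal with |- norm ?x < e => replace x with (zero : C_NormedModule) by (symmetry; exact (minus_eq_zero (G := C_AbelianGroup) l)) end; rewrite norm_zero; exact e0.
    + change (Cmod (Cminus (Cminus (f y) (f z)) (Cmult (Cminus y z) l)) <= e / 2 * Cmod (Cminus y z)) in hd.
      change (Cmod (Cminus (Cdiv (Cminus (f y) (f z)) (Cminus y z)) l) < e).
      pose proof (Cminus_neq_0 n) as n'; pose proof (proj1 (Cmod_gt_0 _) n').
      replace (Cminus (Cdiv (Cminus (f y) (f z)) (Cminus y z)) l) with
        (Cdiv (Cminus (Cminus (f y) (f z)) (Cmult (Cminus y z) l)) (Cminus y z)) by (field; exact n').
      rewrite Cmod_div by exact n'.
      apply Rle_lt_trans with (e / 2); [|lra].
      apply (Rmult_le_reg_r (Cmod (Cminus y z))); [assumption|].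
      unfold Rdiv at 1; rewrite Rmult_assoc, Rinv_l, Rmult_1_r by lra; exact hd.
  - destruct (excluded_middle_informative (@eq C z z)) as [_|n]; [reflexivity|elim n; reflexivity].
  - intros y; destruct (excluded_middle_informative (@eq C y z)) as [->|n]; [ring|].
    field; apply Cminus_neq_0, n.
Qed.

(** * Circles and geometric means *)

Lemma is_derive_pair (u v : R -> R) t (u' v' : R) : is_derive u t u' -> is_derive v t v' ->
  is_derive (V := C_R_NormedModule) (fun t => (u t, v t)) t (u', v').
Proof.
  intros hu hv; apply is_derive_C_iff; intros e e0.
  destruct (proj1 (is_derive_C_iff _ _ _) hu (e / 2)) as [d1 [d10 h1]]; [lra|].
  destruct (proj1 (is_derive_C_iff _ _ _) hv (e / 2)) as [d2 [d20 h2]]; [lra|].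
  exists (Rmin d1 d2); split; [apply Rmin_pos; assumption|intros s hs].
  specialize (h1 s (Rlt_le_trans _ _ _ hs (Rmin_l _ _))); specialize (h2 s (Rlt_le_trans _ _ _ hs (Rmin_r _ _))).
  rewrite norm_C_R.
  change (Cmod (minus (minus (u s) (u t)) (scal (s - t) u'), minus (minus (v s) (v t)) (scal (s - t) v')) <= e * Rabs (s - t)).
  set (a := minus (minus (u s) (u t)) (scal (s - t) u')) in *.
  set (b := minus (minus (v s) (v t)) (scal (s - t) v')) in *.
  change (Rabs a <= e / 2 * Rabs (s - t)) in h1; change (Rabs b <= e / 2 * Rabs (s - t)) in h2.
  replace ((a, b) : C) with (Cplus (RtoC a) (Cmult Ci (RtoC b))).
  - apply Rle_trans with (1 := Cmod_triangle _ _).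
    rewrite Cmod_mult, !Cmod_R, Cmod_Ci; lra.
  - apply injective_projections; simpl; ring.
Qed.

Definition cis (x : R) : C := (cos x, sin x).

Lemma cis_plus x y : cis (x + y) = Cmult (cis x) (cis y).
Proof. unfold cis; rewrite cos_plus, sin_plus; apply injective_projections; simpl; ring. Qed.

Lemma cis_0 : cis 0 = RtoC 1.
Proof. unfold cis; rewrite cos_0, sin_0; reflexivity. Qed.

Lemma Cmod_cis x : Cmod (cis x) = 1.
Proof.
  unfold Cmod, cis; simpl; transitivity (sqrt 1); [f_equal|apply sqrt_1].
  pose proof (sin2_cos2 x) as h; unfold Rsqr in h; lra.
Qed.

Lemma cis_neq_0 x : cis x <> RtoC 0.
Proof. apply Cmod_pos_neq; rewrite Cmod_cis; lra. Qed.

Lemma cis_opp x : cis (- x) = Cinv (cis x).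
Proof.
  assert (h : Cmult (cis x) (cis (- x)) = RtoC 1) by (rewrite <- cis_plus, Rplus_opp_r; apply cis_0).
  rewrite <- (Cmult_1_l (cis (- x))), <- (Cinv_l (cis x) (@cis_neq_0 x)), <- Cmult_assoc, h; ring.
Qed.

Lemma cis_period x (m : Z) : cis (x + 2 * PI * IZR m) = cis x.
Proof.
  assert (H : forall n : nat, cis (2 * PI * INR n) = RtoC 1).
  { intros n; rewrite <- cis_0; unfold cis.
    replace (2 * PI * INR n) with (0 + 2 * INR n * PI) by ring.
    rewrite cos_period, sin_period; reflexivity. }
  rewrite cis_plus; replace (cis (2 * PI * IZR m)) with (RtoC 1); [ring|].
  destruct m as [|p|p].
  - rewrite Rmult_0_r; symmetry; apply cis_0.
  - rewrite <- (positive_nat_Z p), <- (INR_IZR_INZ (Pos.to_nat p)); symmetry; apply H.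
  - replace (2 * PI * IZR (Z.neg p)) with (- (2 * PI * IZR (Z.pos p))).
    + rewrite cis_opp, <- (positive_nat_Z p), <- (INR_IZR_INZ (Pos.to_nat p)), H; field; apply C1_nz.
    + change (Z.neg p) with (- Z.pos p)%Z; rewrite opp_IZR; ring.
Qed.

Lemma is_derive_cis (k : R) (p r : C) t :
  is_derive (V := C_R_NormedModule) (fun t => Cplus p (Cmult r (cis (k * t)))) t (Cmult (Cmult (0, k) r) (cis (k * t))).
Proof.
  destruct p as [p1 p2]; destruct r as [r1 r2].
  apply (is_derive_pair (u := fun t => p1 + (r1 * cos (k * t) - r2 * sin (k * t)))
    (v := fun t => p2 + (r1 * sin (k * t) + r2 * cos (k * t)))); simpl; auto_derive; try exact I; ring.
Qed.

Lemma continuous_cis (k : R) t : continuous (U := CU) (fun t => cis (k * t)) t.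
Proof.
  apply (continuous_pair (f := fun t => cos (k * t)) (g := fun t => sin (k * t))).
  - apply (ex_derive_continuous (V := R_NormedModule)); auto_derive; exact I.
  - apply (ex_derive_continuous (V := R_NormedModule)); auto_derive; exact I.
Qed.

(** The angular speed is a parameter: [2 * PI] gives circles, [PI] the half circle of
    [derivative_not_locally_zero], and [2 * PI * IZR m] the orthogonality relation [RInt_cis]. *)
Definition circle_arc (k : R) (p r : C) : C1_arc :=
  @C1Arc (fun t => Cplus p (Cmult r (cis (k * t)))) (fun t => Cmult (Cmult (0, k) r) (cis (k * t)))
    (fun t _ => is_derive_cis k p r t)
    (fun t _ => continuous_Cmult (T := R_UniformSpace) (continuous_const _ _) (@continuous_cis k t)).

Definition circle (p : C) (r : R) : C1_arc := circle_arc (2 * PI) p (RtoC r).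

(** The velocity of the [m]-fold unit circle is [2 i pi m] times the integrand, and it integrates to
    zero because the arc closes up. *)
Lemma RInt_cis (m : Z) : (m <> 0)%Z ->
  RInt (V := real_module CV) (fun t => cis (2 * PI * IZR m * t)) 0 1 = RtoC 0.
Proof.
  intros hm.
  pose proof (@arc_int_derive (fun z => z) (fun _ => RtoC 1) (circle_arc (2 * PI * IZR m) (RtoC 0) (RtoC 1))
    (fun t _ => cdiff_id _) (fun t _ => continuous_const _ _)) as h.
  unfold arc_int in h; simpl in h.
  pose proof (@RInt_linear CV CV _ (fun t => cis (2 * PI * IZR m * t))
    (@is_linear_scal_C C_NormedModule (0, 2 * PI * IZR m)) (fun t _ => @continuous_cis _ _)) as h'.
  rewrite Rmult_1_r, Rmult_0_r in h.
  replace (cis (2 * PI * IZR m)) with (cis 0) in h by (rewrite <- (cis_period 0 m), Rplus_0_l; reflexivity).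
  match type of h with _ = ?r => assert (hr : r = RtoC 0 :> C) by ring end; rewrite hr in h.
  assert (e : Cmult (0, 2 * PI * IZR m) (RInt (V := real_module CV) (fun t => cis (2 * PI * IZR m * t)) 0 1) = RtoC 0).
  { etransitivity; [symmetry; exact h'|]. etransitivity; [|exact h].
    apply (RInt_ext (V := real_module CV)); intros t _.
    match goal with |- scal ?a ?b = scal ?c ?d => change (@eq C (Cmult a b) (Cmult c d)) end; ring. }
  assert (hn : (0, 2 * PI * IZR m) <> RtoC 0).
  { intros h0; injection h0; intros h1; apply Rmult_integral in h1; destruct h1 as [h1|h1].
    - pose proof PI_RGT_0; lra. - apply hm, eq_IZR, h1. }
  apply NNPP; intros hne; exact (Cmult_neq_0 _ _ hn hne e).
Qed.

Lemma is_linear_scal_C_l (V : NormedModule C_AbsRing) (v : V) :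
  is_linear (U := C_NormedModule) (fun c => scal (c : C_AbsRing) v).
Proof.
  pose proof (is_linear_scal_l v) as [h1 h2 h3]; split; [exact h1|exact h2|exact h3].
Qed.

Section GeometricMean.
Variable V : CompleteNormedModule C_AbsRing.

(** The recursion [phi = v + e L phi] with [e] of mean-zero powers is the resummed
    geometric series [sum_j e^j L^j v], of which only the term [j = 0] survives. *)
Lemma geometric_mean (phi : R -> V) (L : V -> V) (v : V) (q : R) (k : Z) :
  (k = 1 \/ k = -1)%Z ->
  (forall t, 0 <= t <= 1 -> continuous phi t) -> is_linear L -> 0 <= q < 1 ->
  (forall x, norm (L x) <= q * norm x) ->
  (forall t, 0 <= t <= 1 -> phi t = plus v (scal (cis (2 * PI * IZR k * t) : C_AbsRing) (L (phi t)))) ->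
  RInt (V := real_module V) phi 0 1 = v.
Proof.
  intros hk hc hL hq hn hphi.
  (* [a j] is a Fourier coefficient of [phi]. The equation for [phi] becomes [a j = L (a (S j))] for
     positive [j], whence [norm (a 1) <= q ^ n * M] for every [n]; and [a 0 = v + L (a 1) = v]. *)
  pose (a := (fun j : nat => RInt (V := real_module V) (fun t => scal (cis (2 * PI * IZR (k * Z.of_nat j) * t) : C_AbsRing) (phi t)) 0 1) : nat -> V).
  assert (cc : forall j t, 0 <= t <= 1 -> continuous (fun t => scal (cis (2 * PI * IZR (k * Z.of_nat j) * t) : C_AbsRing) (phi t)) t).
  { intros j t ht; apply continuous_scal_C; [apply continuous_cis|apply hc, ht]. }
  assert (rec : forall j, a j = plus (scal (RInt (V := real_module CV) (fun t => cis (2 * PI * IZR (k * Z.of_nat j) * t)) 0 1 : C_AbsRing) v) (L (a (S j)))).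
  { intros j; replace (L (a (S j))) with (RInt (V := real_module V) (fun t => L (scal (cis (2 * PI * IZR (k * Z.of_nat (S j)) * t) : C_AbsRing) (phi t))) 0 1) by exact (RInt_linear hL (cc (S j))).
    rewrite <- (@RInt_linear CV V (fun c => scal (c : C_AbsRing) v) (fun t => cis (2 * PI * IZR (k * Z.of_nat j) * t)) (@is_linear_scal_C_l V v) (fun t _ => @continuous_cis _ _)).
    rewrite <- (RInt_plus (V := real_module V)).
    - apply (RInt_ext (V := real_module V)); rewrite Rmin_left, Rmax_right by lra; intros t ht.
      rewrite (linear_scal _ hL), (hphi t) at 1 by lra.
      replace (2 * PI * IZR (k * Z.of_nat (S j)) * t) with (2 * PI * IZR (k * Z.of_nat j) * t + 2 * PI * IZR k * t).
      + rewrite cis_plus.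
        assert (E : forall (c d : C) (x y : V), scal (c : C_AbsRing) (plus x (scal (d : C_AbsRing) y)) = plus (scal (c : C_AbsRing) x) (scal (Cmult c d : C_AbsRing) y)) by (intros; mod_eq V).
        apply E.
      + rewrite Nat2Z.inj_succ, Z.mul_succ_r, plus_IZR; ring.
    - apply (ex_RInt_01 (V := V)); intros t ht; apply continuous_scal_C; [apply continuous_cis|apply continuous_const].
    - apply (ex_RInt_01 (V := V)); intros t ht; apply (continuous_linear hL), cc, ht. }
  destruct (bounded_continuity (V := V) phi 0 1 hc) as [M HM].
  assert (M0 : 0 <= M).
  { apply Rlt_le, Rle_lt_trans with (2 := HM 0 ltac:(lra)); apply norm_ge_0. }
  assert (ha : forall j, norm (a j) <= M).
  { intros j; replace M with (M * (1 - 0)) by ring.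
    apply (norm_RInt_const (V := real_module V)); [lra|apply cc|].
    intros t ht; apply Rle_trans with (1 := norm_scal _ (phi t)).
    change (Cmod (cis (2 * PI * IZR (k * Z.of_nat j) * t)) * norm (phi t) <= M).
    rewrite Cmod_cis, Rmult_1_l; apply Rlt_le, HM, ht. }
  assert (rec1 : forall j, a (S j) = L (a (S (S j)))).
  { intros j; rewrite rec, RInt_cis by lia; rewrite (scal_zero_l v : scal (RtoC 0 : C_AbsRing) v = zero).
    apply plus_zero_l. }
  assert (ha' : forall n j, norm (a (S j)) <= q ^ n * M).
  { induction n as [|n IH]; intros j; simpl; [rewrite Rmult_1_l; apply ha|].
    rewrite rec1; apply Rle_trans with (1 := hn _); rewrite Rmult_assoc; apply Rmult_le_compat_l; [lra|apply IH]. }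
  assert (a1 : a 1%nat = zero).
  { apply (@norm_eq_zero _ V), Rle_antisym; [|apply norm_ge_0].
    assert (hl : is_lim_seq (fun n => q ^ n * M) (0 * M)).
    { apply (is_lim_seq_scal_r (fun n => q ^ n) M 0), is_lim_seq_geom; rewrite Rabs_pos_eq; lra. }
    rewrite Rmult_0_l in hl.
    exact (is_lim_seq_le _ _ (Finite (norm (a 1%nat))) 0 (fun n => ha' n 0%nat) (is_lim_seq_const _) hl). }
  transitivity (a 0%nat).
  - apply (RInt_ext (V := real_module V)); intros t _.
    rewrite Z.mul_0_r, Rmult_0_r, Rmult_0_l, cis_0; symmetry; exact (scal_one (phi t)).
  - assert (a1' : L (a 1%nat) = zero) by (rewrite a1; apply (linear_zero L hL)).
    rewrite rec, a1', plus_zero_r.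
    rewrite (RInt_ext (V := real_module CV) _ (fun _ => RtoC 1)).
    + rewrite (RInt_const (V := real_module CV)).
      replace (scal (1 - 0) (RtoC 1 : real_module CV)) with (RtoC 1); [exact (scal_one v)|].
      rewrite Rminus_0_r; symmetry; exact (scal_one (RtoC 1 : real_module CV)).
    + intros t _; rewrite Z.mul_0_r, Rmult_0_r, Rmult_0_l; apply cis_0.
Qed.
End GeometricMean.

(** * Winding numbers *)

Definition circle_pt (p : C) (r t : R) : C := Cplus p (Cmult (RtoC r) (cis (2 * PI * t))).

Lemma Cmod_circle_pt p r t : 0 <= r -> Cmod (Cminus (circle_pt p r t) p) = r.
Proof.
  intros hr; unfold circle_pt; replace (Cminus _ p) with (Cmult (RtoC r) (cis (2 * PI * t))) by ring.
  rewrite Cmod_mult, Cmod_R, Cmod_cis, Rabs_pos_eq; lra.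
Qed.

Lemma continuous_circle_pt p r t : continuous (U := CU) (circle_pt p r) t.
Proof.
  apply continuous_Cplus; [apply continuous_const|].
  apply continuous_Cmult; [apply continuous_const|apply continuous_cis].
Qed.

Lemma trace_circle p r z : 0 <= r -> trace (circle p r :: nil) z -> Cmod (Cminus z p) = r.
Proof.
  intros hr hz; apply trace_cons in hz; destruct hz as [[t [_ ->]]|[g [[] _]]].
  exact (Cmod_circle_pt p t hr).
Qed.

Lemma two_pi_i_neq_0 : two_pi_i <> RtoC 0.
Proof. intros h; injection h; pose proof PI_RGT_0; lra. Qed.

Lemma scal_C_inj (V : NormedModule C_AbsRing) (k : C) (x y : V) : k <> RtoC 0 ->
  scal (k : C_AbsRing) x = scal (k : C_AbsRing) y -> x = y.
Proof.
  intros hk h.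
  assert (e : forall u : V, u = scal (Cinv k : C_AbsRing) (scal (k : C_AbsRing) u)).
  { intros u; mod_eq V; field; exact hk. }
  rewrite (e x), h, <- e; reflexivity.
Qed.

Section CircleMean.
Variable V : CompleteNormedModule C_AbsRing.

Definition cmean (F : C -> V) (p : C) (r : R) : V :=
  RInt (V := real_module V) (fun t => F (circle_pt p r t)) 0 1.

Lemma cmean_ext F F' p r : 0 <= r -> (forall z, Cmod (Cminus z p) = r -> F z = F' z) ->
  cmean F p r = cmean F' p r.
Proof.
  intros hr h; apply (RInt_ext (V := real_module V)); intros t _; apply h, Cmod_circle_pt, hr.
Qed.

Lemma continuous_circle_comp (F : C -> V) p r t : 0 <= r ->
  (forall z, Cmod (Cminus z p) = r -> continuous (T := CU) F z) ->
  continuous (fun t => F (circle_pt p r t)) t.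
Proof.
  intros hr h; apply (continuous_comp (circle_pt p r : R -> CU) F t).
  - apply continuous_circle_pt. - apply h, Cmod_circle_pt, hr.
Qed.

(** The velocity of the circle is [2 i pi (z - p)], which cancels the Cauchy kernel of the
    centre. *)
Lemma circle_int_cmean (F : C -> V) p r : 0 < r ->
  (forall z, Cmod (Cminus z p) = r -> continuous (T := CU) F z) ->
  chain_int (fun z => scal (Cinv (Cminus z p) : C_AbsRing) (F z)) (circle p r :: nil) =
  scal (two_pi_i : C_AbsRing) (cmean F p r).
Proof.
  intros hr hF; simpl; rewrite plus_zero_r; unfold cmean.
  rewrite <- (RInt_linear (is_linear_scal_C V two_pi_i)).
  - apply (RInt_ext (V := real_module V)); intros t _.
    change (scal (Cmult (Cmult (0, 2 * PI) (RtoC r)) (cis (2 * PI * t)) : C_AbsRing)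
       (scal (Cinv (Cminus (circle_pt p r t) p) : C_AbsRing) (F (circle_pt p r t))) = scal (two_pi_i : C_AbsRing) (F (circle_pt p r t))).
    rewrite scal_assoc; f_equal; unfold circle_pt, two_pi_i.
    match goal with |- mult ?a ?b = _ => change (mult a b) with (Cmult a b) end.
    match goal with |- ?a = ?b => change (@eq C a b) end.
    field.
    replace (Cminus (Cplus p (Cmult (RtoC r) (cis (2 * PI * t)))) p) with (Cmult (RtoC r) (cis (2 * PI * t))) by ring.
    apply Cmult_neq_0; [intros h; apply RtoC_inj in h; lra|apply cis_neq_0].
  - intros t _; apply continuous_circle_comp; [lra|exact hF].
Qed.

(** A mean is an integral over the circle with kernel [1 / (w - p)], so this is an instance of
    [chain_int_swap]. The centre, where the kernel is singular, is removed from the second domain to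
    form [D2']. *)
Lemma cmean_chain_int (D1 D2 : C -> Prop) (F : C -> C -> V) G p r :
  open (D1 : CU -> Prop) -> open (D2 : CU -> Prop) ->
  (forall z w, D1 z -> D2 w ->
    continuous (T := CU2) (fun p => F (fst p) (snd p)) (z, w)) ->
  (forall z, trace G z -> D1 z) -> 0 < r -> (forall z, Cmod (Cminus z p) = r -> D2 z) ->
  cmean (fun w => chain_int (fun z => F z w) G) p r = chain_int (fun z => cmean (F z) p r) G.
Proof.
  intros o1 o2 hF hG hr hp.
  set (D2' z := D2 z /\ z <> p).
  assert (hp' : forall z, Cmod (Cminus z p) = r -> D2' z).
  { intros z hz; split; [apply hp, hz|intros ->].
    replace (Cminus p p) with (RtoC 0) in hz by ring; rewrite Cmod_0 in hz; lra. }
  assert (o2' : open (D2' : CU -> Prop)).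
  { apply open_Cmod; intros z [hz1 hz2].
    destruct (proj1 (open_Cmod D2) o2 z hz1) as [d [d0 hd]].
    pose proof (proj1 (Cmod_gt_0 _) (Cminus_neq_0 hz2)) as h.
    exists (Rmin d (Cmod (Cminus z p))); split; [apply Rmin_pos; assumption|intros y hy; split].
    - apply hd, Rlt_le_trans with (1 := hy), Rmin_l.
    - intros ->; rewrite Cmod_minus_sym in hy; apply (Rlt_irrefl (Cmod (Cminus z p))), Rlt_le_trans with (1 := hy), Rmin_r. }
  assert (cF : forall z, D1 z -> forall w, D2 w -> continuous (T := CU) (F z) w).
  { intros z hz w hw; apply (cont_on_slice2 (D1 := D1) (D2 := D2)); assumption. }
  assert (cI : forall w, D2 w -> continuous (T := CU) (fun w => chain_int (fun z => F z w) G) w).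
  { intros w hw; apply (cont_on_chain_int (D1 := D1) (D2 := D2)); assumption. }
  assert (hF' : forall z w, D1 z -> D2' w ->
    continuous (T := CU2) (fun q => scal (Cinv (Cminus (snd q) p) : C_AbsRing) (F (fst q) (snd q))) (z, w)).
  { intros z w hz [hw hwp]; apply continuous_scal_C; [|apply hF; assumption].
    apply continuous_Cinv; [exact (Cminus_neq_0 hwp)|].
    apply continuous_Cminus; [apply continuous_snd|apply continuous_const]. }
  apply (scal_C_inj (k := two_pi_i)); [exact two_pi_i_neq_0|].
  rewrite <- circle_int_cmean; [|exact hr|intros z hz; apply cI, hp, hz].
  transitivity (chain_int (fun w => chain_int (fun z => scal (Cinv (Cminus w p) : C_AbsRing) (F z w)) G) (circle p r :: nil)).
  - apply chain_int_ext; intros w hw; apply trace_circle in hw; [|lra].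
    symmetry; apply (chain_int_linear (is_linear_scal_C V _)).
    intros z hz; apply (cont_on_slice1 (D1 := D1) (D2 := D2)); [exact hF|apply hp, hw|apply hG, hz].
  - rewrite (chain_int_swap (D1 := D1) (D2 := D2') o1 o2' hF' hG)
      by (intros w hw; apply hp', (trace_circle (r := r)); [lra|exact hw]).
    rewrite <- (chain_int_linear (is_linear_scal_C V two_pi_i)).
    + apply chain_int_ext; intros z hz; apply circle_int_cmean; [exact hr|].
      intros w hw; apply cF; [apply hG, hz|apply hp, hw].
    + intros z hz; unfold cmean.
      apply (continuous_RInt_param (V := real_module V) (T := CU) (F := fun t z => F z (circle_pt p r t))); [lra|].
      generalize (o1 z (hG z hz)); apply filter_imp; intros z' hz' t _.
      apply (continuous_comp_2 (snd : R * CU -> CU) (fun q => circle_pt p r (fst q) : CU) F (t, z')).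
      * apply continuous_snd.
      * apply (continuous_comp fst (circle_pt p r : R -> CU)); [apply continuous_fst|apply continuous_circle_pt].
      * apply hF; [exact hz'|apply hp, Cmod_circle_pt; lra].
Qed.

End CircleMean.

Notation chain_intC := (chain_int (V := CV)).

(** * The winding number as a function of the point *)

Section Trace.
Variable G : chain.

Lemma trace_bounded : exists M, 0 <= M /\ forall z, trace G z -> Cmod z <= M.
Proof.
  induction G as [|g G' [M [M0 IH]]]; [exists 0; split; [lra|intros z [g [[] _]]]|].
  destruct (bounded_continuity (V := C_NormedModule) g 0 1 (fun t ht => arc_continuous ht)) as [N HN].
  exists (Rmax M N); split; [apply Rle_trans with (1 := M0), Rmax_l|].
  intros z hz; apply trace_cons in hz; destruct hz as [[t [ht ->]]|hz].
  - apply Rle_trans with (2 := Rmax_r _ _), Rlt_le, HN, ht.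
  - apply Rle_trans with (2 := Rmax_l _ _), IH, hz.
Qed.

(** Compactness enters through the boundedness of the continuous function [1 / (g t - w)] on
    [[0, 1]]. *)
Lemma trace_distance w : ~ trace G w -> exists d, 0 < d /\ forall z, trace G z -> d <= Cmod (Cminus z w).
Proof.
  induction G as [|g G' IH]; intros hw; [exists 1; split; [lra|intros z [g [[] _]]]|].
  destruct IH as [d [d0 hd]]; [intros h; apply hw, trace_cons; right; exact h|].
  assert (hn : forall t, 0 <= t <= 1 -> Cminus (g t) w <> RtoC 0).
  { intros t ht; apply Cminus_neq_0; intros <-; apply hw, trace_cons; left; exists t; split; [exact ht|reflexivity]. }
  destruct (bounded_continuity (V := C_NormedModule) (fun t => Cinv (Cminus (g t) w)) 0 1) as [N HN].
  { intros t ht; apply continuous_Cinv; [apply hn, ht|].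
    apply continuous_Cminus; [apply arc_continuous, ht|apply continuous_const]. }
  assert (hN : 0 < N).
  { apply Rle_lt_trans with (2 := HN 0 ltac:(lra)), norm_ge_0. }
  exists (Rmin d (/ N)); split; [apply Rmin_pos; [exact d0|apply Rinv_0_lt_compat, hN]|].
  intros z hz; apply trace_cons in hz; destruct hz as [[t [ht ->]]|hz].
  - apply Rle_trans with (1 := Rmin_r _ _).
    pose proof (HN t ht) as h; change (Cmod (Cinv (Cminus (g t) w)) < N) in h.
    pose proof (proj1 (Cmod_gt_0 _) (hn t ht)).
    rewrite Cmod_inv in h by apply hn, ht.
    rewrite <- (Rinv_inv (Cmod (Cminus (g t) w))); apply Rlt_le, Rinv_lt_contravar; [|exact h].
    apply Rmult_lt_0_compat; [apply Rinv_0_lt_compat; assumption|exact hN].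
  - apply Rle_trans with (1 := Rmin_l _ _), hd, hz.
Qed.

Lemma cauchy_kernel_continuous (z w : C) : z <> w ->
  continuous (T := CU2) (U := CU)
    (fun p => Cinv (Cminus (fst p) (snd p))) (z, w).
Proof.
  intros h; apply continuous_Cinv; [exact (Cminus_neq_0 h)|].
  apply continuous_Cminus; [apply continuous_fst|apply continuous_snd].
Qed.

Lemma cauchy_kernel_cont_on w : ~ trace G w ->
  cont_on (V := CV) (trace G) (fun z => Cinv (Cminus z w)).
Proof.
  intros hw z hz; apply continuous_Cinv; [apply Cminus_neq_0; intros ->; contradiction|].
  apply continuous_Csub.
Qed.

(** Not divided by [2 i pi]: the value at a point surrounded once is [two_pi_i]. *)
Definition winding (w : C) : C := chain_intC (fun z => Cinv (Cminus z w)) G.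

Hypothesis G_cycle : is_cycle G.

(** The derivative of the winding number in [w] integrates [(z - w)^-2], which has a
    primitive; hence the increments of the winding number are quadratically small. *)
Lemma winding_increment (d : R) : 0 < d -> exists K, 0 <= K /\ forall w w',
  (forall z, trace G z -> d <= Cmod (Cminus z w)) -> (forall z, trace G z -> d <= Cmod (Cminus z w')) ->
  Cmod (Cminus (winding w') (winding w)) <= K * Cmod (Cminus w' w) ^ 2.
Proof.
  intros d0; destruct (chain_int_bound G) as [L [L0 HL]].
  exists (L * / d ^ 3); split.
  { apply Rmult_le_pos; [exact L0|apply Rlt_le, Rinv_0_lt_compat, pow_lt, d0]. }
  intros w w' hw hw'.
  assert (nw : forall w, (forall z, trace G z -> d <= Cmod (Cminus z w)) -> forall z, trace G z -> Cminus z w <> RtoC 0).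
  { intros v hv z hz; apply Cmod_pos_neq; specialize (hv z hz); lra. }
  assert (nt : forall w, (forall z, trace G z -> d <= Cmod (Cminus z w)) -> ~ trace G w).
  { intros v hv ht; apply (nw v hv v ht); ring. }
  set (Q z := Cinv (Cmult (Cminus z w) (Cminus z w))).
  assert (hQ : cont_on (V := CV) (trace G) Q).
  { intros z hz; apply continuous_Cinv; [apply Cmult_neq_0; apply nw; assumption|].
    apply continuous_Cmult; apply continuous_Csub. }
  assert (hQ0 : chain_intC Q G = RtoC 0).
  { apply (@chain_int_derive (fun z => Copp (Cinv (Cminus z w)))); [exact G_cycle| |exact hQ].
    intros z hz; pose proof (nw w hw z hz) as hn.
    pose proof (cdiff_minus (cdiff_id z) (cdiff_const w z)) as h1.
    pose proof (cdiff_minus (cdiff_const (RtoC 0) z) (@cdiff_inv (fun y => Cminus y w) z _ hn h1)) as h2.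
    replace (Q z) with (Cminus (RtoC 0) (Copp (Cdiv (Cminus (RtoC 1) (RtoC 0)) (Cmult (Cminus z w) (Cminus z w))))).
    - apply (cdiff_ext_loc (f := fun y => Cminus (RtoC 0) (Cinv (Cminus y w)))); [|exact h2].
      exists 1; split; [lra|intros; ring].
    - unfold Q; field; exact hn. }
  set (D := Cminus w' w).
  (* Expansion of [1 / (z - w')] as [1 / (z - w) + D / (z - w)^2 + D^2 / ((z - w') (z - w)^2)]; the
     middle term integrates to zero. *)
  assert (e : Cminus (winding w') (winding w) = chain_intC (fun z => Cmult (Cmult D D) (Cinv (Cmult (Cminus z w') (Cmult (Cminus z w) (Cminus z w))))) G).
  { assert (hc : cont_on (V := CV) (trace G) (fun z => Cmult (Cmult D D) (Cinv (Cmult (Cminus z w') (Cmult (Cminus z w) (Cminus z w)))))).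
    { intros z hz; apply continuous_Cmult; [apply continuous_const|].
      apply continuous_Cinv; [repeat apply Cmult_neq_0; apply nw; assumption|].
      apply continuous_Cmult; [|apply continuous_Cmult]; apply continuous_Csub. }
    assert (hDQ : cont_on (V := CV) (trace G) (fun z => Cmult D (Q z))).
    { intros z hz; apply continuous_Cmult; [apply continuous_const|apply hQ, hz]. }
    assert (e1 : winding w' = Cplus (Cplus (winding w) (chain_intC (fun z => Cmult D (Q z)) G))
       (chain_intC (fun z => Cmult (Cmult D D) (Cinv (Cmult (Cminus z w') (Cmult (Cminus z w) (Cminus z w))))) G)).
    { etransitivity; [|exact (eq_trans (chain_int_plus (V := CV)
        (F := fun z => Cplus (Cinv (Cminus z w)) (Cmult D (Q z)))
        (fun z hz => continuous_Cplus (cauchy_kernel_cont_on (nt w hw) hz) (hDQ z hz)) hc)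
        (f_equal2 Cplus (chain_int_plus (V := CV) (cauchy_kernel_cont_on (nt w hw)) hDQ) eq_refl))].
      apply chain_int_ext; intros z hz; unfold Q, D.
      match goal with |- ?a = plus ?b ?c => change (@eq C a (Cplus b c)) end.
      field; split; apply nw; assumption. }
    rewrite e1.
    assert (e2 : chain_intC (fun z => Cmult D (Q z)) G = RtoC 0).
    { etransitivity; [exact (chain_int_linear (is_linear_scal_C C_NormedModule D) hQ)|].
      rewrite hQ0; exact (Cmult_0_r D). }
    rewrite e2; match goal with |- ?a = ?b => change (@eq C a b) end; ring. }
  rewrite e.
  apply Rle_trans with (L * (Cmod D ^ 2 * / d ^ 3)); [|right; unfold D; ring].
  assert (d3 : 0 < / d ^ 3) by (apply Rinv_0_lt_compat, pow_lt, d0).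
  apply (HL CV).
  - apply Rmult_le_pos; [apply pow_le, Cmod_ge_0|lra].
  - intros z hz; apply continuous_Cmult; [apply continuous_const|].
    apply continuous_Cinv; [repeat apply Cmult_neq_0; apply nw; assumption|].
    apply continuous_Cmult; [|apply continuous_Cmult]; apply continuous_Csub.
  - intros z hz.
    match goal with |- norm ?a <= _ => change (Cmod a <= Cmod D ^ 2 * / d ^ 3) end.
    rewrite !Cmod_mult, Cmod_inv by (repeat apply Cmult_neq_0; apply nw; assumption).
    rewrite !Cmod_mult; simpl; rewrite !Rmult_1_r.
    apply Rmult_le_compat_l; [apply Rmult_le_pos; apply Cmod_ge_0|].
    apply Rinv_le_contravar; [repeat apply Rmult_lt_0_compat; exact d0|].
    specialize (hw z hz); specialize (hw' z hz).
    apply Rmult_le_compat; [lra|apply Rmult_le_pos; lra|lra|apply Rmult_le_compat; lra].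
Qed.

(** Cutting the segment into [n] equal steps, the quadratic bound on each step adds up to at most
    [K * D ^ 2 / n], which tends to zero. *)
Lemma winding_segment (d : R) (w0 w1 : C) : 0 < d ->
  (forall t z, 0 <= t <= 1 -> trace G z -> d <= Cmod (Cminus z (Cplus w0 (Cmult (RtoC t) (Cminus w1 w0))))) ->
  winding w1 = winding w0.
Proof.
  intros d0 h; destruct (winding_increment d0) as [K [K0 HK]].
  set (w t := Cplus w0 (Cmult (RtoC t) (Cminus w1 w0))) in *.
  set (D := Cmod (Cminus w1 w0)).
  assert (step : forall s t, 0 <= s <= 1 -> 0 <= t <= 1 -> Cmod (Cminus (winding (w t)) (winding (w s))) <= K * D ^ 2 * (t - s) ^ 2).
  { intros s t hs ht; apply Rle_trans with (1 := HK (w s) (w t) (fun z hz => h s z hs hz) (fun z hz => h t z ht hz)).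
    unfold w; replace (Cminus (Cplus w0 (Cmult (RtoC t) (Cminus w1 w0))) (Cplus w0 (Cmult (RtoC s) (Cminus w1 w0))))
      with (Cmult (RtoC (t - s)) (Cminus w1 w0)) by (rewrite RtoC_minus; ring).
    rewrite Cmod_mult, Cmod_R, Rpow_mult_distr, pow2_abs; unfold D; right; ring. }
  assert (sum : forall n m : nat, (m <= S n)%nat ->
    Cmod (Cminus (winding (w (INR m / INR (S n)))) (winding (w 0))) <= INR m * (K * D ^ 2 * (/ INR (S n)) ^ 2)).
  { intros n m; assert (hn : 0 < INR (S n)) by (apply lt_0_INR; lia).
    assert (range : forall m, (m <= S n)%nat -> 0 <= INR m / INR (S n) <= 1).
    { intros m' hm; apply le_INR in hm; pose proof (pos_INR m'); split.
      - apply Rmult_le_pos; [assumption|apply Rlt_le, Rinv_0_lt_compat, hn].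
      - apply (Rmult_le_reg_r (INR (S n))); [exact hn|]; unfold Rdiv; rewrite Rmult_assoc, Rinv_l by lra; lra. }
    induction m as [|m IH]; intros hm.
    - replace (INR 0 / INR (S n)) with 0 by (simpl INR; unfold Rdiv; ring).
      replace (Cminus _ _) with (RtoC 0) by ring; rewrite Cmod_0; simpl; lra.
    - replace (Cminus (winding (w (INR (S m) / INR (S n)))) (winding (w 0))) with
       (Cplus (Cminus (winding (w (INR (S m) / INR (S n)))) (winding (w (INR m / INR (S n)))))
         (Cminus (winding (w (INR m / INR (S n)))) (winding (w 0)))) by ring.
      apply Rle_trans with (1 := Cmod_triangle _ _).
      pose proof (step _ _ (range m ltac:(lia)) (range (S m) hm)) as h1.
      pose proof (IH ltac:(lia)) as h2.
      replace (INR (S m) / INR (S n) - INR m / INR (S n)) with (/ INR (S n)) in h1 by (rewrite (S_INR m); field; lra).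
      rewrite (S_INR m) at 2; lra. }
  apply Cminus_eq_0, Cmod_eq_0, Rle_antisym; [|apply Cmod_ge_0].
  assert (hb : forall n : nat, Cmod (Cminus (winding w1) (winding w0)) <= K * D ^ 2 * / INR (S n)).
  { intros n; assert (hn : 0 < INR (S n)) by (apply lt_0_INR; lia).
    specialize (sum n (S n) (le_n _)).
    replace (INR (S n) / INR (S n)) with 1 in sum by (field; lra).
    replace (w 1) with w1 in sum by (unfold w; ring); replace (w 0) with w0 in sum by (unfold w; ring).
    replace (K * D ^ 2 * / INR (S n)) with (INR (S n) * (K * D ^ 2 * (/ INR (S n)) ^ 2)) by (field; lra); exact sum. }
  apply le_epsilon; intros e e0; rewrite Rplus_0_l.
  assert (KD : 0 <= K * D ^ 2) by (apply Rmult_le_pos; [exact K0|apply pow_le, Cmod_ge_0]).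
  destruct (nfloor_ex (K * D ^ 2 / e)) as [n [_ hn]]; [apply Rmult_le_pos; [exact KD|apply Rlt_le, Rinv_0_lt_compat, e0]|].
  apply Rle_trans with (1 := hb n); rewrite S_INR.
  assert (0 <= INR n) by apply pos_INR.
  apply (Rmult_le_reg_r (INR n + 1)); [lra|].
  rewrite Rmult_assoc, Rinv_l, Rmult_1_r by lra.
  apply (Rmult_lt_compat_r e) in hn; [|exact e0].
  unfold Rdiv in hn; rewrite Rmult_assoc, Rinv_l in hn by lra; lra.
Qed.

(** The disc is also kept at a distance from the trace, so that Cauchy integrals can be formed at
    all of its points. *)
Lemma winding_locally_constant w0 : ~ trace G w0 -> exists d, 0 < d /\ forall w, Cmod (Cminus w w0) < d ->
  winding w = winding w0 /\ forall z, trace G z -> d <= Cmod (Cminus z w).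
Proof.
  intros hw; destruct (trace_distance hw) as [d [d0 hd]].
  assert (hh : forall w z, Cmod (Cminus w w0) < d / 2 -> trace G z -> d / 2 <= Cmod (Cminus z w)).
  { intros w z h hz; specialize (hd z hz).
    replace (Cminus z w0) with (Cplus (Cminus z w) (Cminus w w0)) in hd by ring.
    pose proof (Cmod_triangle (Cminus z w) (Cminus w w0)); lra. }
  exists (d / 2); split; [lra|intros w h; split].
  - apply (@winding_segment (d / 2)); [lra|intros t z ht hz; apply hh; [|exact hz]].
    replace (Cminus (Cplus w0 (Cmult (RtoC t) (Cminus w w0))) w0) with (Cmult (RtoC t) (Cminus w w0)) by ring.
    rewrite Cmod_mult, Cmod_R, Rabs_pos_eq by lra.
    pose proof (Cmod_ge_0 (Cminus w w0)); nra.
  - intros z hz; apply hh; assumption.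
Qed.

(** The ray from [w] away from the origin avoids the disc containing the trace, so the winding
    number is constant along it, while the length estimate makes it tend to zero. *)
Lemma winding_infinity : exists M, 0 <= M /\ (forall z, trace G z -> Cmod z <= M) /\
  forall w, M < Cmod w -> winding w = RtoC 0.
Proof.
  destruct trace_bounded as [M [M0 HM]]; exists M; split; [exact M0|split; [exact HM|intros w hw]].
  destruct (chain_int_bound G) as [L [L0 HL]].
  assert (hd : forall t z, 1 <= t -> trace G z -> t * Cmod w - M <= Cmod (Cminus z (Cmult (RtoC t) w))).
  { intros t z ht hz; specialize (HM z hz); rewrite Cmod_minus_sym.
    pose proof (Cmod_triangle (Cminus (Cmult (RtoC t) w) z) z) as h.
    replace (Cplus (Cminus (Cmult (RtoC t) w) z) z) with (Cmult (RtoC t) w) in h by ring.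
    rewrite Cmod_mult, Cmod_R, Rabs_pos_eq in h by lra; lra. }
  assert (hT : forall T, 1 <= T -> Cmod (winding w) <= L * / (T * Cmod w - M)).
  { intros T hT; assert (hTw : 0 < T * Cmod w - M) by (pose proof (Rmult_le_compat_r (Cmod w) 1 T ltac:(lra) hT); lra).
    rewrite <- (@winding_segment (Cmod w - M) w (Cmult (RtoC T) w)); [|lra|].
    - apply (HL CV).
      + apply Rlt_le, Rinv_0_lt_compat, hTw.
      + apply cauchy_kernel_cont_on; intros ht; specialize (hd T _ hT ht).
        replace (Cminus (Cmult (RtoC T) w) (Cmult (RtoC T) w)) with (RtoC 0) in hd by ring; rewrite Cmod_0 in hd; lra.
      + intros z hz; match goal with |- norm ?a <= ?b => change (Cmod a <= b) end.
        specialize (hd T z hT hz); rewrite Cmod_inv by (apply Cmod_pos_neq; lra).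
        apply Rinv_le_contravar; lra.
    - intros t z ht hz.
      replace (Cplus w (Cmult (RtoC t) (Cminus (Cmult (RtoC T) w) w))) with (Cmult (RtoC (1 + t * (T - 1))) w).
      + assert (h0 : 0 <= t * (T - 1)) by (apply Rmult_le_pos; lra).
        apply Rle_trans with (2 := hd (1 + t * (T - 1)) z ltac:(lra) hz).
        apply Rplus_le_compat_r; pose proof (Rmult_le_compat_r (Cmod w) 1 (1 + t * (T - 1)) ltac:(lra) ltac:(lra)); lra.
      + rewrite RtoC_plus, RtoC_mult, RtoC_minus; ring. }
  apply Cmod_eq_0, Rle_antisym; [|apply Cmod_ge_0].
  apply le_epsilon; intros e e0; rewrite Rplus_0_l.
  (* Chosen so that [T * Cmod w - M = Cmod w + L / e], which brings the estimate below [e]. *)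
  set (T := 1 + (L / e + M) / Cmod w).
  assert (hw0 : 0 < Cmod w) by lra.
  assert (hLe : 0 <= L / e) by (apply Rmult_le_pos; [exact L0|apply Rlt_le, Rinv_0_lt_compat, e0]).
  assert (hT1 : 1 <= T).
  { unfold T; assert (0 <= (L / e + M) / Cmod w); [|lra].
    apply Rmult_le_pos; [lra|apply Rlt_le, Rinv_0_lt_compat, hw0]. }
  apply Rle_trans with (1 := hT T hT1).
  replace (T * Cmod w - M) with (Cmod w + L / e) by (unfold T; field; lra).
  apply (Rmult_le_reg_r (Cmod w + L / e)); [lra|].
  rewrite Rmult_assoc, Rinv_l, Rmult_1_r by lra.
  rewrite Rmult_plus_distr_l; replace (e * (L / e)) with L by (field; lra).
  pose proof (Rmult_lt_0_compat _ _ e0 hw0); lra.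
Qed.
End Trace.

(** * The maximum principle *)

Lemma nested_intervals (u : nat -> R) (a : R) : 0 < a ->
  (forall n, u (S n) = u n \/ u (S n) = u n + a / 2 ^ S n) ->
  exists s, forall n, u n <= s <= u n + a / 2 ^ n.
Proof.
  intros ha hu.
  assert (hp : forall n, 0 < a / 2 ^ n) by (intros n; apply Rdiv_lt_0_compat; [lra|apply pow_lt; lra]).
  assert (hh : forall n, a / 2 ^ n = a / 2 ^ S n + a / 2 ^ S n).
  { intros n; simpl; field; apply pow_nonzero; lra. }
  assert (inc : forall n, u n <= u (S n)) by (intros n; specialize (hp (S n)); destruct (hu n); lra).
  assert (dec : forall n, u (S n) + a / 2 ^ S n <= u n + a / 2 ^ n).
  { intros n; specialize (hh n); specialize (hp (S n)); destruct (hu n); lra. }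
  assert (incm : forall n m, u n <= u (n + m)%nat).
  { intros n m; induction m as [|m IH]; [rewrite Nat.add_0_r; lra|].
    rewrite Nat.add_succ_r; apply Rle_trans with (1 := IH), inc. }
  assert (decm : forall n m, u (n + m)%nat + a / 2 ^ (n + m) <= u n + a / 2 ^ n).
  { intros n m; induction m as [|m IH]; [rewrite Nat.add_0_r; lra|].
    rewrite Nat.add_succ_r; apply Rle_trans with (2 := IH), dec. }
  destruct (ex_finite_lim_seq_incr u (u 0%nat + a)) as [s hs]; [exact inc| |].
  { intros n; specialize (decm 0%nat n); simpl in decm; specialize (hp n); lra. }
  exists s; intros n; split.
  - exact (is_lim_seq_incr_compare u s hs inc n).
  - apply (is_lim_seq_le (fun m => u (n + m)%nat) (fun _ => u n + a / 2 ^ n) s (u n + a / 2 ^ n)).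
    + intros m; specialize (decm n m); specialize (hp (n + m)%nat); lra.
    + apply (is_lim_seq_ext (fun m => u (m + n)%nat)); [intros m; f_equal; lia|].
      apply is_lim_seq_incr_n, hs.
    + apply is_lim_seq_const.
Qed.

(** Shared by the existence of maxima and by Goursat's lemma: a property that passes from each
    rectangle to one of its quarters holds on nested rectangles shrinking to a point. [epsilon]
    chooses the quarters. *)
Lemma bisection (P : nat -> R -> R -> Prop) (a b x0 y0 : R) : 0 < a -> 0 < b -> P 0%nat x0 y0 ->
  (forall n x y, P n x y -> exists x' y', (x' = x \/ x' = x + a / 2 ^ S n) /\
     (y' = y \/ y' = y + b / 2 ^ S n) /\ P (S n) x' y') ->
  exists s t, forall n, exists x y, P n x y /\ x <= s <= x + a / 2 ^ n /\ y <= t <= y + b / 2 ^ n /\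
    (x0 <= x /\ x + a / 2 ^ n <= x0 + a) /\ (y0 <= y /\ y + b / 2 ^ n <= y0 + b).
Proof.
  intros ha hb h0 hs.
  set (step (n : nat) (p q : R * R) := (fst q = fst p \/ fst q = fst p + a / 2 ^ S n) /\
    (snd q = snd p \/ snd q = snd p + b / 2 ^ S n) /\ P (S n) (fst q) (snd q)).
  set (u := nat_rect (fun _ => (R * R)%type) (x0, y0) (fun n p => epsilon (inhabits p) (step n p))).
  assert (hu : forall n, P n (fst (u n)) (snd (u n)) /\ step n (u n) (u (S n))).
  { assert (hst : forall n, P n (fst (u n)) (snd (u n)) -> step n (u n) (u (S n))).
    { intros n hP; apply (epsilon_spec (inhabits (u n)) (step n (u n))).
      destruct (hs n _ _ hP) as [x' [y' H]]; exists (x', y'); exact H. }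
    induction n as [|n [_ IH]]; (split; [|apply hst]); [exact h0|exact h0|apply IH|apply IH]. }
  assert (bounds : forall (v : nat -> R) c, 0 < c -> (forall n, v (S n) = v n \/ v (S n) = v n + c / 2 ^ S n) ->
    forall n, v 0%nat <= v n /\ v n + c / 2 ^ n <= v 0%nat + c).
  { intros v c hc hv; induction n as [|n [h1 h2]]; [simpl; lra|].
    assert (0 < c / 2 ^ S n) by (apply Rdiv_lt_0_compat; [lra|apply pow_lt; lra]).
    assert (c / 2 ^ n = c / 2 ^ S n + c / 2 ^ S n) by (simpl; field; apply pow_nonzero; lra).
    destruct (hv n) as [-> | ->]; lra. }
  assert (hx : forall n, fst (u (S n)) = fst (u n) \/ fst (u (S n)) = fst (u n) + a / 2 ^ S n) by (intros n; apply (hu n)).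
  assert (hy : forall n, snd (u (S n)) = snd (u n) \/ snd (u (S n)) = snd (u n) + b / 2 ^ S n) by (intros n; apply (hu n)).
  destruct (nested_intervals ha hx) as [s Hs]; destruct (nested_intervals hb hy) as [t Ht].
  exists s, t; intros n; exists (fst (u n)), (snd (u n)).
  split; [apply (hu n)|split; [apply Hs|split; [apply Ht|split]]].
  - exact (bounds (fun n => fst (u n)) a ha hx n).
  - exact (bounds (fun n => snd (u n)) b hb hy n).
Qed.

Lemma Cmod_le_Re_Im (z : C) : Cmod z <= Rabs (Re z) + Rabs (Im z).
Proof.
  replace z with (Cplus (RtoC (Re z)) (Cmult Ci (RtoC (Im z)))) at 1.
  - apply Rle_trans with (1 := Cmod_triangle _ _); rewrite Cmod_mult, !Cmod_R, Cmod_Ci; lra.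
  - destruct z; apply injective_projections; simpl; ring.
Qed.

Lemma Cmod_le_minus a b : Cmod a <= Cmod (Cminus a b) + Cmod b.
Proof. replace a with (Cplus (Cminus a b) b) at 1 by ring; apply Cmod_triangle. Qed.

Lemma half_pow_small (c e : R) : 0 < e -> exists n, c / 2 ^ n < e.
Proof.
  intros e0.
  assert (h : is_lim_seq (fun n => c * (/ 2) ^ n) (c * 0)).
  { apply (is_lim_seq_scal_l (fun n => (/ 2) ^ n) c 0), is_lim_seq_geom; rewrite Rabs_pos_eq; lra. }
  rewrite Rmult_0_r in h; apply is_lim_seq_spec in h; destruct (h (mkposreal e e0)) as [N HN].
  exists N; specialize (HN N (le_n N)); simpl in HN; rewrite Rminus_0_r in HN.
  unfold Rdiv; rewrite <- pow_inv; apply Rle_lt_trans with (2 := HN), Rle_abs.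
Qed.

Lemma attains_max_on_disc (phi : C -> R) (M : R) : 0 <= M ->
  (forall z, continuous (T := CU) phi z) ->
  exists p, Cmod p <= M /\ forall z, Cmod z <= M -> phi z <= phi p.
Proof.
  intros M0 hc.
  (* The [+ 1] keeps the side of the square positive when [M = 0]. *)
  set (w := 2 * M + 1).
  (* Every value of [phi] on the disc is reached or exceeded at a point of the disc inside the
     square. *)
  set (P (n : nat) (x y : R) := forall z, Cmod z <= M -> exists z', Cmod z' <= M /\ phi z <= phi z' /\
    x <= Re z' <= x + w / 2 ^ n /\ y <= Im z' <= y + w / 2 ^ n).
  destruct (@bisection P w w (- M) (- M)) as [s [t H]]; [unfold w; lra|unfold w; lra| | |].
  - intros z hz; exists z; split; [exact hz|split; [lra|]].
    pose proof (re_le_Cmod z) as h1.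
    assert (h2 : Rabs (Im z) <= Cmod z) by (apply Rle_trans with (2 := Rmax_Cmod z), Rmax_r).
    unfold w; simpl; split; [revert h1; unfold Rabs; destruct Rcase_abs; lra|].
    revert h2; unfold Rabs; destruct Rcase_abs; lra.
  - intros n x y hP; apply NNPP; intros hn.
    (* If no quarter qualifies, for each of them some point of the disc beats all values taken in
       it; the best of these four points then beats the whole square. *)
    assert (hq : forall x' y', (x' = x \/ x' = x + w / 2 ^ S n) -> (y' = y \/ y' = y + w / 2 ^ S n) ->
      exists z, Cmod z <= M /\ forall z', Cmod z' <= M -> x' <= Re z' <= x' + w / 2 ^ S n ->
         y' <= Im z' <= y' + w / 2 ^ S n -> phi z' < phi z).
    { intros x' y' hx hy; apply NNPP; intros hno; apply hn; exists x', y'; split; [exact hx|split; [exact hy|]].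
      intros z hz; apply NNPP; intros hno'; apply hno; exists z; split; [exact hz|].
      intros z' hz' h1 h2; apply Rnot_le_lt; intros h3; apply hno'; exists z'; tauto. }
    assert (hmax : forall z1 z2, Cmod z1 <= M -> Cmod z2 <= M -> exists z, Cmod z <= M /\ phi z1 <= phi z /\ phi z2 <= phi z).
    { intros z1 z2 h1 h2; destruct (Rle_dec (phi z1) (phi z2)); [exists z2|exists z1]; repeat split; try assumption; lra. }
    destruct (hq x y (or_introl eq_refl) (or_introl eq_refl)) as [z1 [k1 g1]].
    destruct (hq x (y + w / 2 ^ S n) (or_introl eq_refl) (or_intror eq_refl)) as [z2 [k2 g2]].
    destruct (hq (x + w / 2 ^ S n) y (or_intror eq_refl) (or_introl eq_refl)) as [z3 [k3 g3]].
    destruct (hq (x + w / 2 ^ S n) (y + w / 2 ^ S n) (or_intror eq_refl) (or_intror eq_refl)) as [z4 [k4 g4]].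
    destruct (hmax z1 z2 k1 k2) as [z5 [k5 [l1 l2]]]; destruct (hmax z3 z4 k3 k4) as [z6 [k6 [l3 l4]]].
    destruct (hmax z5 z6 k5 k6) as [z7 [k7 [l5 l6]]].
    destruct (hP z7 k7) as [z' [kz [l7 [hx hy]]]].
    assert (hh : w / 2 ^ n = w / 2 ^ S n + w / 2 ^ S n) by (simpl; field; apply pow_nonzero; lra).
    rewrite hh in hx, hy.
    destruct (Rle_dec (Re z') (x + w / 2 ^ S n)); destruct (Rle_dec (Im z') (y + w / 2 ^ S n)).
    + specialize (g1 z' kz ltac:(lra) ltac:(lra)); lra.
    + specialize (g2 z' kz ltac:(lra) ltac:(lra)); lra.
    + specialize (g3 z' kz ltac:(lra) ltac:(lra)); lra.
    + specialize (g4 z' kz ltac:(lra) ltac:(lra)); lra.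
  - exists (s, t).
    assert (near : forall d z, 0 < d -> Cmod z <= M -> exists z', Cmod z' <= M /\ phi z <= phi z' /\ Cmod (Cminus z' (s, t)) < d).
    { intros d z d0 hz; destruct (@half_pow_small (w + w) d d0) as [n hn].
      destruct (H n) as [x [y [hP [hs [ht _]]]]]; destruct (hP z hz) as [z' [kz [l7 [hx hy]]]].
      exists z'; split; [exact kz|split; [exact l7|]].
      apply Rle_lt_trans with (1 := Cmod_le_Re_Im _), Rle_lt_trans with (2 := hn).
      replace ((w + w) / 2 ^ n) with (w / 2 ^ n + w / 2 ^ n) by (unfold Rdiv; ring).
      destruct z' as [z1 z2]; unfold Re, Im, Cminus, Cplus, Copp in *; simpl in *.
      apply Rplus_le_compat; unfold Rabs; destruct Rcase_abs; lra. }
    split.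
    + apply le_epsilon; intros e e0.
      destruct (near e (RtoC 0) e0) as [z' [h1 [_ h2]]]; [rewrite Cmod_0; exact M0|].
      rewrite Cmod_minus_sym in h2.
      pose proof (Cmod_le_minus (s, t) z'); lra.
    + intros z hz; apply le_epsilon; intros e e0.
      pose proof (proj1 (continuous_norm_iff (K := R_AbsRing) (T := CU) (V := R_NormedModule) phi (s, t)) (hc (s, t)) e e0) as hl.
      apply locally_Cmod in hl; destruct hl as [d [d0 hd]].
      destruct (near d z d0 hz) as [z' [_ [h2 h3]]].
      specialize (hd z' h3); change (Rabs (phi z' - phi (s, t)) < e) in hd.
      pose proof (Rle_abs (phi z' - phi (s, t))); lra.
Qed.

Definition mean_value (V : CompleteNormedModule C_AbsRing) (E : C -> V) (p : C) : Prop :=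
  exists rho, 0 < rho /\ forall r, 0 < r < rho -> cmean E p r = E p.

(** The cross term has mean zero, as the explicit primitive [f] shows. The excess [r ^ 2] over the
    value at the centre is what makes [liouville] strict. *)
Lemma is_RInt_circle_sqr (p : C) (r : R) :
  is_RInt (fun t => Cmod (circle_pt p r t) ^ 2) 0 1 (Cmod p ^ 2 + r ^ 2).
Proof.
  pose proof PI_RGT_0 as hpi.
  assert (sq : forall z, Cmod z ^ 2 = Re z ^ 2 + Im z ^ 2).
  { intros z; unfold Cmod, Re, Im; rewrite pow2_sqrt; [reflexivity|apply Rplus_le_le_0_compat; apply pow2_ge_0]. }
  set (f t := (Cmod p ^ 2 + r ^ 2) * t + 2 * r * (Re p * sin (2 * PI * t) - Im p * cos (2 * PI * t)) / (2 * PI)).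
  replace (Cmod p ^ 2 + r ^ 2) with (minus (f 1) (f 0)).
  - apply (is_RInt_derive f); intros t _.
    + unfold f; auto_derive; [exact I|].
      pose proof (sin2_cos2 (2 * PI * t)) as h; unfold Rsqr in h.
      transitivity (Cmod p ^ 2 + r ^ 2 * (sin (2 * PI * t) * sin (2 * PI * t) + cos (2 * PI * t) * cos (2 * PI * t))
        + 2 * r * (Re p * cos (2 * PI * t) + Im p * sin (2 * PI * t))).
      * rewrite h; simpl; field; lra.
      * rewrite !sq; unfold circle_pt, cis, Re, Im; simpl; ring.
    + apply (continuous_ext (fun t => Re (circle_pt p r t) * (Re (circle_pt p r t) * 1) + Im (circle_pt p r t) * (Im (circle_pt p r t) * 1))).
      { intros x; rewrite sq; reflexivity. }
      pose proof (@continuous_circle_pt p r t) as hcp.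
      pose proof (continuous_Re hcp) as hr; pose proof (continuous_Im hcp) as hi.
      apply (continuous_plus (V := R_NormedModule));
        (apply (continuous_mult (K := R_AbsRing)); [assumption|apply (continuous_mult (K := R_AbsRing)); [assumption|apply continuous_const]]).
  - change (f 1 + - f 0 = Cmod p ^ 2 + r ^ 2); unfold f.
    replace (2 * PI * 1) with (2 * PI) by ring; replace (2 * PI * 0) with 0 by ring; rewrite sin_0, cos_0, sin_2PI, cos_2PI; field; lra.
Qed.

(** Maximise [norm (E z) + eta |z|^2] over a large disc: the quadratic term makes the
    mean over a small circle exceed the value at the centre strictly. *)
Lemma liouville (V : CompleteNormedModule C_AbsRing) (E : C -> V) :
  (forall z, continuous (T := CU) E z) -> (forall p, mean_value E p) ->
  (forall e, 0 < e -> exists M, forall z, M < Cmod z -> norm (E z) <= e) ->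
  forall z, E z = zero.
Proof.
  intros hc hmv hinf q; apply (@norm_eq_zero _ V), NNPP; intros hq.
  set (m := norm (E q)) in *.
  assert (m0 : 0 < m) by (pose proof (norm_ge_0 (E q)); unfold m in *; lra).
  destruct (hinf (m / 4)) as [M HM]; [lra|].
  set (N := Rmax (Rmax M (Cmod q)) 0 + 1).
  assert (hN : M < N /\ Cmod q < N /\ 0 < N).
  { unfold N; pose proof (Rmax_l (Rmax M (Cmod q)) 0); pose proof (Rmax_r (Rmax M (Cmod q)) 0).
    pose proof (Rmax_l M (Cmod q)); pose proof (Rmax_r M (Cmod q)); lra. }
  (* On the circle of radius [N] the quadratic term is [m / 4] and [norm (E z) <= m / 4], so [phi]
     stays below [m <= phi q] there and the maximum is interior. *)
  set (eta := m / (4 * N ^ 2)).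
  assert (N2 : 0 < N ^ 2) by (apply pow_lt; lra).
  assert (eta0 : 0 < eta) by (apply Rdiv_lt_0_compat; lra).
  set (phi z := norm (E z) + eta * Cmod z ^ 2).
  assert (phic : forall z, continuous (T := CU) phi z).
  { assert (hn : forall z, continuous (T := CU) (fun z => norm (E z)) z).
    { intros z; apply (continuous_comp E (@norm _ V)); [apply hc|exact (@filterlim_norm _ V (E z))]. }
    assert (hm : forall z, continuous (T := CU) Cmod z) by (intros z; exact (@filterlim_norm _ C_NormedModule z)).
    intros z; apply (continuous_plus (V := R_NormedModule)); [apply hn|].
    apply (continuous_scal_r (V := R_NormedModule) eta (fun z => Cmod z ^ 2)).
    simpl; apply (continuous_mult (K := R_AbsRing)); [apply hm|apply (continuous_mult (K := R_AbsRing)); [apply hm|apply continuous_const]]. }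
  destruct (@attains_max_on_disc phi N ltac:(lra) phic) as [p [hp hmax]].
  assert (hpm : m <= phi p).
  { apply Rle_trans with (2 := hmax q ltac:(lra)); unfold phi; fold m.
    pose proof (pow2_ge_0 (Cmod q)); nra. }
  assert (hpN : Cmod p < N).
  { apply Rnot_le_lt; intros h; assert (e : Cmod p = N) by lra.
    unfold phi in hpm; pose proof (HM p ltac:(lra)) as h1; rewrite e in hpm.
    unfold eta in hpm; replace (m / (4 * N ^ 2) * N ^ 2) with (m / 4) in hpm by (field; lra); lra. }
  destruct (hmv p) as [rho [rho0 hrho]].
  set (r := Rmin rho (N - Cmod p) / 2).
  assert (hr : 0 < r /\ r < rho /\ r <= N - Cmod p).
  { unfold r; assert (0 < Rmin rho (N - Cmod p)) by (apply Rmin_pos; lra).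
    pose proof (Rmin_l rho (N - Cmod p)); pose proof (Rmin_r rho (N - Cmod p)); lra. }
  (* Maximality bounds [norm (E z)] on the circle by [phi p - eta * Cmod z ^ 2]; averaging leads to
     [norm (E p) <= norm (E p) - eta * r ^ 2]. *)
  assert (hle : norm (cmean E p r) <= phi p - eta * (Cmod p ^ 2 + r ^ 2)).
  { apply (norm_RInt_le (V := restrict_R V) (fun t => E (circle_pt p r t)) (fun t => phi p - eta * Cmod (circle_pt p r t) ^ 2) 0 1); [lra| | |].
    - intros t _; assert (h : phi (circle_pt p r t) <= phi p); [|unfold phi in h at 1; change (norm (E (circle_pt p r t)) <= phi p - eta * Cmod (circle_pt p r t) ^ 2); lra].
      apply hmax; unfold circle_pt; apply Rle_trans with (1 := Cmod_triangle _ _).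
      rewrite Cmod_mult, Cmod_R, Cmod_cis, Rabs_pos_eq; lra.
    - apply (RInt_correct (V := real_module V)), (ex_RInt_01 (V := V)).
      intros t _; apply continuous_circle_comp; [lra|intros; apply hc].
    - apply (is_RInt_minus (V := R_NormedModule) (fun _ => phi p)).
      + pose proof (is_RInt_const (V := R_NormedModule) 0 1 (phi p)) as h.
        assert (e1 : (scal (1 - 0) (phi p) : R_NormedModule) = phi p) by (change ((1 - 0) * phi p = phi p); ring).
        exact (eq_ind _ (is_RInt (V := R_NormedModule) (fun _ => phi p) 0 1) h _ e1).
      + apply (is_RInt_scal (V := R_NormedModule)), is_RInt_circle_sqr. }
  rewrite hrho in hle by lra.
  unfold phi in hle at 1; assert (0 < eta * r ^ 2) by (apply Rmult_lt_0_compat; [exact eta0|apply pow_lt; lra]); lra.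
Qed.

(** * Goursat's lemma on rectangles *)

Definition RIntC (f : R -> C) (a b : R) : C := RInt (V := real_module CV) f a b.

Lemma ex_RIntC (f : R -> C) a b : a <= b -> (forall t, a <= t <= b -> continuous (U := CU) f t) ->
  ex_RInt (V := real_module CV) f a b.
Proof.
  intros hab h; apply (@ex_RInt_continuous (real_module CV)).
  rewrite Rmin_left, Rmax_right by lra; exact h.
Qed.

Lemma RIntC_minus_const (f g : R -> C) a b (k : C) : a <= b ->
  (forall t, a <= t <= b -> continuous (U := CU) f t) ->
  (forall t, a <= t <= b -> continuous (U := CU) g t) ->
  RIntC (fun t => Cminus (Cminus (f t) (g t)) k) a b = Cminus (Cminus (RIntC f a b) (RIntC g a b)) (Cmult (RtoC (b - a)) k).
Proof.
  intros hab hf hg; unfold RIntC.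
  assert (ef := ex_RIntC hab hf); assert (eg := ex_RIntC hab hg).
  etransitivity; [apply (RInt_minus (V := real_module CV) (fun t => Cminus (f t) (g t)) (fun _ => k))|].
  - apply (ex_RInt_minus (V := real_module CV) f g); assumption.
  - apply ex_RInt_const.
  - rewrite (RInt_const (V := real_module CV)).
    rewrite (RInt_minus (V := real_module CV) f g) by assumption; reflexivity.
Qed.

Section Goursat.
Variables (G : R -> R -> C) (tau : C).

(** The counter-clockwise boundary integral of [G] against [ds + tau dt]. [G] is regarded as a
    function of the complex variable [s + tau * t]; with [tau = 2 i pi] this is a logarithmic
    coordinate. *)
Definition rect_int (x y a b : R) : C :=
  Cplus (Cminus (RIntC (fun s => G s y) x (x + a)) (RIntC (fun s => G s (y + b)) x (x + a)))
    (Cmult tau (Cminus (RIntC (G (x + a)) y (y + b)) (RIntC (G x) y (y + b)))).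

Definition rect_diff (s t : R) : Prop :=
  exists L : C, forall e, 0 < e -> exists d, 0 < d /\ forall s' t', Rabs (s' - s) < d -> Rabs (t' - t) < d ->
    Cmod (Cminus (Cminus (G s' t') (G s t)) (Cmult L (Cplus (RtoC (s' - s)) (Cmult tau (RtoC (t' - t)))))) <= e * (Rabs (s' - s) + Rabs (t' - t)).

Definition rect_cont (x y a b : R) : Prop := forall s t, x <= s <= x + a -> y <= t <= y + b ->
  continuous (U := CU) (fun p : R * R => G (fst p) (snd p)) (s, t).

Lemma rect_cont_h x y a b t : rect_cont x y a b -> y <= t <= y + b ->
  forall s, x <= s <= x + a -> continuous (U := CU) (fun s => G s t) s.
Proof. intros h ht s hs; apply (continuous_slice (F := G) (U := CU)), h; assumption. Qed.

Lemma rect_cont_v x y a b s : rect_cont x y a b -> x <= s <= x + a ->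
  forall t, y <= t <= y + b -> continuous (U := CU) (G s) t.
Proof. intros h hs t ht; apply (continuous_slice2 (F := G) (U := CU)), h; assumption. Qed.

Lemma rect_cont_sub x y a b x' y' a' b' : rect_cont x y a b -> x <= x' -> x' + a' <= x + a -> y <= y' -> y' + b' <= y + b ->
  rect_cont x' y' a' b'.
Proof. intros h h1 h2 h3 h4 s t hs ht; apply h; lra. Qed.

Lemma RIntC_split (f : R -> C) x a : 0 <= a -> (forall s, x <= s <= x + (a + a) -> continuous (U := CU) f s) ->
  RIntC f x (x + (a + a)) = Cplus (RIntC f x (x + a)) (RIntC f (x + a) (x + a + a)).
Proof.
  intros ha hf; unfold RIntC; rewrite <- Rplus_assoc; symmetry.
  apply (RInt_Chasles (V := real_module CV)); apply ex_RIntC; try lra; intros t ht; apply hf; lra.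
Qed.

Lemma rect_int_split x y a b : 0 <= a -> 0 <= b -> rect_cont x y (a + a) (b + b) ->
  rect_int x y (a + a) (b + b) = Cplus (Cplus (rect_int x y a b) (rect_int (x + a) y a b))
    (Cplus (rect_int x (y + b) a b) (rect_int (x + a) (y + b) a b)).
Proof.
  intros ha hb hc; unfold rect_int.
  rewrite (@RIntC_split (fun s => G s y) x a ha), (@RIntC_split (fun s => G s (y + (b + b))) x a ha)
    by (apply (rect_cont_h hc); lra).
  rewrite (@RIntC_split (G (x + (a + a))) y b hb), (@RIntC_split (G x) y b hb) by (apply (rect_cont_v hc); lra).
  rewrite <- !Rplus_assoc; ring.
Qed.

(** Opposite sides are paired: [G s y - G s (y + b)] differs from the constant [- L * tau * b] by
    two remainders, hence by at most [2 * e], and similarly for the vertical sides. The two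
    constants contribute opposite amounts. *)
Lemma rect_int_small x y a b (s t : R) (L : C) (e : R) : 0 <= a -> 0 <= b -> rect_cont x y a b ->
  (forall s' t', x <= s' <= x + a -> y <= t' <= y + b ->
    Cmod (Cminus (Cminus (G s' t') (G s t)) (Cmult L (Cplus (RtoC (s' - s)) (Cmult tau (RtoC (t' - t)))))) <= e) ->
  Cmod (rect_int x y a b) <= 2 * e * a + Cmod tau * (2 * e * b).
Proof.
  intros ha hb hc he.
  assert (E : rect_int x y a b = Cplus
    (RIntC (fun s => Cminus (Cminus (G s y) (G s (y + b))) (Copp (Cmult L (Cmult tau (RtoC b))))) x (x + a))
    (Cmult tau (RIntC (fun t => Cminus (Cminus (G (x + a) t) (G x t)) (Cmult L (RtoC a))) y (y + b)))).
  { rewrite (@RIntC_minus_const (fun s => G s y) (fun s => G s (y + b))) by (lra || (apply (rect_cont_h hc); lra)).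
    rewrite (@RIntC_minus_const (G (x + a)) (G x)) by (lra || (apply (rect_cont_v hc); lra)).
    unfold rect_int; replace (x + a - x) with a by ring; replace (y + b - y) with b by ring; ring. }
  rewrite E; apply Rle_trans with (1 := Cmod_triangle _ _).
  rewrite Cmod_mult; apply Rplus_le_compat; [|apply Rmult_le_compat_l; [apply Cmod_ge_0|]].
  - replace (2 * e * a) with (2 * e * (x + a - x)) by ring.
    apply (norm_RInt_const (V := real_module CV)); [lra| |].
    + intros s' hs'; apply continuous_Cminus; [|apply continuous_const].
      apply continuous_Cminus; apply (rect_cont_h hc); lra.
    + intros s' hs'.
      pose proof (he s' y ltac:(lra) ltac:(lra)) as h1; pose proof (he s' (y + b) ltac:(lra) ltac:(lra)) as h2.
      match goal with |- norm ?u <= _ => change (Cmod u <= 2 * e) end.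
      match type of h1 with Cmod ?u <= _ => match type of h2 with Cmod ?v <= _ =>
        replace (Cminus (Cminus (G s' y) (G s' (y + b))) (Copp (Cmult L (Cmult tau (RtoC b))))) with (Cminus u v)
          by (rewrite !RtoC_minus, RtoC_plus; ring);
        apply Rle_trans with (1 := Cmod_triangle u (Copp v)); rewrite Cmod_opp; lra end end.
  - replace (2 * e * b) with (2 * e * (y + b - y)) by ring.
    apply (norm_RInt_const (V := real_module CV)); [lra| |].
    + intros s' hs'; apply continuous_Cminus; [|apply continuous_const].
      apply continuous_Cminus; apply (rect_cont_v hc); lra.
    + intros t' ht'.
      pose proof (he (x + a) t' ltac:(lra) ltac:(lra)) as h1; pose proof (he x t' ltac:(lra) ltac:(lra)) as h2.
      match goal with |- norm ?u <= _ => change (Cmod u <= 2 * e) end.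
      match type of h1 with Cmod ?u <= _ => match type of h2 with Cmod ?v <= _ =>
        replace (Cminus (Cminus (G (x + a) t') (G x t')) (Cmult L (RtoC a))) with (Cminus u v)
          by (rewrite !RtoC_minus, RtoC_plus; ring);
        apply Rle_trans with (1 := Cmod_triangle u (Copp v)); rewrite Cmod_opp; lra end end.
Qed.

Lemma goursat x0 y0 a b : 0 < a -> 0 < b -> rect_cont x0 y0 a b ->
  (forall s t, x0 <= s <= x0 + a -> y0 <= t <= y0 + b -> rect_diff s t) -> rect_int x0 y0 a b = RtoC 0.
Proof.
  intros ha hb hc hd; apply NNPP; intros hne.
  pose proof (proj1 (Cmod_gt_0 _) hne) as c0; set (c := Cmod (rect_int x0 y0 a b)) in *.
  (* By additivity one of four quarters carries at least a quarter of the integral. *)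
  set (P (n : nat) x y := (x0 <= x /\ x + a / 2 ^ n <= x0 + a /\ y0 <= y /\ y + b / 2 ^ n <= y0 + b) /\
    c / 4 ^ n <= Cmod (rect_int x y (a / 2 ^ n) (b / 2 ^ n))).
  assert (hpos : forall u n, 0 < u -> 0 < u / 2 ^ n).
  { intros u n hu; apply Rdiv_lt_0_compat; [exact hu|apply pow_lt; lra]. }
  assert (hhalf : forall u n, u / 2 ^ n = u / 2 ^ S n + u / 2 ^ S n).
  { intros u n; simpl; field; apply pow_nonzero; lra. }
  destruct (@bisection P a b x0 y0 ha hb) as [s [t H]].
  - unfold P; simpl; rewrite !Rdiv_1_r; split; [lra|unfold c; lra].
  - intros n x y [hin hI].
    rewrite (hhalf a), (hhalf b) in hin, hI.
    set (a' := a / 2 ^ S n) in *; set (b' := b / 2 ^ S n) in *.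
    assert (0 < a') by apply hpos, ha; assert (0 < b') by apply hpos, hb.
    rewrite rect_int_split in hI by (lra || (apply (rect_cont_sub hc); lra)).
    assert (c4 : c / 4 ^ n = 4 * (c / 4 ^ S n)) by (simpl; field; apply pow_nonzero; lra).
    rewrite c4 in hI.
    apply NNPP; intros hn.
    assert (small : forall x' y', (x' = x \/ x' = x + a') -> (y' = y \/ y' = y + b') -> Cmod (rect_int x' y' a' b') < c / 4 ^ S n).
    { intros x' y' hx hy; apply Rnot_le_lt; intros hle; apply hn; exists x', y'; split; [exact hx|split; [exact hy|]].
      split; [|exact hle]; fold a' b'; destruct hx as [-> | ->]; destruct hy as [-> | ->]; lra. }
    pose proof (small x y (or_introl eq_refl) (or_introl eq_refl)).
    pose proof (small (x + a') y (or_intror eq_refl) (or_introl eq_refl)).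
    pose proof (small x (y + b') (or_introl eq_refl) (or_intror eq_refl)).
    pose proof (small (x + a') (y + b') (or_intror eq_refl) (or_intror eq_refl)).
    pose proof (Cmod_triangle (Cplus (rect_int x y a' b') (rect_int (x + a') y a' b')) (Cplus (rect_int x (y + b') a' b') (rect_int (x + a') (y + b') a' b'))).
    pose proof (Cmod_triangle (rect_int x y a' b') (rect_int (x + a') y a' b')).
    pose proof (Cmod_triangle (rect_int x (y + b') a' b') (rect_int (x + a') (y + b') a' b')). lra.
  - assert (hst : x0 <= s <= x0 + a /\ y0 <= t <= y0 + b).
    { destruct (H 0%nat) as [x [y [_ [h1 [h2 [h3 h4]]]]]]; lra. }
    destruct (hd s t (proj1 hst) (proj2 hst)) as [L HL].
    (* [K] is the bound of [rect_int_small] for the whole rectangle with remainder [a + b]. It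
       scales by [/ 4 ^ n], so a differentiability error [c / (2 * K)] gives half of [c / 4 ^ n], a
       contradiction. *)
    set (K := 2 * (a + b) * a + Cmod tau * (2 * (a + b) * b)).
    assert (K0 : 0 < K).
    { assert (0 < 2 * (a + b) * a) by (repeat apply Rmult_lt_0_compat; lra).
      assert (0 <= Cmod tau * (2 * (a + b) * b)); [|unfold K; lra].
      apply Rmult_le_pos; [apply Cmod_ge_0|repeat apply Rmult_le_pos; lra]. }
    destruct (HL (c / (2 * K))) as [d [d0 hdd]]; [apply Rdiv_lt_0_compat; lra|].
    destruct (@half_pow_small (a + b) d d0) as [n hn].
    assert (hab : (a + b) / 2 ^ n = a / 2 ^ n + b / 2 ^ n) by (unfold Rdiv; ring).
    destruct (H n) as [x [y [[hin hI] [hs [ht _]]]]].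
    pose proof (hpos a n ha) as an; pose proof (hpos b n hb) as bn.
    assert (hsm : Cmod (rect_int x y (a / 2 ^ n) (b / 2 ^ n)) <=
       2 * (c / (2 * K) * (a / 2 ^ n + b / 2 ^ n)) * (a / 2 ^ n) + Cmod tau * (2 * (c / (2 * K) * (a / 2 ^ n + b / 2 ^ n)) * (b / 2 ^ n))).
    { apply (@rect_int_small _ _ _ _ s t L); [lra|lra|apply (rect_cont_sub hc); lra|].
      intros s' t' hs' ht'.
      assert (Rabs (s' - s) <= a / 2 ^ n) by (apply Rabs_le; lra).
      assert (Rabs (t' - t) <= b / 2 ^ n) by (apply Rabs_le; lra).
      apply Rle_trans with (1 := hdd s' t' ltac:(lra) ltac:(lra)).
      apply Rmult_le_compat_l; [apply Rlt_le, Rdiv_lt_0_compat; lra|lra]. }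
    assert (h4 : 4 ^ n = 2 ^ n * 2 ^ n) by (rewrite <- Rpow_mult_distr; f_equal; lra).
    assert (hp2 : 0 < 2 ^ n) by (apply pow_lt; lra).
    replace (2 * (c / (2 * K) * (a / 2 ^ n + b / 2 ^ n)) * (a / 2 ^ n) + Cmod tau * (2 * (c / (2 * K) * (a / 2 ^ n + b / 2 ^ n)) * (b / 2 ^ n)))
      with (c / (2 * K) * K / 4 ^ n) in hsm by (rewrite h4; unfold K at 2; field; split; lra).
    replace (c / (2 * K) * K / 4 ^ n) with (c / 4 ^ n / 2) in hsm by (rewrite h4; field; split; lra).
    assert (0 < c / 4 ^ n) by (apply Rdiv_lt_0_compat; [exact c0|apply pow_lt; lra]); lra.
Qed.
End Goursat.

(** * Mean values over circles *)

(** The map [exp (s + 2 i pi t)], which wraps vertical unit segments once around circles. *)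
Definition expo (s t : R) : C := Cmult (RtoC (exp s)) (cis (2 * PI * t)).

Lemma expo_plus s t u v : expo (s + u) (t + v) = Cmult (expo s t) (expo u v).
Proof. unfold expo; rewrite exp_plus, Rmult_plus_distr_l, cis_plus, RtoC_mult; ring. Qed.

Lemma continuous_expo s t : continuous (U := CU) (fun p : R * R => expo (fst p) (snd p)) (s, t).
Proof.
  apply continuous_Cmult.
  - apply (continuous_comp fst (fun s => RtoC (exp s) : CU)); [apply continuous_fst|].
    apply (continuous_pair (f := exp) (g := fun _ => 0)); [|apply continuous_const].
    apply (ex_derive_continuous (V := R_NormedModule)); auto_derive; exact I.
  - apply (continuous_comp snd (fun t => cis (2 * PI * t) : CU)); [apply continuous_snd|apply continuous_cis].
Qed.

Lemma Cmod_two_pi_i_le : Cmod two_pi_i <= 8.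
Proof.
  unfold two_pi_i; replace ((0, 2 * PI) : C) with (Cmult Ci (RtoC (2 * PI))) by (apply injective_projections; simpl; ring).
  rewrite Cmod_mult, Cmod_Ci, Cmod_R, Rabs_pos_eq by (pose proof PI_RGT_0; lra).
  pose proof PI_4; lra.
Qed.

Lemma expo_approx e : 0 < e -> exists d, 0 < d /\ forall u v, Rabs u < d -> Rabs v < d ->
  Cmod (Cminus (Cminus (expo u v) (RtoC 1)) (Cplus (RtoC u) (Cmult two_pi_i (RtoC v)))) <= e * (Rabs u + Rabs v).
Proof.
  intros e0; set (e1 := Rmin 1 (e / 2)).
  assert (e10 : 0 < e1) by (apply Rmin_pos; lra).
  pose proof (Rmin_l 1 (e / 2)) as l1; pose proof (Rmin_r 1 (e / 2)) as l2; fold e1 in l1, l2.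
  assert (dexp : is_derive (V := R_NormedModule) exp 0 1).
  { pose proof (is_derive_exp 0) as h; rewrite exp_0 in h; exact h. }
  destruct (proj1 (is_derive_C_iff _ _ _) dexp e1 e10) as [d1 [d10 h1]].
  destruct (proj1 (is_derive_C_iff _ _ _) (is_derive_cis (2 * PI) (RtoC 0) (RtoC 1) 0) e1 e10) as [d2 [d20 h2]].
  (* With [Rabs X <= 2 * Rabs u] and [Cmod Y <= 9 * Rabs v], the product of [X] and [Y] is at most
     [18 * Rabs u * Rabs v], hence at most [e / 2 * Rabs u] once [Rabs v < e / 36]. *)
  assert (d30 : 0 < e / 36) by lra.
  exists (Rmin (Rmin d1 d2) (e / 36)); split; [repeat apply Rmin_pos; assumption|].
  intros u v hu hv.
  specialize (h1 u); specialize (h2 v); rewrite Rminus_0_r in h1, h2.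
  specialize (h1 (Rlt_le_trans _ _ _ hu (Rle_trans _ _ _ (Rmin_l _ _) (Rmin_l _ _)))).
  specialize (h2 (Rlt_le_trans _ _ _ hv (Rle_trans _ _ _ (Rmin_l _ _) (Rmin_r _ _)))).
  assert (hv3 : Rabs v < e / 36) by (apply Rlt_le_trans with (1 := hv), Rmin_r).
  rewrite norm_C_R in h2.
  set (X := exp u - 1); set (Y := Cminus (cis (2 * PI * v)) (RtoC 1)).
  assert (k1 : Rabs (X - u) <= e1 * Rabs u).
  { apply Rle_trans with (2 := h1); right; unfold X.
    match goal with |- _ = norm ?a => change (norm a) with (Rabs a) end; f_equal.
    unfold minus, plus, opp, scal; simpl; unfold mult; simpl; rewrite exp_0; ring. }
  assert (k2 : Cmod (Cminus Y (Cmult two_pi_i (RtoC v))) <= e1 * Rabs v).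
  { apply Rle_trans with (2 := h2); right; f_equal; unfold Y, two_pi_i.
    rewrite Rmult_0_r, cis_0.
    apply injective_projections; unfold cis, minus, plus, opp, scal; simpl; unfold mult; simpl; unfold plus, opp, scal; simpl; unfold mult; simpl; ring. }
  assert (kX : Rabs X <= 2 * Rabs u).
  { replace X with ((X - u) + u) by ring; apply Rle_trans with (1 := Rabs_triang _ _).
    pose proof (Rabs_pos u); nra. }
  pose proof Cmod_two_pi_i_le as hp.
  assert (kY : Cmod Y <= 9 * Rabs v).
  { replace Y with (Cplus (Cminus Y (Cmult two_pi_i (RtoC v))) (Cmult two_pi_i (RtoC v))) by ring.
    apply Rle_trans with (1 := Cmod_triangle _ _); rewrite Cmod_mult, Cmod_R.
    pose proof (Rabs_pos v); nra. }
  replace (Cminus (Cminus (expo u v) (RtoC 1)) (Cplus (RtoC u) (Cmult two_pi_i (RtoC v)))) with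
    (Cplus (Cplus (Cmult (RtoC X) Y) (RtoC (X - u))) (Cminus Y (Cmult two_pi_i (RtoC v))))
    by (unfold expo, X, Y; rewrite !RtoC_minus; ring).
  apply Rle_trans with (1 := Cmod_triangle _ _).
  apply Rle_trans with (1 := Rplus_le_compat_r _ _ _ (Cmod_triangle _ _)).
  rewrite Cmod_mult, !Cmod_R.
  assert (k3 : Rabs X * Cmod Y <= 2 * Rabs u * (9 * Rabs v)).
  { apply Rmult_le_compat; [apply Rabs_pos|apply Cmod_ge_0|assumption|assumption]. }
  pose proof (Rabs_pos u); pose proof (Rabs_pos v).
  assert (k4 : Rabs u * Rabs v <= Rabs u * (e / 36)) by (apply Rmult_le_compat_l; lra).
  assert (k5 : e1 * Rabs u <= e / 2 * Rabs u) by (apply Rmult_le_compat_r; lra).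
  assert (k6 : e1 * Rabs v <= e / 2 * Rabs v) by (apply Rmult_le_compat_r; lra).
  nra.
Qed.

Lemma circle_pt_expo p s t : circle_pt p (exp s) t = Cplus p (expo s t).
Proof. reflexivity. Qed.

(** Chain rule: the exponential is its own derivative, so the slope is [d * expo s t]. *)
Lemma rect_diff_expo (g : C -> C) p s t d : cdiff g (Cplus p (expo s t)) d ->
  rect_diff (fun s t => g (Cplus p (expo s t))) two_pi_i s t.
Proof.
  intros [q [hq [<- hg]]]; set (z := Cplus p (expo s t)) in *; set (E := expo s t) in *.
  exists (Cmult (q z) E); intros e e0.
  assert (cE : continuous (U := CU) (fun p' : R * R => q (Cplus p (expo (fst p') (snd p')))) (s, t)).
  { apply (continuous_comp (fun p' : R * R => Cplus p (expo (fst p') (snd p')) : CU) (q : CU -> CU)); [|exact hq].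
    apply continuous_Cplus; [apply continuous_const|apply continuous_expo]. }
  pose proof (Cmod_ge_0 E) as E0; pose proof (Cmod_ge_0 (q z)) as Q0.
  set (M := (Cmod (q z) + 1) * (Cmod E + 1)).
  assert (M0 : 0 < M) by (apply Rmult_lt_0_compat; lra).
  set (N := 8 * (Cmod E + 1)).
  assert (N0 : 0 < N) by (unfold N; lra).
  pose proof (proj1 (continuous_norm_iff (V := C_NormedModule) _ _) cE) as hc.
  destruct (hc (Rmin 1 (e / (2 * N)))) as [d1 h1]; [apply Rmin_pos; [lra|apply Rdiv_lt_0_compat; lra]|].
  destruct (@expo_approx (Rmin 1 (e / (2 * M)))) as [d2 [d20 h2]]; [apply Rmin_pos; [lra|apply Rdiv_lt_0_compat; lra]|].
  exists (Rmin d1 d2); split; [apply Rmin_pos; [apply cond_pos|exact d20]|intros s' t' hs ht].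
  specialize (h1 (s', t') (conj (Rlt_le_trans _ _ _ hs (Rmin_l _ _)) (Rlt_le_trans _ _ _ ht (Rmin_l _ _)))).
  specialize (h2 _ _ (Rlt_le_trans _ _ _ hs (Rmin_r _ _)) (Rlt_le_trans _ _ _ ht (Rmin_r _ _))).
  simpl in h1; set (z' := Cplus p (expo s' t')) in *.
  change (Cmod (Cminus (q z') (q z)) < Rmin 1 (e / (2 * N))) in h1.
  pose proof (Rmin_l 1 (e / (2 * N))); pose proof (Rmin_r 1 (e / (2 * N))).
  pose proof (Rmin_l 1 (e / (2 * M))); pose proof (Rmin_r 1 (e / (2 * M))).
  set (u := s' - s) in *; set (v := t' - t) in *.
  assert (hz : Cminus z' z = Cmult E (Cminus (expo u v) (RtoC 1))).
  { unfold z', z; replace s' with (s + u) by (unfold u; ring); replace t' with (t + v) by (unfold v; ring).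
    rewrite expo_plus; fold E; ring. }
  rewrite (hg z'), hz.
  set (W := Cminus (Cminus (expo u v) (RtoC 1)) (Cplus (RtoC u) (Cmult two_pi_i (RtoC v)))) in *.
  set (T := Cplus (RtoC u) (Cmult two_pi_i (RtoC v))) in *.
  replace (Cminus (Cminus _ (g z)) (Cmult (Cmult (q z) E) T)) with
    (Cplus (Cmult (q z') (Cmult E W)) (Cmult (Cminus (q z') (q z)) (Cmult E T))) by (unfold W; ring).
  assert (hT : Cmod T <= 8 * (Rabs u + Rabs v)).
  { unfold T; apply Rle_trans with (1 := Cmod_triangle _ _); rewrite Cmod_mult, !Cmod_R.
    pose proof Cmod_two_pi_i_le as hp.
    pose proof (Rabs_pos u); pose proof (Rabs_pos v); nra. }
  assert (hq' : Cmod (q z') <= Cmod (q z) + 1) by (pose proof (Cmod_le_minus (q z') (q z)); lra).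
  apply Rle_trans with (1 := Cmod_triangle _ _); rewrite !Cmod_mult.
  set (S := Rabs u + Rabs v) in *.
  assert (S0 : 0 <= S) by (unfold S; pose proof (Rabs_pos u); pose proof (Rabs_pos v); lra).
  apply Rle_trans with ((Cmod (q z) + 1) * ((Cmod E + 1) * (e / (2 * M) * S)) + e / (2 * N) * ((Cmod E + 1) * (8 * S))).
  - apply Rplus_le_compat.
    + apply Rmult_le_compat; [apply Cmod_ge_0| |exact hq'|].
      * apply Rmult_le_pos; apply Cmod_ge_0.
      * apply Rmult_le_compat; [exact E0|apply Cmod_ge_0|lra|].
        apply Rle_trans with (1 := h2); apply Rmult_le_compat_r; lra.
    + apply Rmult_le_compat; [apply Cmod_ge_0| |lra|].
      * apply Rmult_le_pos; apply Cmod_ge_0.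
      * apply Rmult_le_compat; [exact E0|apply Cmod_ge_0|lra|lra].
  - right; unfold M, N; field; split; lra.
Qed.

Section LimitOfConstant.
Variables (J : R -> C) (c : C) (a b : R).
Hypotheses (hab : a < b) (hJ : forall r, a < r < b -> J r = c).

(** With its mirror image, this carries the constancy of circle means to the radius through the
    exceptional point, from either side, and down to radius [0]. *)
Lemma continuous_const_left : continuous (U := CU) J a -> J a = c.
Proof.
  intros hc; apply Cminus_eq_0, Cmod_eq_0, Rle_antisym; [|apply Cmod_ge_0].
  apply le_epsilon; intros e e0.
  destruct (proj1 (continuous_norm_iff (V := C_NormedModule) _ _) hc e e0) as [d hd].
  set (r := a + Rmin d (b - a) / 2).
  assert (0 < Rmin d (b - a)) by (apply Rmin_pos; [apply cond_pos|lra]).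
  pose proof (Rmin_l d (b - a)); pose proof (Rmin_r d (b - a)).
  specialize (hd r); rewrite hJ in hd by (unfold r; lra).
  assert (hr : ball a d r).
  { change (Rabs (r - a) < d); rewrite Rabs_pos_eq; unfold r; lra. }
  specialize (hd hr); change (Cmod (Cminus c (J a)) < e) in hd; rewrite Cmod_minus_sym; lra.
Qed.

Lemma continuous_const_right : continuous (U := CU) J b -> J b = c.
Proof.
  intros hc; apply Cminus_eq_0, Cmod_eq_0, Rle_antisym; [|apply Cmod_ge_0].
  apply le_epsilon; intros e e0.
  destruct (proj1 (continuous_norm_iff (V := C_NormedModule) _ _) hc e e0) as [d hd].
  set (r := b - Rmin d (b - a) / 2).
  assert (0 < Rmin d (b - a)) by (apply Rmin_pos; [apply cond_pos|lra]).
  pose proof (Rmin_l d (b - a)); pose proof (Rmin_r d (b - a)).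
  specialize (hd r); rewrite hJ in hd by (unfold r; lra).
  assert (hr : ball b d r).
  { change (Rabs (r - b) < d); rewrite Rabs_minus_sym, Rabs_pos_eq; unfold r; lra. }
  specialize (hd hr); change (Cmod (Cminus c (J b)) < e) in hd; rewrite Cmod_minus_sym; lra.
Qed.
End LimitOfConstant.

Notation cmeanC := (cmean (V := CV)).

Section CircleMeanValue.
Variables (g : C -> C) (p w : C) (R0 R1 : R).
Hypotheses (hR : 0 < R0 < R1) (hw : Cmod (Cminus w p) < R0).
Hypothesis g_cont : forall z, Cmod (Cminus z p) < R1 -> continuous (T := CU) (U := CU) g z.
Hypothesis g_diff : forall z, Cmod (Cminus z p) < R1 -> z <> w -> exists d, cdiff g z d.

(** Goursat's lemma asks for differentiability on the closed rectangle, so the exceptional point [w]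
    has to stay off the closed annulus. *)
Lemma cmean_const_annulus r1 r2 : 0 < r1 -> r1 < r2 -> r2 < R1 -> (r2 < Cmod (Cminus w p) \/ Cmod (Cminus w p) < r1) ->
  cmeanC g p r1 = cmeanC g p r2.
Proof.
  intros h0 h1 h2 hwr.
  assert (hln : ln r1 < ln r2) by (apply ln_increasing; lra).
  set (G s t := g (Cplus p (expo s t))).
  assert (hE : forall s t, Cmod (Cminus (Cplus p (expo s t)) p) = exp s).
  { intros s t; rewrite <- circle_pt_expo; apply Cmod_circle_pt, Rlt_le, exp_pos. }
  assert (hs : forall s, ln r1 <= s <= ln r1 + (ln r2 - ln r1) -> r1 <= exp s <= r2).
  { intros s hs; split.
    - rewrite <- (exp_ln r1) by lra; destruct (Req_dec (ln r1) s) as [->|]; [lra|apply Rlt_le, exp_increasing; lra].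
    - rewrite <- (exp_ln r2) by lra; destruct (Req_dec s (ln r2)) as [->|]; [lra|apply Rlt_le, exp_increasing; lra]. }
  assert (hI : rect_int G two_pi_i (ln r1) 0 (ln r2 - ln r1) 1 = RtoC 0).
  { apply goursat; [lra|lra| |].
    - intros s t hst _.
      apply (continuous_comp (fun q : R * R => Cplus p (expo (fst q) (snd q)) : CU) (g : CU -> CU)).
      + apply continuous_Cplus; [apply continuous_const|apply continuous_expo].
      + apply g_cont; rewrite hE; specialize (hs s hst); simpl; lra.
    - intros s t hst _; specialize (hs s hst).
      destruct (g_diff (z := Cplus p (expo s t))) as [d hd].
      + rewrite hE; lra.
      + intros e; rewrite <- e, hE in hwr; lra.
      + exact (rect_diff_expo hd). }
  unfold rect_int in hI.
  assert (eln : ln r1 + (ln r2 - ln r1) = ln r2) by ring; rewrite eln, Rplus_0_l in hI.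
  assert (hper : forall s, G s 1 = G s 0).
  { assert (e : cis (2 * PI * 1) = cis (2 * PI * 0)).
    { rewrite <- (cis_period (2 * PI * 0) 1); f_equal; lra. }
    intros s; unfold G, expo; rewrite e; reflexivity. }
  assert (e1 : RIntC (fun s => G s 1) (ln r1) (ln r2) = RIntC (fun s => G s 0) (ln r1) (ln r2)).
  { apply (RInt_ext (V := real_module CV)); intros s _; apply hper. }
  assert (e2 : forall r, 0 < r -> RIntC (G (ln r)) 0 1 = cmeanC g p r).
  { intros r hr; apply (RInt_ext (V := real_module CV)); intros t _.
    unfold G; rewrite <- circle_pt_expo, exp_ln by exact hr; reflexivity. }
  rewrite e1, !e2 in hI by lra.
  apply NNPP; intros hne.
  apply (Cmult_neq_0 two_pi_i (Cminus (cmeanC g p r2) (cmeanC g p r1)) two_pi_i_neq_0).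
  - apply Cminus_neq_0; intros e; apply hne; symmetry; exact e.
  - etransitivity; [|exact hI]; ring.
Qed.

Lemma cmean_continuous_radius r : 0 <= r < R1 -> continuous (U := CU) (cmeanC g p) r.
Proof.
  intros hr; apply (continuous_RInt_param (V := real_module CV) (T := R_UniformSpace) (F := fun t r => g (circle_pt p r t))); [lra|].
  assert (d0 : 0 < R1 - r) by lra.
  exists (mkposreal _ d0); intros r' hr' t _; change (Rabs (r' - r) < R1 - r) in hr'.
  apply (continuous_comp (fun q : R * R => circle_pt p (snd q) (fst q) : CU) (g : CU -> CU)).
  - unfold circle_pt; apply continuous_Cplus; [apply continuous_const|apply continuous_Cmult].
    + apply (continuous_comp snd (fun r => RtoC r : CU)); [apply continuous_snd|].
      apply (continuous_pair (f := fun r : R => r) (g := fun _ => 0)); [apply continuous_id|apply continuous_const].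
    + apply (continuous_comp fst (fun t => cis (2 * PI * t) : CU)); [apply continuous_fst|apply continuous_cis].
  - apply g_cont; unfold circle_pt; simpl.
    replace (Cminus (Cplus p (Cmult (RtoC r') (cis (2 * PI * t)))) p) with (Cmult (RtoC r') (cis (2 * PI * t))) by ring.
    rewrite Cmod_mult, Cmod_R, Cmod_cis, Rmult_1_r.
    pose proof (Rabs_triang (r' - r) r) as h; assert (er : (r' - r + r)%R = r' :> R) by lra; rewrite er in h.
    rewrite (Rabs_pos_eq r) in h by lra; lra.
Qed.

(** In the coordinate [log (z - p)] circles become vertical segments of length [2 pi], and
    the horizontal sides of a rectangle between two of them cancel by periodicity. *)
Lemma cmean_center : cmeanC g p R0 = g p.
Proof.
  set (J := cmeanC g p); set (rho := Cmod (Cminus w p)) in *.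
  assert (rho0 : 0 <= rho) by apply Cmod_ge_0.
  assert (hJ0 : J 0 = g p).
  { unfold J, cmean; rewrite (RInt_ext (V := real_module CV) _ (fun _ => g p)).
    - rewrite (RInt_const (V := real_module CV)).
      rewrite Rminus_0_r; exact (scal_one (g p : real_module CV)).
    - intros t _; unfold circle_pt; f_equal; ring. }
  assert (e1 : J rho = J R0).
  { apply (@continuous_const_left J (J R0) rho R0 hw); [|apply cmean_continuous_radius; lra].
    intros r hr; apply cmean_const_annulus; [lra|lra|lra|right; fold rho; lra]. }
  rewrite <- hJ0, <- e1.
  destruct (Req_dec rho 0) as [h0|h0]; [rewrite h0; reflexivity|].
  (* Inside the circle through [w] all means agree with the one at [rho / 2]; continuity in the
     radius extends this to both ends, [0] and [rho]. *)
  assert (hin : forall r, 0 < r < rho -> J r = J (rho / 2)).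
  { intros r hr; destruct (Rtotal_order r (rho / 2)) as [h|[->|h]].
    - apply cmean_const_annulus; [lra|lra|lra|left; fold rho; lra].
    - reflexivity.
    - symmetry; apply cmean_const_annulus; [lra|lra|lra|left; fold rho; lra]. }
  transitivity (J (rho / 2)).
  - apply (@continuous_const_right J (J (rho / 2)) 0 rho); [lra|exact hin|apply cmean_continuous_radius; lra].
  - symmetry; apply (@continuous_const_left J (J (rho / 2)) 0 rho); [lra|exact hin|apply cmean_continuous_radius; lra].
Qed.
End CircleMeanValue.

(** * Cauchy's formula on a disc *)

Ltac cring := match goal with |- ?a = ?b => change (@eq C a b) end; ring.

Lemma is_linear_Cmult (a : C) : is_linear (U := C_NormedModule) (V := C_NormedModule) (fun x : C => Cmult a x).
Proof. exact (is_linear_scal_C C_NormedModule a). Qed.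

(** With [a = (w - p) / r] the integrand is [1 / (1 - a * cis (- (2 * PI * t)))], a geometric series
    in negative powers; hence the exponent [-1] in [geometric_mean]. *)
Lemma cmean_cauchy_weight p w r : Cmod (Cminus w p) < r ->
  cmeanC (fun z => Cdiv (Cminus z p) (Cminus z w)) p r = RtoC 1.
Proof.
  intros hw.
  assert (hr : 0 < r) by (pose proof (Cmod_ge_0 (Cminus w p)); lra).
  assert (hr' : RtoC r <> RtoC 0) by (intros h; apply RtoC_inj in h; lra).
  assert (hne : forall z, Cmod (Cminus z p) = r -> Cminus z w <> RtoC 0).
  { intros z hz; apply Cminus_neq_0; intros ->; lra. }
  set (a := Cdiv (Cminus w p) (RtoC r)).
  assert (ha : Cmod a < 1).
  { unfold a; rewrite Cmod_div, Cmod_R, Rabs_pos_eq by (assumption || lra).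
    apply (Rmult_lt_reg_r r); [exact hr|]; unfold Rdiv; rewrite Rmult_assoc, Rinv_l; lra. }
  apply (@geometric_mean CV _ (fun x => Cmult a x) (RtoC 1) (Cmod a) (-1)%Z).
  - right; reflexivity.
  - intros t _; apply (@continuous_circle_comp CV (fun z => Cdiv (Cminus z p) (Cminus z w))); [lra|].
    intros z hz; apply continuous_Cdiv; [apply hne, hz| |];
      apply continuous_Csub.
  - apply is_linear_Cmult.
  - split; [apply Cmod_ge_0|exact ha].
  - intros x; right; apply Cmod_mult.
  - intros t _.
    match goal with |- ?u = plus ?v (scal ?k ?x) => change (@eq C u (Cplus v (Cmult k x))) end.
    replace (2 * PI * -1 * t) with (- (2 * PI * t)) by ring; rewrite cis_opp.
    assert (h : Cminus (circle_pt p r t) w <> RtoC 0) by (apply hne, Cmod_circle_pt; lra).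
    assert (hc : cis (2 * PI * t) <> RtoC 0) by apply cis_neq_0.
    assert (ez : Cminus (circle_pt p r t) p = Cmult (RtoC r) (cis (2 * PI * t))) by (unfold circle_pt; ring).
    rewrite ez; unfold a.
    assert (ew : Cminus (circle_pt p r t) w = Cminus (Cmult (RtoC r) (cis (2 * PI * t))) (Cminus w p)) by (unfold circle_pt; ring).
    rewrite ew in h |- *; field; repeat split; assumption.
Qed.

Section CauchyFormula.
Variables (f : C -> C) (p : C) (R0 R1 : R).
Hypothesis hR : 0 < R0 < R1.
Hypothesis f_diff : forall z, Cmod (Cminus z p) < R1 -> exists d, cdiff f z d.

Lemma cdiff_disc_continuous z : Cmod (Cminus z p) < R1 -> continuous (T := CU) (U := CU) f z.
Proof. intros hz; destruct (f_diff hz) as [d hd]; exact (cdiff_continuous hd). Qed.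

(** The slope [q] of [f] at [w] is continuous at [w] and differentiable elsewhere, so
    [q z * (z - p)] has as mean its value at the centre, zero. Only [f w] times the mean of the
    Cauchy weight remains. *)
Lemma cauchy_formula w : Cmod (Cminus w p) < R0 ->
  cmeanC (fun z => Cmult (f z) (Cdiv (Cminus z p) (Cminus z w))) p R0 = f w.
Proof.
  intros hw; destruct (f_diff (z := w)) as [d [q [hq [_ hf]]]]; [lra|].
  assert (hne : forall z, Cmod (Cminus z p) = R0 -> Cminus z w <> RtoC 0).
  { intros z hz; apply Cminus_neq_0; intros ->; lra. }
  assert (hqc : forall z, Cmod (Cminus z p) < R1 -> z <> w -> exists d, cdiff q z d).
  { intros z hz hzw; pose proof (proj1 (Cmod_gt_0 _) (Cminus_neq_0 hzw)) as h0.
    destruct (f_diff hz) as [d1 hd1].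
    pose proof (cdiff_minus hd1 (cdiff_const (f w) z)) as k1.
    pose proof (cdiff_inv (f := fun y => Cminus y w) (Cminus_neq_0 hzw) (cdiff_minus (cdiff_id z) (cdiff_const w z))) as k2.
    eexists; apply (cdiff_ext_loc (f := fun y => Cmult (Cminus (f y) (f w)) (Cinv (Cminus y w)))); [|exact (cdiff_mult k1 k2)].
    exists (Cmod (Cminus z w)); split; [exact h0|intros y hy].
    rewrite (hf y); field; apply Cminus_neq_0; intros ->.
    rewrite Cmod_minus_sym in hy; lra. }
  assert (hm : cmeanC (fun z => Cmult (q z) (Cminus z p)) p R0 = RtoC 0).
  { rewrite (@cmean_center (fun z => Cmult (q z) (Cminus z p)) p w R0 R1 hR hw); [cring| |].
    - intros z hz; apply continuous_Cmult; [|apply continuous_Csub].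
      destruct (excluded_middle_informative (z = w)) as [->|n]; [exact hq|].
      destruct (hqc z hz n) as [d1 hd1]; exact (cdiff_continuous hd1).
    - intros z hz hn; destruct (hqc z hz hn) as [d1 hd1]; eexists.
      exact (cdiff_mult hd1 (cdiff_minus (cdiff_id z) (cdiff_const p z))). }
  assert (cw : forall z, Cmod (Cminus z p) = R0 -> continuous (T := CU) (U := CU) (fun z => Cdiv (Cminus z p) (Cminus z w)) z).
  { intros z hz; apply continuous_Cdiv; [apply hne, hz| |];
      apply continuous_Csub. }
  assert (e : RInt (V := real_module CV) (fun t => Cmult (f (circle_pt p R0 t)) (Cdiv (Cminus (circle_pt p R0 t) p) (Cminus (circle_pt p R0 t) w))) 0 1 =
     Cplus (cmeanC (fun z => Cmult (q z) (Cminus z p)) p R0) (Cmult (f w) (cmeanC (fun z => Cdiv (Cminus z p) (Cminus z w)) p R0))).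
  { unfold cmean at 2.
    rewrite <- (@RInt_linear CV CV _ (fun t => Cdiv (Cminus (circle_pt p R0 t) p) (Cminus (circle_pt p R0 t) w)) (is_linear_Cmult (f w))).
    - unfold cmean; etransitivity; [|apply (RInt_plus (V := real_module CV))].
      + apply (RInt_ext (V := real_module CV)); intros t _.
        assert (h : Cminus (circle_pt p R0 t) w <> RtoC 0) by (apply hne, Cmod_circle_pt; lra).
        match goal with |- ?u = plus ?x ?y => change (@eq C u (Cplus x y)) end.
        rewrite (hf (circle_pt p R0 t)); field; exact h.
      + apply (ex_RInt_01 (V := CV)); intros t _.
        apply (continuous_circle_comp (V := CV) (F := fun z => Cmult (q z) (Cminus z p))); [lra|].
        intros z hz; apply continuous_Cmult; [|apply continuous_Csub].
        destruct (hqc z ltac:(lra) (fun e => hne z hz ltac:(rewrite e; ring))) as [d1 hd1]; exact (cdiff_continuous hd1).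
      + apply (ex_RInt_01 (V := CV)); intros t _.
        apply (continuous_circle_comp (V := CV) (F := fun z => Cmult (f w) (Cdiv (Cminus z p) (Cminus z w)))); [lra|].
        intros z hz; apply continuous_Cmult; [apply continuous_const|apply cw, hz].
    - intros t _; apply (continuous_circle_comp (V := CV) (F := fun z => Cdiv (Cminus z p) (Cminus z w))); [lra|exact cw]. }
  unfold cmean at 1; etransitivity; [exact e|].
  rewrite hm, cmean_cauchy_weight by exact hw.
  match goal with |- ?u = ?v => change (@eq C u v) end; ring.
Qed.

(** The Cauchy integral representing the difference quotient [(f z - f w) / (z - w)]. *)
Definition cauchy_slope (z w : C) : C :=
  cmeanC (fun y => Cdiv (Cmult (f y) (Cminus y p)) (Cmult (Cminus y z) (Cminus y w))) p R0.

Lemma cauchy_slope_mult z w : Cmod (Cminus z p) < R0 -> Cmod (Cminus w p) < R0 ->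
  Cmult (cauchy_slope z w) (Cminus z w) = Cminus (f z) (f w).
Proof.
  intros hz hw.
  assert (hne : forall w, Cmod (Cminus w p) < R0 -> forall y, Cmod (Cminus y p) = R0 -> Cminus y w <> RtoC 0).
  { intros v hv y hy; apply Cminus_neq_0; intros ->; lra. }
  assert (hc : forall w, Cmod (Cminus w p) < R0 -> forall y, Cmod (Cminus y p) = R0 ->
    continuous (T := CU) (U := CU) (fun y => Cmult (f y) (Cdiv (Cminus y p) (Cminus y w))) y).
  { intros v hv y hy; apply continuous_Cmult; [apply cdiff_disc_continuous; lra|].
    apply continuous_Cdiv; [apply (hne v hv y hy)| |]; apply continuous_Csub. }
  rewrite <- (cauchy_formula hz), <- (cauchy_formula hw); unfold cauchy_slope, cmean.
  rewrite Cmult_comm.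
  etransitivity; [symmetry; apply (@RInt_linear CV CV _ _ (is_linear_Cmult (Cminus z w)))|].
  - intros t _; apply (continuous_circle_comp (V := CV) (F := fun y => Cdiv (Cmult (f y) (Cminus y p)) (Cmult (Cminus y z) (Cminus y w)))); [lra|].
    intros y hy; apply continuous_Cdiv.
    + apply Cmult_neq_0; [apply (hne z hz y hy)|apply (hne w hw y hy)].
    + apply continuous_Cmult; [apply cdiff_disc_continuous; lra|apply continuous_Csub].
    + apply continuous_Cmult; apply continuous_Csub.
  - etransitivity; [|apply (RInt_minus (V := real_module CV))].
    + apply (RInt_ext (V := real_module CV)); intros t _.
      assert (hy : Cmod (Cminus (circle_pt p R0 t) p) = R0) by (apply Cmod_circle_pt; lra).
      match goal with |- ?u = minus ?x ?y => change (@eq C u (Cminus x y)) end.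
      pose proof (hne z hz _ hy); pose proof (hne w hw _ hy); field; split; assumption.
    + apply (ex_RInt_01 (V := CV)); intros t _.
      apply (continuous_circle_comp (V := CV) (F := fun y => Cmult (f y) (Cdiv (Cminus y p) (Cminus y z)))); [lra|apply hc, hz].
    + apply (ex_RInt_01 (V := CV)); intros t _.
      apply (continuous_circle_comp (V := CV) (F := fun y => Cmult (f y) (Cdiv (Cminus y p) (Cminus y w)))); [lra|apply hc, hw].
Qed.

Lemma disc_open r : open ((fun z => Cmod (Cminus z p) < r) : CU -> Prop).
Proof.
  apply open_Cmod; intros z hz; exists (r - Cmod (Cminus z p)); split; [lra|intros y hy].
  replace (Cminus y p) with (Cplus (Cminus y z) (Cminus z p)) by ring.
  pose proof (Cmod_triangle (Cminus y z) (Cminus z p)); lra.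
Qed.

Lemma cauchy_param_continuous (T : UniformSpace) (h : T -> C -> C) (s0 : T) :
  locally s0 (fun s => forall y, Cmod (Cminus y p) = R0 -> continuous (T := prod_UniformSpace T CU) (U := CU) (fun q => h (fst q) (snd q)) (s, y)) ->
  continuous (U := CU) (fun s => cmeanC (h s) p R0) s0.
Proof.
  intros hl; apply (continuous_RInt_param (V := real_module CV) (F := fun t s => h s (circle_pt p R0 t))); [lra|].
  revert hl; apply filter_imp; intros s hs t _.
  apply (continuous_comp_2 (snd : R * T -> T) (fun q => circle_pt p R0 (fst q) : CU) h (t, s)).
  - apply continuous_snd.
  - apply (continuous_comp fst (circle_pt p R0 : R -> CU)); [apply continuous_fst|apply continuous_circle_pt].
  - apply hs, Cmod_circle_pt; lra.
Qed.

Lemma cauchy_slope_continuous z w : Cmod (Cminus z p) < R0 -> Cmod (Cminus w p) < R0 ->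
  continuous (T := CU2) (U := CU) (fun q => cauchy_slope (fst q) (snd q)) (z, w).
Proof.
  intros hz hw.
  apply (cauchy_param_continuous (T := CU2)
    (h := fun q y => Cdiv (Cmult (f y) (Cminus y p)) (Cmult (Cminus y (fst q)) (Cminus y (snd q))))).
  destruct (disc_open hz) as [d1 h1]; destruct (disc_open hw) as [d2 h2].
  exists (mkposreal _ (Rmin_stable_in_posreal d1 d2)); intros [z' w'] [k1 k2] y hy; simpl in k1, k2.
  assert (hz' : Cmod (Cminus z' p) < R0) by (apply h1, (ball_le (M := CU) z _ _ (Rmin_l d1 d2)), k1).
  assert (hw' : Cmod (Cminus w' p) < R0) by (apply h2, (ball_le (M := CU) w _ _ (Rmin_r d1 d2)), k2).
  apply continuous_Cdiv; simpl.
  - apply Cmult_neq_0; apply Cminus_neq_0; intros ->; lra.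
  - apply continuous_Cmult.
    + apply (continuous_comp (snd : (CU * CU) * CU -> CU) (f : CU -> CU)); [apply continuous_snd|].
      apply cdiff_disc_continuous; simpl; lra.
    + apply continuous_Cminus; [apply continuous_snd|apply continuous_const].
  - apply continuous_Cmult; (apply continuous_Cminus; [apply continuous_snd|]).
    + apply (continuous_comp (fst : (CU * CU) * CU -> _) fstC); [apply continuous_fst|apply continuous_fst].
    + apply (continuous_comp (fst : (CU * CU) * CU -> _) sndC); [apply continuous_fst|apply continuous_snd].
Qed.

(** At [z = w] the difference quotient in [z] of the kernel yields another Cauchy integral, which is
    continuous. Off the diagonal, [slope] is an ordinary quotient and the rules of differentiation
    suffice. *)
Lemma cauchy_slope_cdiff w : Cmod (Cminus w p) < R0 -> exists d, cdiff (fun z => cauchy_slope z w) w d.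
Proof.
  intros hw.
  set (q z := cmeanC (fun y => Cdiv (Cmult (f y) (Cminus y p)) (Cmult (Cminus y z) (Cmult (Cminus y w) (Cminus y w)))) p R0).
  assert (hne : forall w, Cmod (Cminus w p) < R0 -> forall y, Cmod (Cminus y p) = R0 -> Cminus y w <> RtoC 0).
  { intros v hv y hy; apply Cminus_neq_0; intros ->; lra. }
  assert (fp : forall y, Cmod (Cminus y p) = R0 -> continuous (T := CU) (U := CU) (fun y => Cmult (f y) (Cminus y p)) y).
  { intros y hy; apply continuous_Cmult; [apply cdiff_disc_continuous; lra|apply continuous_Csub]. }
  exists (q w).
  apply (@cdiff_ext_loc (fun z => Cplus (cauchy_slope w w) (Cmult (q z) (Cminus z w)))).
  - exists (R0 - Cmod (Cminus w p)); split; [lra|intros z hz].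
    assert (hz' : Cmod (Cminus z p) < R0).
    { replace (Cminus z p) with (Cplus (Cminus z w) (Cminus w p)) by ring.
      pose proof (Cmod_triangle (Cminus z w) (Cminus w p)); lra. }
    assert (c2 : forall z, Cmod (Cminus z p) < R0 -> forall y, Cmod (Cminus y p) = R0 -> continuous (T := CU) (U := CU)
      (fun y => Cdiv (Cmult (f y) (Cminus y p)) (Cmult (Cminus y z) (Cminus y w))) y).
    { intros v hv y hy; apply continuous_Cdiv; [apply Cmult_neq_0; [apply (hne v hv y hy)|apply (hne w hw y hy)]|apply fp, hy|].
      apply continuous_Cmult; apply continuous_Csub. }
    assert (c3 : forall y, Cmod (Cminus y p) = R0 -> continuous (T := CU) (U := CU)
      (fun y => Cdiv (Cmult (f y) (Cminus y p)) (Cmult (Cminus y z) (Cmult (Cminus y w) (Cminus y w)))) y).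
    { intros y hy; apply continuous_Cdiv; [apply Cmult_neq_0; [apply (hne z hz' y hy)|apply Cmult_neq_0; apply (hne w hw y hy)]|apply fp, hy|].
      apply continuous_Cmult; [|apply continuous_Cmult]; apply continuous_Csub. }
    symmetry; unfold cauchy_slope, q, cmean; rewrite Cmult_comm.
    etransitivity; [|apply (f_equal2 Cplus eq_refl (@RInt_linear CV CV _ _ (is_linear_Cmult (Cminus z w))
      (fun t _ => continuous_circle_comp (V := CV) (p := p) (t := t) (Rlt_le _ _ (proj1 hR)) c3)))].
    etransitivity; [|apply (RInt_plus (V := real_module CV))].
    + apply (RInt_ext (V := real_module CV)); intros t _.
      assert (hy : Cmod (Cminus (circle_pt p R0 t) p) = R0) by (apply Cmod_circle_pt; lra).
      match goal with |- ?u = plus ?x ?y => change (@eq C u (Cplus x y)) end.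
      pose proof (hne z hz' _ hy); pose proof (hne w hw _ hy); field; split; assumption.
    + apply (ex_RInt_01 (V := CV)); intros t _.
      apply (continuous_circle_comp (V := CV) (F := fun y => Cdiv (Cmult (f y) (Cminus y p)) (Cmult (Cminus y w) (Cminus y w)))); [lra|apply c2, hw].
    + apply (ex_RInt_01 (V := CV)); intros t _.
      apply (continuous_linear (is_linear_Cmult (Cminus z w))).
      apply (continuous_circle_comp (V := CV)
        (F := fun y => Cdiv (Cmult (f y) (Cminus y p)) (Cmult (Cminus y z) (Cmult (Cminus y w) (Cminus y w))))); [lra|exact c3].
  - exists q; split; [|split; [reflexivity|intros y; ring]].
    apply (cauchy_param_continuous (T := CU)
      (h := fun z y => Cdiv (Cmult (f y) (Cminus y p)) (Cmult (Cminus y z) (Cmult (Cminus y w) (Cminus y w))))).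
    generalize (disc_open hw); apply filter_imp; intros z hz y hy.
    apply continuous_Cdiv; simpl.
    + apply Cmult_neq_0; [apply (hne z hz y hy)|apply Cmult_neq_0; apply (hne w hw y hy)].
    + apply (continuous_comp sndC (fun y => Cmult (f y) (Cminus y p) : CU)); [apply continuous_snd|apply fp, hy].
    + apply continuous_Cmult; [apply continuous_Cminus; [apply continuous_snd|apply continuous_fst]|].
      apply continuous_Cmult; (apply continuous_Cminus; [apply continuous_snd|apply continuous_const]).
Qed.
End CauchyFormula.

(** * Dixon's proof of Cauchy's theorem *)

Lemma Cmod_minus_diag z : Cmod (Cminus z z) = 0.
Proof. replace (Cminus z z) with (RtoC 0) by ring; apply Cmod_0. Qed.

Lemma cdiff_unique f z d d' : cdiff f z d -> cdiff f z d' -> d = d'.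
Proof.
  intros [p [hp [<- hf]]] [q [hq [<- hg]]].
  apply Cminus_eq_0, NNPP; intros hne.
  destruct (@continuous_C_nonzero (fun y => Cminus (p y) (q y)) z (continuous_Cminus hp hq) hne) as [e [e0 he]].
  set (y := Cplus z (RtoC (e / 2))).
  assert (hy : Cminus y z = RtoC (e / 2)) by (unfold y; ring).
  apply (he y); [rewrite hy, Cmod_R, Rabs_pos_eq; lra|].
  assert (h0 : RtoC (e / 2) <> RtoC 0) by (intros h; apply RtoC_inj in h; lra).
  apply NNPP; intros hne'.
  apply (Cmult_neq_0 _ _ hne' h0); rewrite <- hy.
  assert (h : Cmult (p y) (Cminus y z) = Cmult (q y) (Cminus y z)).
  { replace (Cmult (p y) (Cminus y z)) with (Cminus (f y) (f z)) by (rewrite (hf y); ring); rewrite (hg y); ring. }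
  replace (Cmult (Cminus (p y) (q y)) (Cminus y z)) with (Cminus (Cmult (p y) (Cminus y z)) (Cmult (q y) (Cminus y z))) by ring.
  rewrite h; ring.
Qed.

Lemma cont_on_trace_bounded (V : CompleteNormedModule C_AbsRing) (F : C -> V) G : cont_on (trace G) F ->
  exists B, 0 <= B /\ forall z, trace G z -> norm (F z) <= B.
Proof.
  induction G as [|g G IH]; intros hF; [exists 0; split; [lra|intros z [g [[] _]]]|].
  destruct (IH (cont_on_tail hF)) as [B [B0 HB]].
  destruct (bounded_continuity (V := V) (fun t => F (g t)) 0 1) as [N HN].
  { intros t ht; apply (continuous_comp (g : R -> CU) F t); [apply arc_continuous, ht|].
    apply (cont_on_arc (in_eq g G) hF ht). }
  exists (Rmax B N); split; [apply Rle_trans with (1 := B0), Rmax_l|].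
  intros z hz; apply trace_cons in hz; destruct hz as [[t [ht ->]]|hz].
  - apply Rle_trans with (2 := Rmax_r _ _), Rlt_le, HN, ht.
  - apply Rle_trans with (2 := Rmax_l _ _), HB, hz.
Qed.

(** * The difference quotient across the diagonal *)

Section Slope.
Variables (U : C -> Prop) (f f' : C -> C).
Hypothesis U_open : open (U : CU -> Prop).
Hypothesis f_diff : forall z, U z -> cdiff f z (f' z).

Definition slope (z w : C) : C :=
  if excluded_middle_informative (@eq C z w) then f' z else Cdiv (Cminus (f z) (f w)) (Cminus z w).

Lemma slope_neq z w : z <> w -> slope z w = Cdiv (Cminus (f z) (f w)) (Cminus z w).
Proof. intros h; unfold slope; destruct excluded_middle_informative; [contradiction|reflexivity]. Qed.

Lemma slope_diag z : slope z z = f' z.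
Proof. unfold slope; destruct excluded_middle_informative as [|n]; [reflexivity|elim n; reflexivity]. Qed.

Lemma slope_sym z w : slope z w = slope w z.
Proof.
  destruct (classic (z = w)) as [->|h]; [reflexivity|].
  rewrite !slope_neq by congruence; field; split; apply Cminus_neq_0; congruence.
Qed.

Lemma slope_mult z w : Cmult (slope z w) (Cminus z w) = Cminus (f z) (f w).
Proof.
  destruct (classic (z = w)) as [->|h]; [ring|].
  rewrite slope_neq by exact h; field; apply Cminus_neq_0, h.
Qed.

(** Near a diagonal point the quotient is a Cauchy integral in both variables, which gives joint
    continuity and differentiability across the diagonal. The diagonal value is identified by
    uniqueness of the derivative. *)
Lemma slope_cauchy p : U p -> exists R0, 0 < R0 /\ exists R1, R0 < R1 /\ (forall z, Cmod (Cminus z p) < R1 -> U z) /\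
  forall z w, Cmod (Cminus z p) < R0 -> Cmod (Cminus w p) < R0 -> slope z w = cauchy_slope f p R0 z w.
Proof.
  intros hp; destruct (proj1 (open_Cmod U) U_open p hp) as [R1 [hR1 hU]].
  exists (R1 / 2); split; [lra|exists R1; split; [lra|split; [exact hU|]]].
  assert (hR : 0 < R1 / 2 < R1) by lra.
  assert (fd : forall z, Cmod (Cminus z p) < R1 -> exists d, cdiff f z d) by (intros z hz; exists (f' z); apply f_diff, hU, hz).
  assert (off : forall z w, z <> w -> Cmod (Cminus z p) < R1 / 2 -> Cmod (Cminus w p) < R1 / 2 -> slope z w = cauchy_slope f p (R1 / 2) z w).
  { intros z w hzw hz hw; rewrite slope_neq by exact hzw.
    rewrite <- (cauchy_slope_mult hR fd hz hw); field; apply Cminus_neq_0, hzw. }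
  intros z w hz hw; destruct (classic (z = w)) as [->|h]; [|apply off; assumption].
  rewrite slope_diag; apply (@cdiff_unique f w); [apply f_diff, hU; lra|].
  apply (@cdiff_ext_loc (fun y => Cplus (f w) (Cmult (cauchy_slope f p (R1 / 2) y w) (Cminus y w)))).
  - exists (R1 / 2 - Cmod (Cminus w p)); split; [lra|intros y hy].
    assert (hy' : Cmod (Cminus y p) < R1 / 2).
    { replace (Cminus y p) with (Cplus (Cminus y w) (Cminus w p)) by ring.
      pose proof (Cmod_triangle (Cminus y w) (Cminus w p)); lra. }
    rewrite (cauchy_slope_mult hR fd hy' hw); ring.
  - exists (fun y => cauchy_slope f p (R1 / 2) y w); split; [|split; [reflexivity|intros y; ring]].
    apply (continuous_slice (S := CU) (T := CU) (U := CU) (F := cauchy_slope f p (R1 / 2))).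
    apply (cauchy_slope_continuous hR fd hw hw).
Qed.

Lemma cdiff_continuous_on z : U z -> continuous (T := CU) (U := CU) f z.
Proof. intros hz; exact (cdiff_continuous (f_diff hz)). Qed.

Lemma slope_continuous z w : U z -> U w ->
  continuous (T := CU2) (U := CU) (fun q => slope (fst q) (snd q)) (z, w).
Proof.
  intros hz hw; destruct (classic (z = w)) as [->|h].
  - destruct (slope_cauchy hw) as [R0 [h0 [R1 [h1 [hU hs]]]]].
    assert (hww : Cmod (Cminus w w) < R0) by (replace (Cminus w w) with (RtoC 0) by ring; rewrite Cmod_0; exact h0).
    apply (@continuous_ext_loc (CU2) CU _ (fun q => cauchy_slope f w R0 (fst q) (snd q))).
    + destruct (disc_open hww) as [d hd].
      exists d; intros [z' w'] [k1 k2]; symmetry; apply hs; [apply hd, k1|apply hd, k2].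
    + apply (cauchy_slope_continuous (R1 := R1)); [lra| |exact hww|exact hww].
      intros z hz'; exists (f' z); apply f_diff, hU, hz'.
  - apply (@continuous_ext_loc (CU2) CU _
      (fun q => Cdiv (Cminus (f (fst q)) (f (snd q))) (Cminus (fst q) (snd q)))).
    + assert (hc : continuous (T := CU2) (U := CU) (fun q => Cminus (fst q) (snd q)) (z, w)).
      { apply continuous_Cminus; [apply continuous_fst|apply continuous_snd]. }
      pose proof (Cminus_neq_0 h) as hn; pose proof (proj1 (Cmod_gt_0 _) hn) as hn0.
      generalize (proj1 (continuous_norm_iff (V := C_NormedModule) _ _) hc _ hn0); apply filter_imp.
      intros [z' w'] hq; simpl in hq |- *; symmetry; apply slope_neq; intros ->.
      match type of hq with norm ?x < _ => change (Cmod (Cminus (Cminus w' w') (Cminus z w)) < Cmod (Cminus z w)) in hq end.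
      replace (Cminus (Cminus w' w') (Cminus z w)) with (Copp (Cminus z w)) in hq by ring; rewrite Cmod_opp in hq; lra.
    + apply continuous_Cdiv; [exact (Cminus_neq_0 h)| |].
      * apply continuous_Cminus.
        -- apply (continuous_comp fstC (f : CU -> CU)); [apply continuous_fst|apply cdiff_continuous_on, hz].
        -- apply (continuous_comp sndC (f : CU -> CU)); [apply continuous_snd|apply cdiff_continuous_on, hw].
      * apply continuous_Cminus; [apply continuous_fst|apply continuous_snd].
Qed.

Lemma slope_cdiff z w : U z -> U w -> exists d, cdiff (fun z => slope z w) z d.
Proof.
  intros hz hw; destruct (classic (z = w)) as [->|h].
  - destruct (slope_cauchy hw) as [R0 [h0 [R1 [h1 [hU hs]]]]].
    assert (hww : Cmod (Cminus w w) < R0) by (replace (Cminus w w) with (RtoC 0) by ring; rewrite Cmod_0; exact h0).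
    destruct (@cauchy_slope_cdiff f w R0 R1 (conj h0 h1) (fun z hz => ex_intro _ (f' z) (f_diff (hU z hz))) w hww) as [d hd].
    exists d; apply (cdiff_ext_loc (f := fun z => cauchy_slope f w R0 z w)); [|exact hd].
    exists R0; split; [exact h0|intros y hy; symmetry; apply hs; assumption].
  - pose proof (Cminus_neq_0 h) as hn.
    eexists; apply (cdiff_ext_loc (f := fun y => Cmult (Cminus (f y) (f w)) (Cinv (Cminus y w)))).
    + exists (Cmod (Cminus z w)); split; [exact (proj1 (Cmod_gt_0 _) hn)|intros y hy].
      symmetry; apply slope_neq; intros ->; rewrite Cmod_minus_sym in hy; lra.
    + apply cdiff_mult.
      * exact (cdiff_minus (f_diff hz) (cdiff_const (f w) z)).
      * exact (cdiff_inv (f := fun y => Cminus y w) hn (cdiff_minus (cdiff_id z) (cdiff_const w z))).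
Qed.

Lemma slope_cdiff2 z w : U z -> U w -> exists d, cdiff (fun w => slope z w) w d.
Proof.
  intros hz hw; destruct (slope_cdiff hw hz) as [d hd]; exists d.
  apply (cdiff_ext_loc (f := fun w => slope w z)); [|exact hd].
  exists 1; split; [lra|intros y _; apply slope_sym].
Qed.
End Slope.

Lemma mean_value_ext_loc (V : CompleteNormedModule C_AbsRing) (F F' : C -> V) p d : 0 < d ->
  (forall w, Cmod (Cminus w p) < d -> F w = F' w) -> mean_value F p -> mean_value F' p.
Proof.
  intros d0 h [rho [rho0 hrho]]; exists (Rmin rho d); split; [apply Rmin_pos; assumption|intros r hr].
  pose proof (Rmin_l rho d); pose proof (Rmin_r rho d).
  rewrite <- (h p) by (rewrite Cmod_minus_diag; exact d0).
  rewrite <- (hrho r) by lra; symmetry; apply cmean_ext; [lra|intros z hz; apply h; lra].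
Qed.

Lemma continuous_ext_disc (U : UniformSpace) (F F' : C -> U) p d : 0 < d ->
  (forall w, Cmod (Cminus w p) < d -> F w = F' w) ->
  continuous (T := CU) F p -> continuous (T := CU) F' p.
Proof.
  intros d0 h; apply continuous_ext_loc, locally_Cmod; exists d; split; [exact d0|exact h].
Qed.

(** * Cauchy transforms off the trace *)

Section CauchyTransform.
Variables (V : CompleteNormedModule C_AbsRing) (D : C -> Prop) (F : C -> V) (G : chain).
Hypothesis D_open : open (D : CU -> Prop).
Hypothesis F_cont : cont_on D F.
Hypothesis G_in_D : forall z, trace G z -> D z.

Definition cauchy_transform (w : C) : V := chain_int (fun z => scal (Cinv (Cminus z w) : C_AbsRing) (F z)) G.

(** The kernel is holomorphic in [w] off the trace, so its circle means are its central values, and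
    [cmean_chain_int] exchanges mean and chain integral. *)
Lemma cauchy_transform_regular p : ~ trace G p ->
  continuous (T := CU) cauchy_transform p /\ mean_value cauchy_transform p.
Proof.
  intros hp; destruct (trace_distance hp) as [d [d0 hd]].
  (* The distance [d] from [p] to the trace is halved, so that [z] and [w] cannot meet. *)
  set (D1 z := D z /\ d / 2 < Cmod (Cminus z p)); set (D2 w := Cmod (Cminus w p) < d / 2).
  assert (o2 : open (D2 : CU -> Prop)) by apply disc_open.
  assert (o1 : open (D1 : CU -> Prop)).
  { apply open_and; [exact D_open|]; apply open_Cmod; intros z hz.
    exists (Cmod (Cminus z p) - d / 2); split; [lra|intros y hy].
    replace (Cminus z p) with (Cminus (Cminus y p) (Cminus y z)) in hy by ring.
    pose proof (Cmod_triangle (Cminus y p) (Copp (Cminus y z))) as ht; rewrite Cmod_opp in ht.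
    unfold Cminus at 2 in hy; lra. }
  assert (hG : forall z, trace G z -> D1 z).
  { intros z hz; split; [apply G_in_D, hz|]; specialize (hd z hz); lra. }
  assert (hne : forall z w, D1 z -> D2 w -> z <> w) by (intros z w [_ h1] h2 ->; unfold D2 in h2; lra).
  assert (cF : forall z w, D1 z -> D2 w -> continuous (T := CU2)
    (fun q => scal (Cinv (Cminus (fst q) (snd q)) : C_AbsRing) (F (fst q))) (z, w)).
  { intros z w hz hw; apply continuous_scal_C; [apply cauchy_kernel_continuous, hne; assumption|].
    apply (continuous_comp fstC F); [apply continuous_fst|].
    apply F_cont, hz. }
  assert (hpp : D2 p) by (unfold D2; rewrite Cmod_minus_diag; lra).
  split; [exact (cont_on_chain_int o2 (F := fun z w => scal (Cinv (Cminus z w) : C_AbsRing) (F z)) cF hG hpp)|].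
  exists (d / 2); split; [lra|intros r hr].
  unfold cauchy_transform.
  rewrite (@cmean_chain_int V D1 D2 (fun z w => scal (Cinv (Cminus z w) : C_AbsRing) (F z)) G p r o1 o2 cF hG)
    by (lra || (intros z hz; unfold D2; lra)).
  assert (cd : forall z w, D1 z -> D2 w -> exists e, cdiff (fun w => Cinv (Cminus z w)) w e).
  { intros z w hz hw; eexists.
    apply (cdiff_inv (f := fun w => Cminus z w)); [apply Cminus_neq_0, hne; assumption|].
    exact (cdiff_minus (cdiff_const z w) (cdiff_id w)). }
  apply chain_int_ext; intros z hz.
  assert (hc : forall w, D2 w -> continuous (T := CU) (U := CU) (fun w => Cinv (Cminus z w)) w).
  { intros w hw; destruct (cd z w (hG z hz) hw) as [e he]; exact (cdiff_continuous he). }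
  rewrite <- (@cmean_center (fun w => Cinv (Cminus z w)) p p r (d / 2)); [|lra|rewrite Cmod_minus_diag; lra|exact hc|].
  - apply (@RInt_linear CV V _ (fun t => Cinv (Cminus z (circle_pt p r t))) (is_linear_scal_C_l (F z))).
    intros t _; apply (continuous_circle_comp (V := CV) (F := fun w => Cinv (Cminus z w))); [lra|].
    intros w hw; apply hc; unfold D2; lra.
  - intros w hw _; exact (cd z w (hG z hz) hw).
Qed.
End CauchyTransform.

Section Dixon.
Variables (U : C -> Prop) (f f' : C -> C) (G : chain).
Hypothesis U_open : open (U : CU -> Prop).
Hypothesis f_diff : forall z, U z -> cdiff f z (f' z).
Hypothesis G_cycle : is_cycle G.
Hypothesis G_in_U : forall z, trace G z -> U z.
Hypothesis G_winding : forall w, ~ U w -> winding G w = RtoC 0.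

Let K := cauchy_transform (V := CV) f G.
Let S (w : C) : C := chain_intC (fun z => slope f f' z w) G.
(** Dixon's function. At points of [U] off the trace, the two branches agree as soon as the winding
    number vanishes, by [slope_int_split]; so [H] coincides with [K] near every point outside [U]
    and near infinity. *)
Let H (w : C) : C := if excluded_middle_informative (U w) then S w else K w.

Lemma cauchy_integrand_cont_on w : ~ trace G w ->
  cont_on (V := CV) (trace G) (fun z => Cmult (Cinv (Cminus z w)) (f z)).
Proof.
  intros hw z hz; apply continuous_Cmult; [exact (cauchy_kernel_cont_on hw hz)|].
  apply cdiff_continuous with (f' z); apply f_diff, G_in_U, hz.
Qed.

Lemma slope_int_split w : U w -> ~ trace G w -> winding G w = RtoC 0 -> S w = K w.
Proof.
  intros hU hw h0.
  assert (e : K w = Cplus (S w) (Cmult (f w) (winding G w))).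
  { unfold K, cauchy_transform, S, winding.
    assert (cs : cont_on (V := CV) (trace G) (fun z => slope f f' z w)).
    { intros z hz; apply (continuous_slice (S := CU) (T := CU) (U := CU) (F := slope f f')).
      apply (slope_continuous U_open f_diff); [apply G_in_U, hz|exact hU]. }
    pose proof (cauchy_kernel_cont_on hw) as ck.
    rewrite <- (chain_int_linear (V := CV) (is_linear_Cmult (f w)) ck).
    etransitivity; [|apply (chain_int_plus (V := CV) cs)].
    - apply chain_int_ext; intros z hz.
      match goal with |- scal ?u ?v = plus ?x ?y => change (@eq C (Cmult u v) (Cplus x y)) end.
      assert (hn : z <> w) by (intros ->; contradiction).
      rewrite slope_neq by exact hn; field; apply Cminus_neq_0, hn.
    - intros z hz; apply continuous_Cmult; [apply continuous_const|apply ck, hz]. }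
  rewrite e, h0; cring.
Qed.

Lemma dixon_inside p : U p -> continuous (T := CU) (U := CU) H p /\ mean_value (V := CV) H p.
Proof.
  intros hp; destruct (proj1 (open_Cmod U) U_open p hp) as [d [d0 hd]].
  assert (eH : forall w, Cmod (Cminus w p) < d -> H w = S w).
  { intros w hw; unfold H; destruct excluded_middle_informative as [|n]; [reflexivity|elim n; apply hd, hw]. }
  assert (hpp : Cmod (Cminus p p) < d) by (replace (Cminus p p) with (RtoC 0) by ring; rewrite Cmod_0; exact d0).
  split.
  - apply (@continuous_ext_loc CU CU _ S).
    + generalize (disc_open hpp); apply filter_imp; intros w hw; symmetry; apply eH, hw.
    + apply (cont_on_chain_int (V := CV) (D1 := U) (D2 := U) U_open (F := slope f f') (slope_continuous U_open f_diff) G_in_U hp).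
  - exists d; split; [exact d0|intros r hr].
    rewrite (eH p hpp).
    rewrite (@cmean_ext CV H S) by (lra || (intros z hz; apply eH; lra)).
    unfold S; rewrite (@cmean_chain_int CV U U (slope f f') G p r U_open U_open (slope_continuous U_open f_diff) G_in_U)
      by (lra || (intros z hz; apply hd; lra)).
    apply chain_int_ext; intros z hz; apply (@cmean_center _ p p r d); [lra|rewrite Cmod_minus_diag; lra| |].
    + intros w hw; destruct (slope_cdiff2 U_open f_diff (G_in_U hz) (hd w hw)) as [e he]; exact (cdiff_continuous he).
    + intros w hw _; exact (slope_cdiff2 U_open f_diff (G_in_U hz) (hd w hw)).
Qed.

(** [p] may lie on the boundary of [U]. The winding number vanishes on a whole disc around it, so
    [H] is [K] there even at the points of [U]. *)
Lemma dixon_outside p : ~ U p -> continuous (T := CU) (U := CU) H p /\ mean_value (V := CV) H p.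
Proof.
  intros hp; assert (hpt : ~ trace G p) by (intros h; apply hp, G_in_U, h).
  destruct (winding_locally_constant G_cycle hpt) as [d [d0 hd]].
  assert (eH : forall w, Cmod (Cminus w p) < d -> H w = K w).
  { intros w hw; unfold H; destruct excluded_middle_informative as [hU|n]; [|reflexivity].
    destruct (hd w hw) as [h1 h2]; apply slope_int_split; [exact hU| |rewrite h1; apply G_winding, hp].
    intros ht; specialize (h2 w ht); replace (Cminus w w) with (RtoC 0) in h2 by ring; rewrite Cmod_0 in h2; lra. }
  destruct (@cauchy_transform_regular CV U f G U_open (fun z hz => cdiff_continuous (f_diff hz)) G_in_U p hpt) as [h1 h2].
  split.
  - exact (continuous_ext_disc (U := CU) d0 (fun w hw => eq_sym (eH w hw)) h1).
  - exact (mean_value_ext_loc d0 (fun w hw => eq_sym (eH w hw)) h2).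
Qed.

Lemma dixon_infinity e : 0 < e -> exists M, forall w, M < Cmod w -> Cmod (H w) <= e.
Proof.
  intros e0; destruct (winding_infinity G_cycle) as [M [M0 [HM HW]]].
  destruct (chain_int_bound G) as [L [L0 HL]].
  assert (cf : cont_on (V := CV) (trace G) f).
  { intros z hz; apply cdiff_continuous with (f' z), f_diff, G_in_U, hz. }
  destruct (cont_on_trace_bounded cf) as [B [B0 HB]].
  assert (hLB : 0 <= L * B / e) by (apply Rmult_le_pos; [apply Rmult_le_pos; assumption|apply Rlt_le, Rinv_0_lt_compat, e0]).
  exists (M + L * B / e); intros w hw.
  assert (ht : ~ trace G w) by (intros h; specialize (HM w h); lra).
  assert (eH : H w = K w).
  { unfold H; destruct excluded_middle_informative as [hU|n]; [|reflexivity].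
    apply slope_int_split; [exact hU|exact ht|apply HW; lra]. }
  rewrite eH; apply Rle_trans with (L * (/ (Cmod w - M) * B)).
  - apply (HL CV).
    + apply Rmult_le_pos; [apply Rlt_le, Rinv_0_lt_compat; lra|exact B0].
    + apply cauchy_integrand_cont_on, ht.
    + intros z hz; match goal with |- norm ?x <= ?y => change (Cmod (Cmult (Cinv (Cminus z w)) (f z)) <= y) end.
      pose proof (Cmod_le_minus w z) as h; specialize (HM z hz); rewrite Cmod_minus_sym in h.
      rewrite Cmod_mult, Cmod_inv by (apply Cmod_pos_neq; lra).
      apply Rmult_le_compat; [apply Rlt_le, Rinv_0_lt_compat; lra|apply Cmod_ge_0|apply Rinv_le_contravar; lra|apply (HB z hz)].
  - apply (Rmult_le_reg_r (Cmod w - M)); [lra|].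
    replace (L * (/ (Cmod w - M) * B) * (Cmod w - M)) with (L * B / e * e) by (field; lra).
    rewrite (Rmult_comm e); apply Rmult_le_compat_r; lra.
Qed.

Theorem dixon w : U w -> chain_intC (fun z => slope f f' z w) G = RtoC 0.
Proof.
  intros hw; change (S w = RtoC 0); transitivity (H w).
  - unfold H; destruct excluded_middle_informative as [|n]; [reflexivity|contradiction].
  - apply (@liouville CV H).
    + intros p; destruct (classic (U p)); [apply dixon_inside|apply dixon_outside]; assumption.
    + intros p; destruct (classic (U p)); [apply dixon_inside|apply dixon_outside]; assumption.
    + exact dixon_infinity.
Qed.
End Dixon.

(** The function [(z - w) * f z] vanishes at [w], and its slope there is [f] itself, diagonal value
    included; [dixon] applied to it gives the claim. A point of the trace serves as [w]. *)
Theorem cauchy_homology (U : C -> Prop) (f : C -> C) (G : chain) :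
  open (U : CU -> Prop) -> (forall z, U z -> exists d, cdiff f z d) ->
  is_cycle G -> (forall z, trace G z -> U z) -> (forall w, ~ U w -> winding G w = RtoC 0) ->
  chain_intC f G = RtoC 0.
Proof.
  intros hU hf hG hGU hW; destruct G as [|g0 G0]; [reflexivity|].
  set (G := g0 :: G0) in *; set (w := g0 0).
  assert (hw : U w) by (apply hGU, (trace_arc (G := G)); [apply in_eq|lra]).
  set (psi z := Cmult (Cminus z w) (f z)).
  assert (hpsi : forall z, exists d, U z -> cdiff psi z d).
  { intros z; destruct (classic (U z)) as [h|h]; [|exists (RtoC 0); intros; contradiction].
    destruct (hf z h) as [d hd]; eexists; intros _.
    exact (cdiff_mult (cdiff_minus (cdiff_id z) (cdiff_const w z)) hd). }
  set (psi' z := proj1_sig (constructive_indefinite_description _ (hpsi z))).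
  assert (hpsi' : forall z, U z -> cdiff psi z (psi' z)) by (intros z; exact (proj2_sig (constructive_indefinite_description _ (hpsi z)))).
  rewrite <- (dixon hU hpsi' hG hGU hW hw).
  apply chain_int_ext; intros z hz; destruct (classic (z = w)) as [->|n].
  - rewrite slope_diag; apply (@cdiff_unique psi w); [|apply hpsi', hw].
    destruct (hf w hw) as [d hd].
    exists f; split; [exact (cdiff_continuous hd)|split; [reflexivity|intros y; unfold psi; ring]].
  - rewrite slope_neq by exact n; unfold psi; match goal with |- ?a = ?b => change (@eq C a b) end; field; apply Cminus_neq_0, n.
Qed.

(** * The Banach algebra of bounded operators *)

Section Complete.
Variable X : NormedModule C_AbsRing.
Hypothesis X_complete : forall F : (X -> Prop) -> Prop, ProperFilter F -> cauchy F ->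
  exists l : X, forall e : posreal, F (ball l e).
Notation B := (bounded_op X).

Lemma minus_bop (P Q : B) (x : X) : (minus P Q : B) x = minus (P x) (Q x).
Proof. reflexivity. Qed.

Lemma ball_bop (P Q : B) (e : R) : ball P e Q -> forall x, norm (minus (Q x) (P x)) <= e * norm x.
Proof.
  intros h x; rewrite <- minus_bop; apply Rle_trans with (1 := op_norm_bound _ _).
  apply Rmult_le_compat_r; [apply norm_ge_0|apply Rlt_le, h].
Qed.

Lemma norm_minus_sym (V : NormedModule C_AbsRing) (x y : V) : norm (minus x y) = norm (minus y x).
Proof. rewrite <- norm_opp, opp_minus; reflexivity. Qed.

(** The limit [L] is chosen pointwise by completeness of [X]. Each of its properties is checked on
    an operator of the filter that is close to [L] at the few vectors concerned. *)
Lemma bop_complete (F : (B -> Prop) -> Prop) : ProperFilter F -> cauchy F ->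
  exists L : B, forall e : posreal, F (ball L e).
Proof.
  intros hF hc.
  set (Fx (x : X) := filtermap (fun A : B => A x) F).
  assert (pF : forall x, ProperFilter (Fx x)) by (intros x; apply filtermap_proper_filter, hF).
  assert (cF : forall x, cauchy (Fx x)).
  { intros x e; assert (h0 : 0 < e / (1 + norm x)).
    { apply Rdiv_lt_0_compat; [apply cond_pos|pose proof (@norm_ge_0 _ X x); lra]. }
    destruct (hc (mkposreal _ h0)) as [A0 hA0]; exists (A0 x); unfold Fx, filtermap.
    revert hA0; apply filter_imp; intros A hA; apply norm_compat1.
    apply Rle_lt_trans with (1 := ball_bop hA x); simpl.
    pose proof (@norm_ge_0 _ X x); pose proof (cond_pos e).
    apply (Rmult_lt_reg_r (1 + norm x)); [lra|].
    replace (e / (1 + norm x) * norm x * (1 + norm x)) with (e * norm x) by (field; lra); nra. }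
  set (L := fun x => proj1_sig (constructive_indefinite_description _ (X_complete (pF x) (cF x)))).
  assert (hL0 : forall x (e : posreal), Fx x (ball (L x) e)).
  { intros x; exact (proj2_sig (constructive_indefinite_description _ (X_complete (pF x) (cF x)))). }
  assert (hL : forall x (e : R), 0 < e -> F (fun A : B => norm (minus (A x) (L x)) < e)).
  { intros x e e0; assert (h0 : 0 < e / @norm_factor _ X) by (apply Rdiv_lt_0_compat; [exact e0|apply norm_factor_gt_0]).
    generalize (hL0 x (mkposreal _ h0)); unfold Fx, filtermap; apply filter_imp.
    intros A hA0; pose proof (@norm_compat2 _ X (L x) (A x) _ hA0) as hA; simpl in hA.
    replace (@norm_factor _ X * (e / @norm_factor _ X)) with e in hA; [exact hA|].
    field; pose proof (@norm_factor_gt_0 _ X); lra. }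
  assert (eq0 : forall v : X, (forall e, 0 < e -> norm v <= e) -> v = zero).
  { intros v h; apply (@norm_eq_zero _ X), Rle_antisym; [|apply (@norm_ge_0 _ X)].
    apply le_epsilon; intros e e0; rewrite Rplus_0_l; apply h, e0. }
  assert (eqm : forall u v : X, minus u v = zero -> u = v).
  { intros u v h; replace u with (plus (minus u v) v) by mod_eq X; rewrite h; apply plus_zero_l. }
  assert (Llin : is_linear L).
  { split.
    - intros x y; apply eqm, eq0; intros e e0; assert (e3 : 0 < e / 3) by lra.
      destruct (filter_ex _ (filter_and _ _ (hL (plus x y) _ e3) (filter_and _ _ (hL x _ e3) (hL y _ e3)))) as [A [h1 [h2 h3]]].
      replace (minus (L (plus x y)) (plus (L x) (L y))) with
        (plus (minus (L (plus x y)) (A (plus x y))) (plus (minus (A x) (L x)) (minus (A y) (L y))))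
        by (rewrite (linear_plus _ (bop_lin A)); mod_eq X).
      apply Rle_trans with (1 := norm_triangle _ _).
      apply Rle_trans with (1 := Rplus_le_compat_l _ _ _ (norm_triangle _ _)).
      rewrite norm_minus_sym; lra.
    - intros k x; apply eqm, eq0; intros e e0.
      pose proof (abs_ge_0 k) as k0.
      assert (e3 : 0 < e / (2 * (1 + abs k))) by (apply Rdiv_lt_0_compat; lra).
      assert (e2 : 0 < e / 2) by lra.
      destruct (filter_ex _ (filter_and _ _ (hL (scal k x) _ e2) (hL x _ e3))) as [A [h1 h2]].
      replace (minus (L (scal k x)) (scal k (L x))) with
        (plus (minus (L (scal k x)) (A (scal k x))) (scal k (minus (A x) (L x))))
        by (rewrite (linear_scal _ (bop_lin A)); mod_eq X).
      apply Rle_trans with (1 := norm_triangle _ _).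
      pose proof (norm_scal k (minus (A x) (L x))) as h3.
      assert (h4 : abs k * norm (minus (A x) (L x)) <= e / 2).
      { apply Rle_trans with ((1 + abs k) * (e / (2 * (1 + abs k)))); [|right; field; lra].
        apply Rmult_le_compat; [exact k0|apply norm_ge_0|lra|lra]. }
      rewrite norm_minus_sym; lra.
    - destruct (hc (mkposreal _ Rlt_0_1)) as [A0 hA0].
      exists (op_norm A0 + 1); split; [pose proof (op_norm_ge_0 A0); lra|intros x].
      apply le_epsilon; intros e e0.
      destruct (filter_ex _ (filter_and _ _ hA0 (hL x e e0))) as [A [h1 h2]].
      pose proof (ball_bop h1 x) as h3; simpl in h3.
      replace (L x) with (plus (A0 x) (plus (minus (A x) (A0 x)) (minus (L x) (A x)))) by mod_eq X.
      apply Rle_trans with (1 := norm_triangle _ _).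
      apply Rle_trans with (1 := Rplus_le_compat_l _ _ _ (norm_triangle _ _)).
      rewrite (norm_minus_sym (L x)); pose proof (op_norm_bound A0 x); lra. }
  exists (BoundedOp Llin); intros e.
  (* [A] and [A'] are both within [e / 4] of [A0], and [A'] is chosen with [A' x] within [d] of
     [L x]; this gives [e / 2 * norm x + d] for arbitrary [d]. *)
  assert (e4 : 0 < e / 4) by (pose proof (cond_pos e); lra).
  destruct (hc (mkposreal _ e4)) as [A0 hA0].
  generalize hA0; apply filter_imp; intros A hA.
  change (op_norm (minus A (BoundedOp Llin)) < e).
  apply Rle_lt_trans with (e / 2); [|pose proof (cond_pos e); lra].
  apply op_norm_least; [lra|intros x].
  change (norm (minus (A x) (L x)) <= e / 2 * norm x).
  apply le_epsilon; intros d d0.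
  destruct (filter_ex _ (filter_and _ _ hA0 (hL x d d0))) as [A' [h1 h2]].
  pose proof (ball_bop h1 x) as h3; pose proof (ball_bop hA x) as h4; simpl in h3, h4.
  replace (minus (A x) (L x)) with (plus (minus (A x) (A0 x)) (plus (minus (A0 x) (A' x)) (minus (A' x) (L x)))) by mod_eq X.
  apply Rle_trans with (1 := norm_triangle _ _).
  apply Rle_trans with (1 := Rplus_le_compat_l _ _ _ (norm_triangle _ _)).
  rewrite (norm_minus_sym (A0 x)); lra.
Qed.

End Complete.

Section CompleteOperators.
Variable X : CompleteNormedModule C_AbsRing.
Notation B := (bounded_op X).

Definition bop_lim (F : (B -> Prop) -> Prop) : B :=
  epsilon (inhabits (bop_zero X)) (fun L => forall e : posreal, F (ball L e)).

(** [epsilon] answers alike on equal filters, and two filters each finer than the other are equal by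
    extensionality. *)
Lemma bop_lim_ext (F1 F2 : (B -> Prop) -> Prop) : filter_le F1 F2 -> filter_le F2 F1 -> close (bop_lim F1) (bop_lim F2).
Proof.
  intros h1 h2; replace F2 with F1; [intros e; apply ball_center|].
  apply functional_extensionality; intros P; apply propositional_extensionality; split; [apply h2|apply h1].
Qed.

Lemma cauchy_converges (F : (X -> Prop) -> Prop) : ProperFilter F -> cauchy F ->
  exists l : X, forall e : posreal, F (ball l e).
Proof. intros hF hc; exists (lim F); exact (complete_cauchy F hF hc). Qed.

Definition bop_complete_mixin : CompleteSpace.mixin_of (bop_UniformSpace X) :=
  CompleteSpace.Mixin (bop_UniformSpace X) bop_lim
    (fun F hF hc => epsilon_spec (inhabits (bop_zero X)) _ (bop_complete cauchy_converges hF hc)) bop_lim_ext.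

Canonical bop_Banach : CompleteNormedModule C_AbsRing :=
  CompleteNormedModule.Pack C_AbsRing B
    (CompleteNormedModule.Class C_AbsRing B (NormedModule.class C_AbsRing (bop_NormedModule X)) bop_complete_mixin) B.
End CompleteOperators.

Ltac bop_eq :=
  match goal with X : CompleteNormedModule C_AbsRing |- _ => mod_eq (bop_Banach X) end.

(** * Composition of operators and the Neumann series *)

Section OperatorAlgebra.
Variable X : CompleteNormedModule C_AbsRing.
Notation B := (bounded_op X).
Notation E := (bop_Banach X).
Implicit Types P Q S : B.

Lemma comp_assoc P Q S : bop_comp P (bop_comp Q S) = bop_comp (bop_comp P Q) S.
Proof. apply bop_ext; reflexivity. Qed.

Lemma comp_id_l P : bop_comp (bop_id X) P = P.
Proof. apply bop_ext; reflexivity. Qed.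

Lemma comp_id_r P : bop_comp P (bop_id X) = P.
Proof. apply bop_ext; reflexivity. Qed.

Lemma comp_plus_l P Q S : bop_comp (plus P Q) S = plus (bop_comp P S) (bop_comp Q S).
Proof. apply bop_ext; reflexivity. Qed.

Lemma comp_plus_r P Q S : bop_comp P (plus Q S) = plus (bop_comp P Q) (bop_comp P S).
Proof. apply bop_ext; intros x; apply (linear_plus _ (bop_lin P)). Qed.

Lemma comp_minus_l P Q S : bop_comp (minus P Q) S = minus (bop_comp P S) (bop_comp Q S).
Proof. apply bop_ext; reflexivity. Qed.

Lemma comp_minus_r P Q S : bop_comp P (minus Q S) = minus (bop_comp P Q) (bop_comp P S).
Proof. apply bop_ext; intros x; exact (linear_minus (K := C_AbsRing) P (Q x) (S x) (bop_lin P)). Qed.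

Lemma comp_scal_l (k : C) P Q : bop_comp (scal (k : C_AbsRing) P) Q = scal (k : C_AbsRing) (bop_comp P Q).
Proof. apply bop_ext; reflexivity. Qed.

Lemma comp_scal_r (k : C) P Q : bop_comp P (scal (k : C_AbsRing) Q) = scal (k : C_AbsRing) (bop_comp P Q).
Proof. apply bop_ext; intros x; apply (linear_scal _ (bop_lin P)). Qed.

Lemma comp_zero_l P : bop_comp zero P = zero.
Proof. apply bop_ext; reflexivity. Qed.

Lemma comp_zero_r P : bop_comp P zero = zero.
Proof. apply bop_ext; intros x; exact (linear_zero P (bop_lin P)). Qed.

Lemma op_norm_comp P Q : op_norm (bop_comp P Q) <= op_norm P * op_norm Q.
Proof.
  apply op_norm_least; [apply Rmult_le_pos; apply op_norm_ge_0|intros x].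
  apply Rle_trans with (1 := op_norm_bound P (Q x)); rewrite Rmult_assoc.
  apply Rmult_le_compat_l; [apply op_norm_ge_0|apply op_norm_bound].
Qed.

Lemma op_norm_id : op_norm (bop_id X) <= 1.
Proof. apply op_norm_least; [lra|intros x; rewrite Rmult_1_l; apply Rle_refl]. Qed.

Lemma is_linear_comp_l P : is_linear (U := E) (V := E) (fun Q => bop_comp P Q).
Proof.
  split; [intros; apply comp_plus_r|intros; apply comp_scal_r|].
  exists (op_norm P + 1); split; [pose proof (op_norm_ge_0 P); lra|intros Q].
  change (op_norm (bop_comp P Q) <= (op_norm P + 1) * op_norm Q).
  apply Rle_trans with (1 := op_norm_comp P Q); apply Rmult_le_compat_r; [apply op_norm_ge_0|lra].
Qed.

Lemma is_linear_comp_r P : is_linear (U := E) (V := E) (fun Q => bop_comp Q P).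
Proof.
  split; [intros; apply comp_plus_l|intros; apply comp_scal_l|].
  exists (op_norm P + 1); split; [pose proof (op_norm_ge_0 P); lra|intros Q].
  change (op_norm (bop_comp Q P) <= (op_norm P + 1) * op_norm Q).
  apply Rle_trans with (1 := op_norm_comp Q P); rewrite Rmult_comm; apply Rmult_le_compat_r; [apply op_norm_ge_0|lra].
Qed.

Fixpoint bop_pow Q (n : nat) : B := match n with O => bop_id X | S n => bop_comp Q (bop_pow Q n) end.

Lemma op_norm_pow Q n : op_norm (bop_pow Q n) <= op_norm Q ^ n.
Proof.
  induction n as [|n IH]; simpl; [apply op_norm_id|].
  apply Rle_trans with (1 := op_norm_comp _ _), Rmult_le_compat_l; [apply op_norm_ge_0|exact IH].
Qed.

Lemma bop_pow_comm Q n : bop_comp Q (bop_pow Q n) = bop_comp (bop_pow Q n) Q.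
Proof. induction n as [|n IH]; simpl; [apply bop_ext; reflexivity|rewrite IH at 1; apply comp_assoc]. Qed.

Lemma neumann Q : op_norm Q < 1 -> exists P, is_inverse (minus (bop_id X) Q) P.
Proof.
  intros hQ; pose proof (op_norm_ge_0 Q) as hQ0.
  assert (hs : ex_series (V := E) (bop_pow Q)).
  { apply (ex_series_le (V := E)) with (fun n => op_norm Q ^ n); [exact (op_norm_pow Q)|].
    apply ex_series_geom; rewrite Rabs_pos_eq; assumption. }
  destruct hs as [P hP]; exists P.
  (* Stated for a linear map [l], so that left and right multiplication by [Id - Q] are treated
     together; the partial sums telescope. *)
  assert (key : forall l : B -> B, is_linear (U := E) (V := E) l ->
    (forall n, l (sum_n (G := E) (bop_pow Q) n) = minus (bop_id X) (bop_pow Q (S n))) -> l P = bop_id X).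
  { intros l hl hsum.
    apply (filterlim_locally_unique (K := C_AbsRing) (V := E) (F := eventually) (fun n => l (sum_n (G := E) (bop_pow Q) n))).
    - exact (filterlim_comp _ _ _ _ _ _ _ _ hP (linear_cont (U := E) (V := E) l P hl)).
    - apply (filterlim_ext (fun n => minus (bop_id X) (bop_pow Q (S n)))); [intros n; symmetry; apply hsum|].
      apply (filterlim_locally (U := E)); intros e.
      assert (hl0 : is_lim_seq (fun n => op_norm Q ^ n) 0) by (apply is_lim_seq_geom; rewrite Rabs_pos_eq; assumption).
      apply is_lim_seq_spec in hl0; destruct (hl0 e) as [N HN]; exists N; intros n hn.
      specialize (HN (S n) ltac:(lia)); rewrite Rminus_0_r in HN.
      change (op_norm (minus (minus (bop_id X) (bop_pow Q (S n))) (bop_id X)) < e).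
      replace (minus (minus (bop_id X) (bop_pow Q (S n))) (bop_id X)) with (opp (bop_pow Q (S n))) by bop_eq.
      apply Rle_lt_trans with (1 := op_norm_opp _).
      apply Rle_lt_trans with (1 := op_norm_pow Q (S n)).
      apply Rle_lt_trans with (2 := HN), Rle_abs. }
  split.
  - apply (key (fun P => bop_comp (minus (bop_id X) Q) P)); [apply is_linear_comp_l|].
    induction n as [|n IH]; [rewrite sum_O; simpl; rewrite !comp_id_r; reflexivity|].
    rewrite sum_Sn.
    change (bop_comp (minus (bop_id X) Q) (plus (sum_n (G := E) (bop_pow Q) n : B) (bop_pow Q (S n))) = minus (bop_id X) (bop_pow Q (S (S n)))).
    rewrite comp_plus_r, IH, comp_minus_l, comp_id_l; change (bop_comp Q (bop_pow Q (S n))) with (bop_pow Q (S (S n))).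
    bop_eq.
  - apply (key (fun P => bop_comp P (minus (bop_id X) Q))); [apply is_linear_comp_r|].
    induction n as [|n IH]; [rewrite sum_O; simpl; rewrite !comp_id_l, comp_id_r; reflexivity|].
    rewrite sum_Sn.
    change (bop_comp (plus (sum_n (G := E) (bop_pow Q) n : B) (bop_pow Q (S n))) (minus (bop_id X) Q) = minus (bop_id X) (bop_pow Q (S (S n)))).
    rewrite comp_plus_l, IH, comp_minus_r, comp_id_r, <- bop_pow_comm; change (bop_comp Q (bop_pow Q (S n))) with (bop_pow Q (S (S n))).
    bop_eq.
Qed.

Lemma inverse_unique P Q S : is_inverse P Q -> is_inverse P S -> Q = S.
Proof.
  intros [h1 h2] [h3 h4]; rewrite <- (comp_id_r Q), <- h3, comp_assoc, h2; apply comp_id_l.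
Qed.

Lemma inverse_comp P P' Q Q' : is_inverse P P' -> is_inverse Q Q' -> is_inverse (bop_comp P Q) (bop_comp Q' P').
Proof.
  intros [h1 h2] [h3 h4]; split.
  - rewrite comp_assoc, <- (comp_assoc P), h3, comp_id_r; exact h1.
  - rewrite comp_assoc, <- (comp_assoc Q'), h2, comp_id_r; exact h4.
Qed.
End OperatorAlgebra.

(** * Resolvents *)

Section Resolvent.
Variable X : CompleteNormedModule C_AbsRing.
Variable A : bounded_op X.
Notation B := (bounded_op X).
Notation R_ := (resolvent A).
Notation Id := (bop_id X).
Notation shift z := (minus (bop_scal z Id) A).

Definition resolvent_set (z : C) : Prop := ~ spectrum A z.

Lemma resolvent_spec z : resolvent_set z -> is_inverse (shift z) (R_ z).
Proof.
  intros hz; apply NNPP in hz; exact (epsilon_spec (inhabits (bop_zero X)) (is_inverse (shift z)) hz).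
Qed.

Lemma resolvent_set_inverse z P : is_inverse (shift z) P -> resolvent_set z /\ R_ z = P.
Proof.
  intros hP; assert (h : resolvent_set z) by (intros n; apply n; exists P; exact hP).
  split; [exact h|exact (inverse_unique (resolvent_spec h) hP)].
Qed.

Lemma comp_shift_l z P : bop_comp (shift z) P = minus (scal (z : C_AbsRing) P) (bop_comp A P).
Proof.
  rewrite comp_minus_l; f_equal; etransitivity; [exact (comp_scal_l z Id P)|rewrite comp_id_l; reflexivity].
Qed.

Lemma comp_shift_r z P : bop_comp P (shift z) = minus (scal (z : C_AbsRing) P) (bop_comp P A).
Proof.
  rewrite comp_minus_r; f_equal; etransitivity; [exact (comp_scal_r z P Id)|rewrite comp_id_r; reflexivity].
Qed.

Lemma resolvent_shift_l z : resolvent_set z -> minus (scal (z : C_AbsRing) (R_ z)) (bop_comp A (R_ z)) = Id.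
Proof. intros hz; rewrite <- comp_shift_l; apply (resolvent_spec hz). Qed.

Lemma resolvent_shift_r z : resolvent_set z -> minus (scal (z : C_AbsRing) (R_ z)) (bop_comp (R_ z) A) = Id.
Proof. intros hz; rewrite <- comp_shift_r; apply (resolvent_spec hz). Qed.

Lemma resolvent_comm z : resolvent_set z -> bop_comp A (R_ z) = bop_comp (R_ z) A.
Proof.
  intros hz; pose proof (resolvent_shift_l hz) as h1; rewrite <- (resolvent_shift_r hz) in h1.
  assert (e : forall P Q S : B, minus P Q = minus P S -> Q = S).
  { intros P Q S h; replace Q with (minus P (minus P Q)) by bop_eq.
    rewrite h; bop_eq. }
  exact (e _ _ _ h1).
Qed.

Lemma resolvent_identity z w : resolvent_set z -> resolvent_set w ->
  minus (R_ z) (R_ w) = scal (Cminus w z : C_AbsRing) (bop_comp (R_ z) (R_ w)).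
Proof.
  intros hz hw.
  transitivity (minus (bop_comp (R_ z) (minus (scal (w : C_AbsRing) (R_ w)) (bop_comp A (R_ w))))
    (bop_comp (minus (scal (z : C_AbsRing) (R_ z)) (bop_comp (R_ z) A)) (R_ w))).
  - rewrite (resolvent_shift_l hw), (resolvent_shift_r hz), comp_id_r, comp_id_l; reflexivity.
  - rewrite comp_minus_r, comp_minus_l, comp_scal_l, comp_scal_r, comp_assoc; bop_eq.
Qed.

(** [w - A] factors as [(z - A) (Id - Q)] with [Q = (z - w) R(z)] of norm at most [1 / 2]. The
    resolvent identity then bounds the norm of [R(w)] by that of [R(z)] plus half of itself. *)
Lemma resolvent_perturbation z w : resolvent_set z -> Cmod (Cminus w z) * op_norm (R_ z) <= 1 / 2 ->
  resolvent_set w /\ op_norm (R_ w) <= 2 * op_norm (R_ z).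
Proof.
  intros hz hw.
  set (Q := scal (Cminus z w : C_AbsRing) (R_ z) : B).
  assert (hQ : op_norm Q <= 1 / 2).
  { apply Rle_trans with (1 := op_norm_scal _ _).
    change (Cmod (Cminus z w) * op_norm (R_ z) <= 1 / 2); rewrite Cmod_minus_sym; exact hw. }
  destruct (@neumann X Q ltac:(lra)) as [P hP].
  assert (e : bop_comp (shift z) (minus Id Q) = shift w).
  { rewrite comp_minus_r, comp_id_r; unfold Q; rewrite comp_scal_r.
    rewrite (proj1 (resolvent_spec hz)).
    change (bop_scal z Id) with (scal (z : C_AbsRing) Id); change (bop_scal w Id) with (scal (w : C_AbsRing) Id).
    bop_eq. }
  pose proof (inverse_comp (resolvent_spec hz) hP) as hi; rewrite e in hi.
  destruct (resolvent_set_inverse hi) as [h1 h2]; split; [exact h1|].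
  assert (hw' : R_ w = plus (R_ z) (scal (Cminus z w : C_AbsRing) (bop_comp (R_ w) (R_ z)))).
  { rewrite <- (resolvent_identity h1 hz); bop_eq. }
  assert (hn : op_norm (R_ w) <= op_norm (R_ z) + 1 / 2 * op_norm (R_ w)).
  { rewrite hw' at 1; apply Rle_trans with (1 := op_norm_triangle _ _), Rplus_le_compat_l.
    apply Rle_trans with (1 := op_norm_scal _ _).
    change (Cmod (Cminus z w) * op_norm (bop_comp (R_ w) (R_ z)) <= 1 / 2 * op_norm (R_ w)).
    rewrite Cmod_minus_sym.
    apply Rle_trans with (Cmod (Cminus w z) * (op_norm (R_ w) * op_norm (R_ z))).
    - apply Rmult_le_compat_l; [apply Cmod_ge_0|apply op_norm_comp].
    - pose proof (op_norm_ge_0 (R_ w)); nra. }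
  lra.
Qed.

(** Invertibility comes from the Neumann series of [A / z], and the norm bound from
    [z R(z) = Id + A R(z)]. *)
Lemma resolvent_set_large z : op_norm A < Cmod z -> resolvent_set z /\ op_norm (R_ z) <= / (Cmod z - op_norm A).
Proof.
  intros hz; pose proof (op_norm_ge_0 A) as hA.
  assert (z0 : z <> RtoC 0) by (apply Cmod_pos_neq; lra).
  set (Q := scal (Cinv z : C_AbsRing) A : B).
  assert (hQ : op_norm Q < 1).
  { apply Rle_lt_trans with (1 := op_norm_scal _ _).
    change (Cmod (Cinv z) * op_norm A < 1); rewrite Cmod_inv by exact z0.
    apply (Rmult_lt_reg_l (Cmod z)); [lra|]; rewrite <- Rmult_assoc, Rinv_r; lra. }
  destruct (@neumann X Q hQ) as [P [hP1 hP2]].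
  assert (e : shift z = scal (z : C_AbsRing) (minus Id Q)).
  { unfold Q; change (bop_scal z Id) with (scal (z : C_AbsRing) Id); bop_eq; field; exact z0. }
  assert (hi : is_inverse (shift z) (scal (Cinv z : C_AbsRing) P)).
  { assert (s1 : scal (z : C_AbsRing) (scal (Cinv z : C_AbsRing) Id) = Id).
    { transitivity (scal (RtoC 1 : C_AbsRing) Id); [bop_eq; field; exact z0|exact (scal_one Id)]. }
    rewrite e; split.
    - rewrite comp_scal_l, comp_scal_r, hP1; exact s1.
    - rewrite comp_scal_r, comp_scal_l, hP2; exact s1. }
  destruct (resolvent_set_inverse hi) as [h1 _]; split; [exact h1|].
  assert (hn : Cmod z * op_norm (R_ z) <= 1 + op_norm A * op_norm (R_ z)).
  { assert (e2 : R_ z = scal (Cinv z : C_AbsRing) (plus Id (bop_comp A (R_ z)))).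
    { rewrite <- (resolvent_shift_l h1); bop_eq; field; exact z0. }
    rewrite e2 at 1.
    apply Rle_trans with (Cmod z * (Cmod (Cinv z) * op_norm (plus Id (bop_comp A (R_ z))))).
    - apply Rmult_le_compat_l; [lra|apply op_norm_scal].
    - rewrite Cmod_inv by exact z0; rewrite <- Rmult_assoc, Rinv_r, Rmult_1_l by lra.
      apply Rle_trans with (1 := op_norm_triangle _ _), Rplus_le_compat; [apply op_norm_id|apply op_norm_comp]. }
  apply (Rmult_le_reg_l (Cmod z - op_norm A)); [lra|rewrite Rinv_r by lra; lra].
Qed.

Lemma resolvent_set_open : open (resolvent_set : CU -> Prop).
Proof.
  apply open_Cmod; intros z hz; pose proof (op_norm_ge_0 (R_ z)) as h0.
  exists (/ (2 * (op_norm (R_ z) + 1))); split; [apply Rinv_0_lt_compat; lra|intros y hy].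
  apply (resolvent_perturbation hz).
  apply Rle_trans with (/ (2 * (op_norm (R_ z) + 1)) * (op_norm (R_ z) + 1)).
  - apply Rmult_le_compat; [apply Cmod_ge_0|exact h0|lra|lra].
  - right; field; lra.
Qed.

Lemma resolvent_continuous : cont_on (V := bop_Banach X) resolvent_set R_.
Proof.
  intros z hz; apply (proj2 (continuous_C_iff (V := bop_NormedModule X) R_ z)); intros e e0.
  pose proof (op_norm_ge_0 (R_ z)) as h0; set (M := op_norm (R_ z) + 1).
  assert (M0 : 0 < M) by (unfold M; lra).
  exists (Rmin (/ (2 * M)) (e / (4 * M * M))); split.
  - apply Rmin_pos; [apply Rinv_0_lt_compat; lra|apply Rdiv_lt_0_compat; [exact e0|repeat apply Rmult_lt_0_compat; lra]].
  - intros y hy; pose proof (Rmin_l (/ (2 * M)) (e / (4 * M * M))); pose proof (Rmin_r (/ (2 * M)) (e / (4 * M * M))).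
    destruct (@resolvent_perturbation z y hz) as [h1 h2].
    + apply Rle_trans with (/ (2 * M) * M); [|right; field; lra].
      apply Rmult_le_compat; [apply Cmod_ge_0|exact h0|lra|unfold M; lra].
    + change (op_norm (minus (R_ y) (R_ z)) < e); rewrite (resolvent_identity h1 hz).
      apply Rle_lt_trans with (1 := op_norm_scal _ _).
      change (Cmod (Cminus z y) * op_norm (bop_comp (R_ y) (R_ z)) < e); rewrite Cmod_minus_sym.
      apply Rle_lt_trans with (e / (4 * M * M) * (2 * M * M)).
      * apply Rmult_le_compat; [apply Cmod_ge_0|apply op_norm_ge_0|lra|].
        apply Rle_trans with (1 := op_norm_comp _ _).
        apply Rmult_le_compat; [apply op_norm_ge_0|exact h0|unfold M; lra|unfold M; lra].
      * replace (e / (4 * M * M) * (2 * M * M)) with (e / 2) by (field; lra); lra.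
Qed.

(** On the circle [z - p = r * cis (2 * PI * t)], and the resolvent identity reads
    [R(z) = R(p) - (z - p) R(p) R(z)]: the recursion of [geometric_mean] with exponent [1],
    contracting for small [r]. *)
Lemma resolvent_mean_value p : resolvent_set p -> mean_value (V := bop_Banach X) R_ p.
Proof.
  intros hp; destruct (proj1 (open_Cmod _) resolvent_set_open p hp) as [d [d0 hd]].
  pose proof (op_norm_ge_0 (R_ p)) as h0; set (M := op_norm (R_ p) + 1).
  assert (hM : 0 < / M) by (apply Rinv_0_lt_compat; unfold M; lra).
  exists (Rmin d (/ M)); split; [apply Rmin_pos; assumption|intros r hr].
  pose proof (Rmin_l d (/ M)); pose proof (Rmin_r d (/ M)).
  assert (hin : forall z, Cmod (Cminus z p) = r -> resolvent_set z) by (intros z hz; apply hd; lra).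
  apply (@geometric_mean (bop_Banach X) (fun t => R_ (circle_pt p r t))
    (fun Q : B => scal (RtoC (- r) : C_AbsRing) (bop_comp (R_ p) Q)) (R_ p) (r * op_norm (R_ p)) 1%Z).
  - left; reflexivity.
  - intros t _; apply (continuous_circle_comp (V := bop_Banach X)); [lra|].
    intros z hz; apply resolvent_continuous, hin, hz.
  - exact (is_linear_comp _ _ (is_linear_comp_l (R_ p)) (@is_linear_scal_C (bop_NormedModule X) (RtoC (- r)))).
  - split; [apply Rmult_le_pos; lra|].
    apply Rlt_le_trans with (/ M * M); [|right; apply Rinv_l; unfold M; lra].
    apply Rle_lt_trans with (/ M * op_norm (R_ p)); [apply Rmult_le_compat_r; lra|].
    apply Rmult_lt_compat_l; [exact hM|unfold M; lra].
  - intros Q; change (op_norm (scal (RtoC (- r) : C_AbsRing) (bop_comp (R_ p) Q)) <= r * op_norm (R_ p) * op_norm Q).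
    apply Rle_trans with (1 := op_norm_scal _ _); rewrite Rmult_assoc.
    change (Cmod (RtoC (- r)) * op_norm (bop_comp (R_ p) Q) <= r * (op_norm (R_ p) * op_norm Q)).
    rewrite Cmod_R, Rabs_Ropp, Rabs_pos_eq by lra; apply Rmult_le_compat_l; [lra|apply op_norm_comp].
  - intros t _; set (z := circle_pt p r t).
    assert (hz : resolvent_set z) by (apply hin, Cmod_circle_pt; lra).
    replace (2 * PI * 1 * t) with (2 * PI * t) by ring.
    change (R_ z = plus (R_ p) (scal (cis (2 * PI * t) : C_AbsRing) (scal (RtoC (- r) : C_AbsRing) (bop_comp (R_ p) (R_ z)))) :> B).
    assert (e : scal (cis (2 * PI * t) : C_AbsRing) (scal (RtoC (- r) : C_AbsRing) (bop_comp (R_ p) (R_ z))) = opp (minus (R_ p) (R_ z))).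
    { rewrite (resolvent_identity hp hz); replace (Cminus z p) with (Cmult (RtoC r) (cis (2 * PI * t))) by (unfold z, circle_pt; ring).
      bop_eq; rewrite RtoC_opp; ring. }
    rewrite e; bop_eq.
Qed.

Notation intE := (chain_int (V := bop_Banach X)).

(** Integrating the resolvent identity turns the Cauchy transform of the resolvent into
    [(2 i pi - T) R(w)], where [T] is the integral to be computed; this function extends
    to an entire function vanishing at infinity. *)
Theorem int_resolvent G : is_cycle G -> (forall z, trace G z -> resolvent_set z) ->
  (forall w, spectrum A w -> winding G w = two_pi_i) -> intE R_ G = scal (two_pi_i : C_AbsRing) Id.
Proof.
  intros hG hGR hW.
  set (T := intE R_ G); set (K := cauchy_transform (V := bop_Banach X) R_ G).
  set (l := fun Q : B => minus (scal (two_pi_i : C_AbsRing) Q) (bop_comp T Q)).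
  assert (hl : is_linear (U := bop_Banach X) (V := bop_Banach X) l).
  { pose proof (@is_linear_scal_C (bop_NormedModule X) two_pi_i) as h1; pose proof (is_linear_comp_l T) as h2.
    split.
    - intros P Q; unfold l; change (bop_comp T (plus P Q)) with (bop_comp T (plus (P : B) Q)).
      rewrite comp_plus_r; bop_eq.
    - intros k Q; unfold l; change (bop_comp T (scal k Q)) with (bop_comp T (scal k (Q : B))).
      rewrite comp_scal_r; bop_eq.
    - destruct (linear_norm _ h1) as [M1 [m1 H1]]; destruct (linear_norm _ h2) as [M2 [m2 H2]].
      exists (M1 + M2); split; [lra|intros Q].
      change (op_norm (minus (scal (two_pi_i : C_AbsRing) (Q : B)) (bop_comp T Q)) <= (M1 + M2) * op_norm Q).
      apply Rle_trans with (1 := op_norm_triangle _ _).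
      pose proof (op_norm_opp (bop_comp T Q)); specialize (H1 Q); specialize (H2 Q).
      change (op_norm (scal (two_pi_i : C_AbsRing) (Q : B)) <= M1 * op_norm Q) in H1.
      change (op_norm (bop_comp T Q) <= M2 * op_norm Q) in H2.
      rewrite Rmult_plus_distr_r; apply Rplus_le_compat; [exact H1|exact (Rle_trans _ _ _ H H2)]. }
  (* Off the spectrum [F] is regular because the resolvent is, even on the trace. Near a point of
     the spectrum the winding number is [2 i pi], so by [hK] both branches are the Cauchy transform
     [K]. *)
  set (F := fun w => if excluded_middle_informative (spectrum A w) then K w else l (R_ w)).
  assert (hK : forall w, resolvent_set w -> ~ trace G w -> winding G w = two_pi_i -> K w = l (R_ w)).
  { intros w hw ht h; unfold K, cauchy_transform.
    pose proof (cauchy_kernel_cont_on ht) as ck.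
    assert (c1 : cont_on (V := bop_Banach X) (trace G) (fun z => scal (Cinv (Cminus z w) : C_AbsRing) (R_ w))).
    { intros z hz; apply continuous_scal_C; [exact (ck z hz)|apply continuous_const]. }
    assert (c2 : cont_on (V := bop_Banach X) (trace G) R_) by (intros z hz; apply resolvent_continuous, hGR, hz).
    assert (hl2 : is_linear (U := bop_Banach X) (V := bop_Banach X) (fun Q : B => opp (bop_comp Q (R_ w)))).
    { exact (is_linear_comp _ _ (is_linear_comp_r (R_ w)) (@is_linear_opp C_AbsRing (bop_NormedModule X))). }
    transitivity (plus (scal (winding G w : C_AbsRing) (R_ w) : B) (opp (bop_comp T (R_ w)))).
    - etransitivity; [|exact (f_equal2 plus
        (@chain_int_linear CV (bop_Banach X) _ _ G (is_linear_scal_C_l (R_ w)) ck)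
        (chain_int_linear hl2 c2))].
      etransitivity; [|apply (chain_int_plus (V := bop_Banach X) c1)].
      + apply chain_int_ext; intros z hz.
        assert (hn : Cminus z w <> RtoC 0) by (apply Cminus_neq_0; intros ->; contradiction).
        change (scal (Cinv (Cminus z w) : C_AbsRing) (R_ z) = plus (scal (Cinv (Cminus z w) : C_AbsRing) (R_ w)) (opp (bop_comp (R_ z) (R_ w))) :> B).
        assert (e : R_ z = plus (R_ w) (scal (Cminus w z : C_AbsRing) (bop_comp (R_ z) (R_ w)))).
        { rewrite <- (resolvent_identity (hGR z hz) hw); bop_eq. }
        rewrite e at 1; bop_eq; field; exact hn.
      + intros z hz; apply (continuous_linear hl2), c2, hz.
    - rewrite h; reflexivity. }
  assert (hF : forall w, F w = zero).
  { assert (hreg : forall p, continuous (T := CU) (U := bop_Banach X) F p /\ mean_value (V := bop_Banach X) F p).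
    { intros p; destruct (classic (spectrum A p)) as [hp|hp].
      - assert (ht : ~ trace G p) by (intros h; exact (hGR p h hp)).
        destruct (winding_locally_constant hG ht) as [d [d0 hd]].
        assert (eF : forall w, Cmod (Cminus w p) < d -> K w = F w).
        { intros w hw; unfold F; destruct excluded_middle_informative as [|n]; [reflexivity|].
          destruct (hd w hw) as [h1 h2]; apply hK; [exact n| |rewrite h1; apply hW, hp].
          intros h; specialize (h2 w h); rewrite Cmod_minus_diag in h2; lra. }
        destruct (@cauchy_transform_regular (bop_Banach X) resolvent_set R_ G resolvent_set_open resolvent_continuous hGR p ht) as [h1 h2].
        split; [exact (continuous_ext_disc (U := bop_Banach X) d0 eF h1)|exact (mean_value_ext_loc d0 eF h2)].
      - destruct (proj1 (open_Cmod _) resolvent_set_open p hp) as [d [d0 hd]].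
        assert (eF : forall w, Cmod (Cminus w p) < d -> l (R_ w) = F w).
        { intros w hw; unfold F; destruct excluded_middle_informative as [h|]; [elim (hd w hw h)|reflexivity]. }
        split.
        + apply (continuous_ext_disc (U := bop_Banach X) d0 eF), (continuous_linear hl), resolvent_continuous, hp.
        + apply (mean_value_ext_loc d0 eF).
          destruct (resolvent_mean_value hp) as [rho [rho0 hrho]].
          exists (Rmin rho d); split; [apply Rmin_pos; assumption|intros r hr].
          pose proof (Rmin_l rho d); pose proof (Rmin_r rho d).
          rewrite <- (hrho r) by lra.
          apply (RInt_linear hl); intros t _; apply (continuous_circle_comp (V := bop_Banach X)); [lra|].
          intros z hz; apply resolvent_continuous, hd; lra. }
    apply (@liouville (bop_Banach X)); [apply hreg|apply hreg|].
    intros e e0; destruct (linear_norm _ hl) as [M [M0 HM]].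
    exists (op_norm A + M / e); intros w hw.
    assert (hMe : 0 < M / e) by (apply Rdiv_lt_0_compat; lra).
    destruct (@resolvent_set_large w) as [h1 h2]; [lra|].
    unfold F; destruct excluded_middle_informative as [h|_]; [contradiction|].
    apply Rle_trans with (1 := HM (R_ w)); apply Rle_trans with (M * / (Cmod w - op_norm A)).
    - apply Rmult_le_compat_l; [lra|exact h2].
    - apply (Rmult_le_reg_r (Cmod w - op_norm A)); [lra|].
      rewrite Rmult_assoc, Rinv_l, Rmult_1_r by lra.
      apply Rle_trans with (e * (M / e)); [right; field; lra|apply Rmult_le_compat_l; lra]. }
  set (w := RtoC (op_norm A + 1)).
  destruct (@resolvent_set_large w) as [h1 _].
  { unfold w; rewrite Cmod_R, Rabs_pos_eq; pose proof (op_norm_ge_0 A); lra. }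
  specialize (hF w); unfold F in hF; destruct excluded_middle_informative as [h|_]; [contradiction|].
  (* One point [w] of the resolvent set is enough: composing [l (R(w)) = 0] with [w - A] leaves
     [2 i pi - T = 0]. *)
  assert (e : bop_comp (l (R_ w)) (shift w) = zero) by (rewrite hF; apply comp_zero_l).
  unfold l in e; rewrite comp_minus_l, comp_scal_l, <- comp_assoc, (proj2 (resolvent_spec h1)), comp_id_r in e.
  assert (e1 : forall P Q : B, minus P Q = zero -> Q = P).
  { intros P Q h; replace Q with (minus P (minus P Q)) by bop_eq.
    rewrite h; bop_eq. }
  exact (e1 _ _ e).
Qed.
End Resolvent.

(** * The Riesz functional calculus *)

Section Calculus.
Variable X : CompleteNormedModule C_AbsRing.
Notation B := (bounded_op X).
Notation E := (bop_Banach X).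
Notation Id := (bop_id X).
Notation tpi := (two_pi_i : C_AbsRing).
Variable U : C -> Prop.
Hypothesis U_open : open (U : CU -> Prop).

(** [surrounds] restated with the unnormalised [winding] and the resolvent set. *)
Record encloses (G : chain) (A : B) : Prop := Encloses {
  enc_cycle : is_cycle G;
  enc_U : forall z, trace G z -> U z;
  enc_res : forall z, trace G z -> resolvent_set A z;
  enc_in : forall w, spectrum A w -> winding G w = two_pi_i;
  enc_out : forall w, ~ U w -> winding G w = RtoC 0 }.

Lemma surrounds_encloses G A : surrounds G (spectrum A) U -> encloses G A.
Proof.
  intros [h1 [h2 [h3 h4]]]; split; [exact h1|intros z hz; apply h2, hz|intros z hz; apply h2, hz| |].
  - intros w hw; pose proof (is_chain_int_unique (V := CV) (h3 w hw)) as h.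
    unfold winding; rewrite <- h; cring.
  - intros w hw; pose proof (is_chain_int_unique (V := CV) (h4 w hw)) as h.
    unfold winding; rewrite <- h; cring.
Qed.

(** [2 i pi phi(A)] *)
Definition calc (A : B) (G : chain) (phi : C -> C) : B :=
  chain_int (V := E) (fun z => scal (phi z : C_AbsRing) (resolvent A z)) G.

Definition dom (A : B) (z : C) : Prop := U z /\ resolvent_set A z.

Lemma dom_open A : open (dom A : CU -> Prop).
Proof. apply open_and; [exact U_open|apply resolvent_set_open]. Qed.

Definition jcont (phi : C -> C -> C) : Prop := forall z w, U z -> U w ->
  continuous (T := CU2) (U := CU) (fun q => phi (fst q) (snd q)) (z, w).

Lemma jcont_slice phi z w : jcont phi -> U z -> U w -> continuous (T := CU) (U := CU) (fun z => phi z w) z.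
Proof.
  intros h hz hw; apply (continuous_slice (S := CU) (T := CU) (U := CU) (F := phi)), h; assumption.
Qed.

Lemma jcont_slice2 phi z w : jcont phi -> U z -> U w -> continuous (T := CU) (U := CU) (fun w => phi z w) w.
Proof.
  intros h hz hw; apply (continuous_slice2 (S := CU) (T := CU) (U := CU) (F := phi)), h; assumption.
Qed.

Section OneOperator.
Variables (A : B) (G : chain).
Hypothesis enc : encloses G A.
Notation RA := (resolvent A).

Lemma resolvent_cont_on_trace : cont_on (V := E) (trace G) RA.
Proof. intros z hz; apply resolvent_continuous, (enc_res enc), hz. Qed.

Lemma scal_resolvent_continuous (phi : C -> C) z : resolvent_set A z -> continuous (T := CU) (U := CU) phi z ->
  continuous (T := CU) (U := E) (fun z => scal (phi z : C_AbsRing) (RA z)) z.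
Proof. intros hz h; apply continuous_scal_C; [exact h|apply resolvent_continuous, hz]. Qed.

Lemma int_const_1 : chain_intC (fun _ => RtoC 1) G = RtoC 0.
Proof.
  apply (@chain_int_derive (fun z => z)); [apply (enc_cycle enc)| |].
  - intros z _; apply cdiff_id.
  - intros z _; apply continuous_const.
Qed.

Lemma int_scal_const (phi : C -> C) (P : B) : cont_on (V := CV) (trace G) phi ->
  chain_int (V := E) (fun z => scal (phi z : C_AbsRing) P) G = scal (chain_intC phi G : C_AbsRing) P.
Proof. apply (@chain_int_linear CV E _ phi G (is_linear_scal_C_l P)). Qed.

Lemma calc_linear (l : B -> B) (phi : C -> C) : is_linear (U := E) (V := E) l ->
  cont_on (V := CV) (trace G) phi ->
  chain_int (V := E) (fun z => scal (phi z : C_AbsRing) (l (RA z))) G = l (calc A G phi).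
Proof.
  intros hl hphi; unfold calc; rewrite <- (chain_int_linear hl).
  - apply chain_int_ext; intros z _; symmetry; apply (linear_scal _ hl).
  - intros z hz; apply scal_resolvent_continuous; [apply (enc_res enc), hz|apply hphi, hz].
Qed.

Lemma calc_plus phi psi : cont_on (V := CV) (trace G) phi -> cont_on (V := CV) (trace G) psi ->
  calc A G (fun z => Cplus (phi z) (psi z)) = plus (calc A G phi) (calc A G psi).
Proof.
  intros h1 h2; unfold calc; etransitivity; [|apply (chain_int_plus (V := E))].
  - apply chain_int_ext; intros z _; exact (scal_distr_r (phi z : C_AbsRing) (psi z) (RA z)).
  - intros z hz; apply scal_resolvent_continuous; [apply (enc_res enc), hz|apply h1, hz].
  - intros z hz; apply scal_resolvent_continuous; [apply (enc_res enc), hz|apply h2, hz].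
Qed.

Lemma calc_scal (k : C) phi : cont_on (V := CV) (trace G) phi ->
  calc A G (fun z => Cmult k (phi z)) = scal (k : C_AbsRing) (calc A G phi).
Proof.
  intros h1; etransitivity; [|exact (calc_linear (l := fun P : B => scal (k : C_AbsRing) P) (@is_linear_scal_C (bop_NormedModule X) k) h1)].
  apply chain_int_ext; intros z _; bop_eq.
Qed.

Lemma calc_one : calc A G (fun _ => RtoC 1) = scal tpi Id.
Proof.
  rewrite <- (int_resolvent (enc_cycle enc) (enc_res enc) (enc_in enc)).
  apply chain_int_ext; intros z _; exact (scal_one (RA z)).
Qed.

(** Since [z R(z) = A R(z) + Id], the integral is [A] applied to the value at [1], plus the integral
    of a constant over a cycle, which is zero. *)
Lemma calc_id : calc A G (fun z => z) = scal tpi A.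
Proof.
  assert (c1 : cont_on (V := CV) (trace G) (fun _ => RtoC 1)) by (intros z _; apply continuous_const).
  transitivity (plus (bop_comp A (calc A G (fun _ => RtoC 1))) (scal (chain_intC (fun _ => RtoC 1) G : C_AbsRing) Id)).
  - rewrite <- (int_scal_const Id c1), <- (calc_linear (is_linear_comp_l A) c1).
    etransitivity; [|apply (chain_int_plus (V := E))].
    + apply chain_int_ext; intros z hz.
      change (scal (z : C_AbsRing) (RA z) = plus (scal (RtoC 1 : C_AbsRing) (bop_comp A (RA z))) (scal (RtoC 1 : C_AbsRing) Id) :> B).
      rewrite <- (resolvent_shift_l (enc_res enc hz)); bop_eq.
    + intros z hz; apply continuous_scal_C; [apply continuous_const|].
      apply (continuous_linear (is_linear_comp_l A)), resolvent_cont_on_trace, hz.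
    + intros z hz; apply continuous_const.
  - rewrite int_const_1, calc_one, comp_scal_r, comp_id_r; bop_eq.
Qed.

Lemma calc_comm phi : cont_on (V := CV) (trace G) phi ->
  bop_comp A (calc A G phi) = bop_comp (calc A G phi) A.
Proof.
  intros h; rewrite <- (calc_linear (is_linear_comp_l A) h), <- (calc_linear (is_linear_comp_r A) h).
  apply chain_int_ext; intros z hz; rewrite resolvent_comm; [reflexivity|apply (enc_res enc), hz].
Qed.

Lemma calc_param_continuous phi : jcont phi -> cont_on (V := E) U (fun w => calc A G (fun z => phi z w)).
Proof.
  intros h; apply (cont_on_chain_int (V := E) (D1 := dom A) (D2 := U) U_open (F := fun z w => scal (phi z w : C_AbsRing) (RA z))).
  - intros z w [hz hz'] hw; apply continuous_scal_C; [apply h; assumption|].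
    apply (continuous_comp fstC (RA : CU -> E)); [apply continuous_fst|apply resolvent_continuous, hz'].
  - intros z hz; split; [apply (enc_U enc), hz|apply (enc_res enc), hz].
Qed.

(** This is how the scalar form of Cauchy's theorem reaches operators: after the exchange of
    integrals, the inner one is scalar for each fixed [z]. *)
Lemma int_calc_zero (G' : chain) phi : jcont phi -> (forall w, trace G' w -> U w) ->
  (forall z, U z -> chain_intC (fun w => phi z w) G' = RtoC 0) ->
  chain_int (V := E) (fun w => calc A G (fun z => phi z w)) G' = zero.
Proof.
  intros h hG' h0; unfold calc.
  rewrite (@chain_int_swap E (dom A) U (@dom_open A) U_open (fun z w => scal (phi z w : C_AbsRing) (RA z))).
  - rewrite (chain_int_ext (V := E) (F' := fun _ => zero)); [apply (chain_int_const_zero E)|].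
    intros z hz; pose proof (enc_U enc hz) as hzU.
    etransitivity; [apply (@chain_int_linear CV E _ (fun w => phi z w) G' (is_linear_scal_C_l (RA z)))|].
    + intros w hw; apply (jcont_slice2 h hzU), hG', hw.
    + rewrite h0 by exact hzU; exact (scal_zero_l (RA z)).
  - intros z w [hz hz'] hw; apply continuous_scal_C; [apply h; assumption|].
    apply (continuous_comp fstC (RA : CU -> E)); [apply continuous_fst|apply resolvent_continuous, hz'].
  - intros z hz; split; [apply (enc_U enc), hz|apply (enc_res enc), hz].
  - exact hG'.
Qed.
End OneOperator.
End Calculus.

(** * Factorisation of the generalized derivation *)

Ltac comp_simp := repeat first
  [ rewrite comp_minus_l | rewrite comp_minus_r | rewrite comp_plus_l | rewrite comp_plus_r
  | rewrite comp_scal_l | rewrite comp_scal_r | rewrite comp_assoc | rewrite comp_id_l | rewrite comp_id_r ].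

Section SlopeCalculus.
Variable X : CompleteNormedModule C_AbsRing.
Notation B := (bounded_op X).
Notation E := (bop_Banach X).
Notation Id := (bop_id X).
Notation tpi := (two_pi_i : C_AbsRing).
Variables (U : C -> Prop) (f f' : C -> C).
Hypothesis U_open : open (U : CU -> Prop).
Hypothesis f_diff : forall z, U z -> cdiff f z (f' z).
Notation h := (slope f f').

Lemma slope_jcont : jcont U h.
Proof. intros z w hz hw; apply (slope_continuous U_open f_diff hz hw). Qed.

Lemma slope_f z w : f z = Cplus (f w) (Cmult (h z w) (Cminus z w)).
Proof. rewrite slope_mult; ring. Qed.

Lemma dixon_encloses (A : B) G w : encloses U G A -> U w -> chain_intC (fun z => h z w) G = RtoC 0.
Proof. intros enc hw; apply (dixon U_open f_diff (enc_cycle enc) (enc_U enc) (enc_out enc) hw). Qed.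

Lemma cdiff_cont_on_trace (A : B) G : encloses U G A -> cont_on (V := CV) (trace G) f.
Proof. intros enc z hz; exact (cdiff_continuous (f_diff (enc_U enc hz))). Qed.

Section OneOperator.
Variables (A fA : B) (G : chain).
Hypothesis enc : encloses U G A.
Hypothesis hfA : calc A G f = scal tpi fA.
Notation RA := (resolvent A).

(** [2 i pi h(A, w)], formally [2 i pi (f(A) - f(w)) / (A - w)]. *)
Definition slope_calc (w : C) : B := calc A G (fun z => h z w).

Lemma slope_cont_on_trace w : U w -> cont_on (V := CV) (trace G) (fun z => h z w).
Proof. intros hw z hz; apply (jcont_slice slope_jcont); [apply (enc_U enc), hz|exact hw]. Qed.

Lemma slope_calc_comm w : U w -> bop_comp A (slope_calc w) = bop_comp (slope_calc w) A.
Proof. intros hw; apply (calc_comm enc), slope_cont_on_trace, hw. Qed.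

Lemma comp_scal_shift (w : C) P : bop_comp (minus (scal (w : C_AbsRing) Id) A) P = minus (scal (w : C_AbsRing) P) (bop_comp A P).
Proof. rewrite comp_minus_l, comp_scal_l, comp_id_l; reflexivity. Qed.

(** As [(w - A) R(z) = Id - (z - w) R(z)], the integrand [h(z, w) (w - A) R(z)] is
    [h(z, w) Id + (f w - f z) R(z)]. The first term integrates to zero by [dixon], and the second is
    known. *)
Lemma slope_calc_shift w : U w ->
  minus (scal (w : C_AbsRing) (slope_calc w)) (bop_comp A (slope_calc w)) = scal tpi (minus (scal (f w : C_AbsRing) Id) fA).
Proof.
  intros hw.
  pose proof (slope_cont_on_trace hw) as ch; pose proof (cdiff_cont_on_trace enc) as cf.
  assert (c1 : cont_on (V := CV) (trace G) (fun _ => RtoC 1)) by (intros z _; apply continuous_const).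
  rewrite <- comp_scal_shift, <- (calc_linear enc (is_linear_comp_l _) ch).
  assert (cfw : cont_on (V := CV) (trace G) (fun z => Cmult (f w) (RtoC 1))) by (intros z _; apply continuous_const).
  assert (cmf : cont_on (V := CV) (trace G) (fun z => Cmult (RtoC (-1)) (f z))).
  { intros z hz; apply continuous_Cmult; [apply continuous_const|apply cf, hz]. }
  transitivity (plus (scal (chain_intC (fun z => h z w) G : C_AbsRing) Id) (plus (calc A G (fun z => Cmult (f w) (RtoC 1))) (calc A G (fun z => Cmult (RtoC (-1)) (f z)))) : B).
  - rewrite <- (calc_plus enc cfw cmf), <- (int_scal_const Id ch).
    etransitivity; [|apply (chain_int_plus (V := E))].
    + apply chain_int_ext; intros z hz.
      change (scal (h z w : C_AbsRing) (bop_comp (minus (scal (w : C_AbsRing) Id) A) (RA z)) =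
        plus (scal (h z w : C_AbsRing) Id) (scal (Cplus (Cmult (f w) (RtoC 1)) (Cmult (RtoC (-1)) (f z)) : C_AbsRing) (RA z)) :> B).
      rewrite comp_scal_shift, <- (resolvent_shift_l (enc_res enc hz)), (slope_f z w); bop_eq.
    + intros z hz; apply continuous_scal_C; [apply ch, hz|apply continuous_const].
    + intros z hz; apply scal_resolvent_continuous; [apply (enc_res enc), hz|].
      apply continuous_Cplus; [apply cfw, hz|apply cmf, hz].
  - rewrite (dixon_encloses enc hw), (calc_scal enc (f w) c1), (calc_scal enc (RtoC (-1)) cf), (calc_one enc), hfA.
    bop_eq.
Qed.

Lemma slope_calc_shift_r w : U w ->
  minus (scal (w : C_AbsRing) (slope_calc w)) (bop_comp (slope_calc w) A) = scal tpi (minus (scal (f w : C_AbsRing) Id) fA).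
Proof. intros hw; rewrite <- slope_calc_comm by exact hw; apply slope_calc_shift, hw. Qed.

Lemma slope_calc_resolvent w : U w -> resolvent_set A w ->
  slope_calc w = scal tpi (minus (scal (f w : C_AbsRing) (RA w)) (bop_comp (RA w) fA)).
Proof.
  intros hw hr.
  assert (e : bop_comp (RA w) (minus (scal (w : C_AbsRing) (slope_calc w)) (bop_comp A (slope_calc w))) = slope_calc w).
  { rewrite comp_minus_r, comp_scal_r, comp_assoc.
    transitivity (bop_comp (minus (scal (w : C_AbsRing) (RA w)) (bop_comp (RA w) A)) (slope_calc w)).
    - rewrite comp_minus_l, comp_scal_l; reflexivity.
    - rewrite (resolvent_shift_r hr); apply comp_id_l. }
  rewrite <- e, slope_calc_shift by exact hw.
  rewrite comp_scal_r, comp_minus_r, comp_scal_r, comp_id_r; reflexivity.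
Qed.
End OneOperator.

(** * The operator D attached to the pair A, A' *)

Section TwoOperators.
Variables (A A' fA fA' : B) (G G' : chain).
Hypotheses (enc : encloses U G A) (enc' : encloses U G' A').
Hypotheses (hfA : calc A G f = scal tpi fA) (hfA' : calc A' G' f = scal tpi fA').
Notation RA := (resolvent A).
Notation RB := (resolvent A').
Notation S := (slope_calc A G).

(** The operator D of the overview times [(2 i pi)^2]; the integral over [G] is already contained in
    [S w]. *)
Definition factor_int (Y : B) : B := chain_int (V := E) (fun w => bop_comp (S w) (bop_comp Y (RB w))) G'.

Lemma slope_calc_continuous : cont_on (V := E) U S.
Proof. exact (calc_param_continuous U_open enc slope_jcont). Qed.

Lemma continuous_comp_op (T : UniformSpace) (P Q : T -> B) (x : T) : continuous (U := E) P x -> continuous (U := E) Q x ->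
  continuous (U := E) (fun y => bop_comp (P y) (Q y)) x.
Proof.
  intros hP hQ.
  apply (proj2 (continuous_norm_iff (V := bop_NormedModule X) _ x)); intros e e0.
  pose proof (op_norm_ge_0 (P x)) as p0; pose proof (op_norm_ge_0 (Q x)) as q0.
  set (M := op_norm (P x) + op_norm (Q x) + 1); assert (M0 : 0 < M) by (unfold M; lra).
  (* In the three-term expansion the minimum with [1] makes the product of both increments at most
     [d], so that the total is at most [d * M = e / 3]. *)
  assert (d0 : 0 < Rmin 1 (e / (3 * M))) by (apply Rmin_pos; [lra|apply Rdiv_lt_0_compat; lra]).
  generalize (filter_and _ _ (proj1 (continuous_norm_iff (V := bop_NormedModule X) _ x) hP _ d0) (proj1 (continuous_norm_iff (V := bop_NormedModule X) _ x) hQ _ d0)).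
  apply filter_imp; intros y [h1 h2].
  pose proof (Rmin_l 1 (e / (3 * M))) as l1; pose proof (Rmin_r 1 (e / (3 * M))) as l2.
  change (op_norm (minus (P y) (P x)) < Rmin 1 (e / (3 * M))) in h1; change (op_norm (minus (Q y) (Q x)) < Rmin 1 (e / (3 * M))) in h2.
  change (op_norm (minus (bop_comp (P y) (Q y)) (bop_comp (P x) (Q x))) < e).
  replace (minus (bop_comp (P y) (Q y)) (bop_comp (P x) (Q x))) with
    (plus (plus (bop_comp (minus (P y) (P x)) (minus (Q y) (Q x))) (bop_comp (P x) (minus (Q y) (Q x)))) (bop_comp (minus (P y) (P x)) (Q x)))
    by (rewrite !comp_minus_r, !comp_minus_l; bop_eq).
  apply Rle_lt_trans with (1 := op_norm_triangle _ _).
  apply Rle_lt_trans with (1 := Rplus_le_compat_r _ _ _ (op_norm_triangle _ _)).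
  pose proof (op_norm_comp (minus (P y) (P x)) (minus (Q y) (Q x))) as k1.
  pose proof (op_norm_comp (P x) (minus (Q y) (Q x))) as k2.
  pose proof (op_norm_comp (minus (P y) (P x)) (Q x)) as k3.
  pose proof (op_norm_ge_0 (minus (P y) (P x))) as a0; pose proof (op_norm_ge_0 (minus (Q y) (Q x))) as b0.
  set (a := op_norm (minus (P y) (P x))) in *; set (b := op_norm (minus (Q y) (Q x))) in *.
  set (d := e / (3 * M)) in *.
  assert (hd : d * M = e / 3) by (unfold d; field; lra).
  assert (dpos : 0 < d) by (unfold d; apply Rdiv_lt_0_compat; lra).
  assert (m1 : a * b <= 1 * d) by (apply Rmult_le_compat; lra).
  assert (m2 : op_norm (P x) * b <= op_norm (P x) * d) by (apply Rmult_le_compat_l; lra).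
  assert (m3 : a * op_norm (Q x) <= d * op_norm (Q x)) by (apply Rmult_le_compat_r; lra).
  assert (m4 : d * M = d * op_norm (P x) + d * op_norm (Q x) + d) by (unfold M; ring).
  lra.
Qed.

Lemma factor_continuous Y w : trace G' w -> continuous (T := CU) (U := E) (fun w => bop_comp (S w) (bop_comp Y (RB w))) w.
Proof.
  intros hw; apply continuous_comp_op; [apply slope_calc_continuous, (enc_U enc'), hw|].
  apply continuous_comp_op; [apply continuous_const|apply (resolvent_cont_on_trace enc'), hw].
Qed.

(** The integrand is [S(w) Y (w - A') RB(w) - S(w) (w - A) Y RB(w)]. The first term is [S(w) Y],
    whose integral vanishes by Cauchy's theorem in [w]; by [slope_calc_shift_r] the second is
    [2 i pi (f w - fA) Y RB(w)], which integrates to a combination of [Y fA'] and [fA Y]. *)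
Lemma factor_int_delta Y : factor_int (delta A A' Y) = scal (Cmult tpi tpi : C_AbsRing) (delta fA fA' Y).
Proof.
  assert (cf := cdiff_cont_on_trace enc').
  assert (c1 : cont_on (V := CV) (trace G') (fun _ => RtoC 1)) by (intros z _; apply continuous_const).
  assert (cmf : cont_on (V := CV) (trace G') (fun z => Cmult (RtoC (-1)) (f z))).
  { intros z hz; apply continuous_Cmult; [apply continuous_const|apply cf, hz]. }
  set (l1 := fun P : B => scal tpi (bop_comp Y P) : B); set (l2 := fun P : B => scal tpi (bop_comp fA (bop_comp Y P)) : B).
  assert (hl1 : is_linear (U := E) (V := E) l1).
  { exact (is_linear_comp _ _ (is_linear_comp_l Y) (@is_linear_scal_C (bop_NormedModule X) tpi)). }
  assert (hl2 : is_linear (U := E) (V := E) l2).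
  { exact (is_linear_comp _ _ (is_linear_comp _ _ (is_linear_comp_l Y) (is_linear_comp_l fA)) (@is_linear_scal_C (bop_NormedModule X) tpi)). }
  assert (hS0 : chain_int (V := E) S G' = zero).
  { apply (int_calc_zero U_open enc slope_jcont (enc_U enc')).
    intros z hz; rewrite <- (dixon_encloses enc' hz); apply chain_int_ext; intros w _; apply slope_sym. }
  assert (cS : cont_on (V := E) (trace G') S) by (intros w hw; apply slope_calc_continuous, (enc_U enc'), hw).
  transitivity (plus (bop_comp (chain_int (V := E) S G') Y) (plus (l1 (calc A' G' (fun z => Cmult (RtoC (-1)) (f z)))) (l2 (calc A' G' (fun _ => RtoC 1))))).
  - rewrite <- (calc_linear enc' hl1 cmf), <- (calc_linear enc' hl2 c1).
    assert (cc1 : cont_on (V := E) (trace G') (fun w => scal (Cmult (RtoC (-1)) (f w) : C_AbsRing) (l1 (RB w)))).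
    { intros w hw; apply continuous_scal_C; [apply cmf, hw|apply (continuous_linear hl1), (resolvent_cont_on_trace enc'), hw]. }
    assert (cc2 : cont_on (V := E) (trace G') (fun w => scal (RtoC 1 : C_AbsRing) (l2 (RB w)))).
    { intros w hw; apply continuous_scal_C; [apply continuous_const|apply (continuous_linear hl2), (resolvent_cont_on_trace enc'), hw]. }
    etransitivity; [|exact (f_equal2 plus (chain_int_linear (is_linear_comp_r Y) cS) (chain_int_plus (V := E) cc1 cc2))].
    etransitivity; [|apply (chain_int_plus (V := E))].
    + apply chain_int_ext; intros w hw; pose proof (enc_U enc' hw) as hwU; pose proof (enc_res enc' hw) as hwr.
      change (bop_comp (S w) (bop_comp (delta A A' Y) (RB w)) = plus (bop_comp (S w) Y)
        (plus (scal (Cmult (RtoC (-1)) (f w) : C_AbsRing) (scal tpi (bop_comp Y (RB w)))) (scal (RtoC 1 : C_AbsRing) (scal tpi (bop_comp fA (bop_comp Y (RB w))))))).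
      transitivity (minus (bop_comp (S w) (bop_comp Y (minus (scal (w : C_AbsRing) (RB w)) (bop_comp A' (RB w)))))
        (bop_comp (minus (scal (w : C_AbsRing) (S w)) (bop_comp (S w) A)) (bop_comp Y (RB w)))).
      * unfold delta; comp_simp.
        bop_eq.
      * rewrite (resolvent_shift_l hwr), comp_id_r, (slope_calc_shift_r enc hfA hwU).
        rewrite comp_scal_l, comp_minus_l, comp_scal_l, comp_id_l; bop_eq.
    + intros w hw; apply (continuous_linear (is_linear_comp_r Y)), cS, hw.
    + intros w hw; apply (continuous_plus (V := bop_NormedModule X)); [apply cc1, hw|apply cc2, hw].
  - rewrite hS0, comp_zero_l, (calc_scal enc' (RtoC (-1)) cf), (calc_one enc'), hfA'.
    unfold l1, l2, delta; rewrite !comp_scal_r, comp_id_r; bop_eq.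
Qed.

Lemma delta_factor_int Y : delta A A' (factor_int Y) = factor_int (delta A A' Y).
Proof.
  assert (hl : is_linear (U := E) (V := E) (fun P : B => delta A A' P)).
  { pose proof (is_linear_comp_l A) as h1; pose proof (is_linear_comp _ _ (is_linear_comp_r A') (@is_linear_opp C_AbsRing (bop_NormedModule X))) as h2.
    exact (is_linear_comp (fun P : E => (P, P)) _ (is_linear_prod _ _ is_linear_id is_linear_id)
      (is_linear_comp (fun p : E * E => (bop_comp A (fst p), opp (bop_comp (snd p) A'))) _
        (is_linear_prod _ _ (is_linear_comp _ _ is_linear_fst h1) (is_linear_comp _ _ is_linear_snd h2)) is_linear_plus)). }
  unfold factor_int; etransitivity; [symmetry; exact (chain_int_linear hl (@factor_continuous Y))|].
  apply chain_int_ext; intros w hw; unfold delta.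
  comp_simp; rewrite (slope_calc_comm enc (enc_U enc' hw)).
  assert (e : forall P : B, bop_comp (bop_comp P (RB w)) A' = bop_comp (bop_comp P A') (RB w)).
  { intros P; rewrite <- !comp_assoc, resolvent_comm; [reflexivity|apply (enc_res enc'), hw]. }
  rewrite e; reflexivity.
Qed.

Definition factor_op (Y : B) : B := scal (Cinv (Cmult tpi tpi) : C_AbsRing) (factor_int Y).

Lemma delta_riesz_factor Y : delta fA fA' Y = factor_op (delta A A' Y).
Proof.
  unfold factor_op; rewrite factor_int_delta; bop_eq.
  field; exact two_pi_i_neq_0.
Qed.

Lemma delta_riesz_range Y : delta fA fA' Y = delta A A' (factor_op Y).
Proof.
  rewrite delta_riesz_factor; unfold factor_op; rewrite <- delta_factor_int.
  unfold delta; rewrite comp_scal_l, comp_scal_r; bop_eq.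
Qed.

Lemma delta_riesz_null Y : delta A A' Y = zero -> delta fA fA' Y = zero.
Proof.
  intros hY; rewrite delta_riesz_factor, hY; unfold factor_op, factor_int.
  rewrite (chain_int_ext (V := E) (F' := fun _ => zero)).
  - rewrite (chain_int_const_zero E); bop_eq.
  - intros w _; rewrite comp_zero_l; apply comp_zero_r.
Qed.
End TwoOperators.
End SlopeCalculus.

(** * Inverting the factorisation *)

Section InverseSlope.
Variable X : CompleteNormedModule C_AbsRing.
Notation B := (bounded_op X).
Notation E := (bop_Banach X).
Notation Id := (bop_id X).
Notation tpi := (two_pi_i : C_AbsRing).
Variables (U : C -> Prop) (f f' : C -> C).
Hypothesis U_open : open (U : CU -> Prop).
Hypothesis f_diff : forall z, U z -> cdiff f z (f' z).
Notation h := (slope f f').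
Hypothesis slope_nonzero : forall z w, U z -> U w -> h z w <> RtoC 0.

Definition inv_slope (z w : C) : C := Cinv (h z w).
Notation k := inv_slope.

Lemma inv_slope_jcont : jcont U k.
Proof.
  intros z w hz hw; apply continuous_Cinv; [apply slope_nonzero; assumption|].
  apply (slope_continuous U_open f_diff hz hw).
Qed.

Lemma inv_slope_f z w : U z -> U w -> Cmult (k z w) (f z) = Cplus (Cmult (k z w) (f w)) (Cminus z w).
Proof. intros hz hw; rewrite (slope_f f f' z w); unfold k; field; apply slope_nonzero; assumption. Qed.

Lemma inv_slope_cdiff z w : U z -> U w -> exists d, cdiff (fun z => k z w) z d.
Proof.
  intros hz hw; destruct (slope_cdiff U_open f_diff hz hw) as [d hd].
  eexists; exact (cdiff_inv (f := fun z => h z w) (slope_nonzero hz hw) hd).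
Qed.

Lemma inv_slope_sym z w : k z w = k w z.
Proof. unfold k; rewrite slope_sym; reflexivity. Qed.

(** The integrand is holomorphic in [z] on [U] without being a slope, which calls for the general
    form of Cauchy's theorem. *)
Lemma int_slope_inv_slope (A : B) G u w : encloses U G A -> U u -> U w ->
  chain_intC (fun z => Cmult (k z w) (h z u)) G = RtoC 0.
Proof.
  intros enc hu hw; apply (@cauchy_homology U); [exact U_open| |apply (enc_cycle enc)|apply (enc_U enc)|apply (enc_out enc)].
  intros z hz; destruct (inv_slope_cdiff hz hw) as [d1 h1]; destruct (slope_cdiff U_open f_diff hz hu) as [d2 h2].
  eexists; exact (cdiff_mult h1 h2).
Qed.

Section OneOperator.
Variables (A fA : B) (G : chain).
Hypothesis enc : encloses U G A.
Hypothesis hfA : calc A G f = scal tpi fA.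
Notation RA := (resolvent A).
Notation S := (slope_calc f f' A G).

(** [2 i pi k(A, w)], formally [2 i pi (A - w) / (f(A) - f(w))]. *)
Definition inv_calc (w : C) : B := calc A G (fun z => k z w).

Lemma inv_slope_cont_on_trace w : U w -> cont_on (V := CV) (trace G) (fun z => k z w).
Proof. intros hw z hz; apply (jcont_slice inv_slope_jcont); [apply (enc_U enc), hz|exact hw]. Qed.

Lemma slope_calc_resolvent_r w : U w -> resolvent_set A w ->
  S w = scal tpi (minus (scal (f w : C_AbsRing) (RA w)) (bop_comp fA (RA w))).
Proof.
  intros hw hr.
  assert (e : bop_comp (minus (scal (w : C_AbsRing) (S w)) (bop_comp (S w) A)) (RA w) = S w).
  { transitivity (bop_comp (S w) (minus (scal (w : C_AbsRing) (RA w)) (bop_comp A (RA w)))).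
    - comp_simp; reflexivity.
    - rewrite (resolvent_shift_l hr); apply comp_id_r. }
  rewrite <- e, (slope_calc_shift_r U_open f_diff enc hfA hw); comp_simp; reflexivity.
Qed.

Lemma int_inv_slope_slope_calc w : U w -> chain_int (V := E) (fun z => scal (k z w : C_AbsRing) (S z)) G = zero.
Proof.
  intros hw.
  transitivity (chain_int (V := E) (fun z => calc A G (fun u => Cmult (k z w) (h u z))) G).
  - apply chain_int_ext; intros z hz; symmetry; apply (calc_scal enc).
    apply (slope_cont_on_trace U_open f_diff enc), (enc_U enc), hz.
  - apply (@int_calc_zero X U U_open A G enc G (fun u z => Cmult (k z w) (h u z))).
    + intros u z hu hz; apply continuous_Cmult.
      * apply (continuous_comp sndC (fun z => k z w : CU)); [apply continuous_snd|].
        apply (jcont_slice inv_slope_jcont hz hw).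
      * apply (slope_jcont U_open f_diff hu hz).
    + apply (enc_U enc).
    + intros u hu; rewrite <- (int_slope_inv_slope enc hu hw); apply chain_int_ext; intros z _; rewrite (slope_sym f f' u z); reflexivity.
Qed.

(** The vanishing integral of [k(z, w) S(z)] is evaluated with [S(z) = 2 i pi R(z) (f z - fA)].
    Writing [k f(z)] as [k f(w) + (z - w)] produces [K(w) (f w - fA)] and the value of the calculus
    at [z - w], which is [2 i pi (A - w)]. *)
Lemma inv_calc_spec w : U w ->
  bop_comp (inv_calc w) (minus (scal (f w : C_AbsRing) Id) fA) = scal tpi (minus (scal (w : C_AbsRing) Id) A).
Proof.
  intros hw.
  set (l := fun P : B => bop_comp (bop_comp (scal tpi Id) P) (minus (scal (f w : C_AbsRing) Id) fA)).
  assert (hl : is_linear (U := E) (V := E) l).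
  { exact (is_linear_comp _ _ (is_linear_comp_l (scal tpi Id : B)) (is_linear_comp_r (minus (scal (f w : C_AbsRing) Id) fA : B))). }
  assert (ck := inv_slope_cont_on_trace hw).
  assert (c1 : cont_on (V := CV) (trace G) (fun _ => RtoC 1)) by (intros z _; apply continuous_const).
  assert (cid : cont_on (V := CV) (trace G) (fun z => z)) by (intros z _; apply continuous_id).
  assert (cw : cont_on (V := CV) (trace G) (fun z => Cmult (Copp w) (RtoC 1))) by (intros z _; apply continuous_const).
  assert (czw : cont_on (V := CV) (trace G) (fun z => Cplus z (Cmult (Copp w) (RtoC 1)))).
  { intros z hz; apply continuous_Cplus; [apply cid, hz|apply cw, hz]. }
  pose (m := fun P : B => scal tpi P : B).
  assert (hm : is_linear (U := E) (V := E) m) by exact (@is_linear_scal_C (bop_NormedModule X) tpi).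
  assert (e : plus (l (inv_calc w)) (m (calc A G (fun z => Cplus z (Cmult (Copp w) (RtoC 1))))) = zero).
  { etransitivity; [|exact (int_inv_slope_slope_calc hw)]; unfold inv_calc.
    rewrite <- (calc_linear enc hl ck), <- (calc_linear enc hm czw).
    symmetry; etransitivity; [|apply (chain_int_plus (V := E))].
    - apply chain_int_ext; intros z hz; pose proof (enc_U enc hz) as hzU; pose proof (enc_res enc hz) as hzr.
      change (scal (k z w : C_AbsRing) (S z) = plus (scal (k z w : C_AbsRing) (l (RA z))) (scal (Cplus z (Cmult (Copp w) (RtoC 1)) : C_AbsRing) (m (RA z))) :> B).
      unfold l, m; rewrite (slope_calc_resolvent U_open f_diff enc hfA hzU hzr); comp_simp.
      pose proof (inv_slope_f hzU hw) as hk.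
      replace (scal (k z w : C_AbsRing) (scal tpi (minus (scal (f z : C_AbsRing) (RA z)) (bop_comp (RA z) fA)) : B)) with
        (plus (scal (Cmult tpi (Cmult (k z w) (f z)) : C_AbsRing) (RA z)) (scal (Copp (Cmult tpi (k z w)) : C_AbsRing) (bop_comp (RA z) fA)) : B)
        by bop_eq.
      rewrite hk; bop_eq.
    - intros z hz; apply continuous_scal_C; [apply ck, hz|apply (continuous_linear hl), (resolvent_cont_on_trace enc), hz].
    - intros z hz; apply continuous_scal_C; [apply czw, hz|apply (continuous_linear hm), (resolvent_cont_on_trace enc), hz]. }
  rewrite (calc_plus enc cid cw), (calc_scal enc (Copp w) c1), (calc_one enc), (calc_id enc) in e.
  unfold l, m in e; rewrite comp_scal_l, comp_id_l, comp_scal_l in e.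
  apply (scal_C_inj two_pi_i_neq_0).
  assert (e1 : forall P Q : B, plus P Q = zero -> P = opp Q).
  { intros P Q h0; replace P with (minus (plus P Q) Q) by bop_eq.
    rewrite h0; bop_eq. }
  etransitivity; [exact (e1 _ _ e)|bop_eq].
Qed.

Lemma inv_calc_continuous : cont_on (V := E) U inv_calc.
Proof. exact (calc_param_continuous U_open enc inv_slope_jcont). Qed.
End OneOperator.

Section TwoOperators.
Variables (A A' fA fA' : B) (G G' : chain).
Hypotheses (enc : encloses U G A) (enc' : encloses U G' A').
Hypotheses (hfA : calc A G f = scal tpi fA) (hfA' : calc A' G' f = scal tpi fA').
Notation RB := (resolvent A').
Notation K := (inv_calc A G).
Notation S' := (slope_calc f f' A' G').

(** [S'(w)] is itself an integral over [v] in the same cycle [G']. After the exchange, the inner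
    integral of [h(v, w) K(w)] in [w] vanishes for each [v]. *)
Lemma int_inv_calc_slope_calc Y : chain_int (V := E) (fun w => bop_comp (K w) (bop_comp Y (S' w))) G' = zero.
Proof.
  set (F := fun v w => scal (h v w : C_AbsRing) (bop_comp (K w) (bop_comp Y (RB v))) : B).
  assert (cF : forall v w, dom U A' v -> U w -> continuous (T := CU2) (U := E) (fun q => F (fst q) (snd q)) (v, w)).
  { intros v w [hv hv'] hw; apply continuous_scal_C; [apply (slope_jcont U_open f_diff hv hw)|].
    apply continuous_comp_op.
    - apply (continuous_comp sndC (K : CU -> E)); [apply continuous_snd|apply (inv_calc_continuous enc), hw].
    - apply continuous_comp_op; [apply continuous_const|].
      apply (continuous_comp fstC (RB : CU -> E)); [apply continuous_fst|apply resolvent_continuous, hv']. }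
  transitivity (chain_int (V := E) (fun w => chain_int (V := E) (fun v => F v w) G') G').
  - apply chain_int_ext; intros w hw; pose proof (enc_U enc' hw) as hwU; symmetry; unfold F.
    exact (calc_linear enc' (is_linear_comp _ _ (is_linear_comp_l Y) (is_linear_comp_l (K w))) (slope_cont_on_trace U_open f_diff enc' hwU)).
  - rewrite (@chain_int_swap E (dom U A') U (@dom_open X U U_open A') U_open F cF G' G'
      (fun v hv => conj (enc_U enc' hv) (enc_res enc' hv)) (enc_U enc')).
    rewrite (chain_int_ext (V := E) (F' := fun _ => zero)); [apply (chain_int_const_zero E)|].
    intros v hv; pose proof (enc_U enc' hv) as hvU; unfold F.
    assert (h0 : chain_int (V := E) (fun w => scal (h v w : C_AbsRing) (K w)) G' = zero).
    { transitivity (chain_int (V := E) (fun w => calc A G (fun z => Cmult (h v w) (k z w))) G').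
      - apply chain_int_ext; intros w hw; symmetry; apply (calc_scal enc), (inv_slope_cont_on_trace enc), (enc_U enc'), hw.
      - apply (@int_calc_zero X U U_open A G enc G' (fun z w => Cmult (h v w) (k z w))); [|apply (enc_U enc')|].
        + intros z w hz hw; apply continuous_Cmult; [|apply (inv_slope_jcont hz hw)].
          apply (continuous_comp sndC (fun w => h v w : CU)); [apply continuous_snd|].
          apply (jcont_slice2 (slope_jcont U_open f_diff) hvU hw).
        + intros z hz; rewrite <- (int_slope_inv_slope enc' hvU hz); apply chain_int_ext; intros w _.
          rewrite (slope_sym f f' v w), (inv_slope_sym z w); apply Cmult_comm. }
    assert (cK : cont_on (V := E) (trace G') (fun w => scal (h v w : C_AbsRing) (K w))).
    { intros w hw; apply continuous_scal_C; [apply (jcont_slice2 (slope_jcont U_open f_diff) hvU), (enc_U enc'), hw|].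
      apply (inv_calc_continuous enc), (enc_U enc'), hw. }
    transitivity (bop_comp (chain_int (V := E) (fun w => scal (h v w : C_AbsRing) (K w)) G') (bop_comp Y (RB v))).
    + etransitivity; [|exact (chain_int_linear (is_linear_comp_r (bop_comp Y (RB v))) cK)].
      apply chain_int_ext; intros w _; symmetry; apply comp_scal_l.
    + rewrite h0; apply comp_zero_l.
Qed.

(** Because [fA Y = Y fA'], the integrand [K(w) Y S'(w)] equals [2 i pi K(w) (f w - fA) Y RB(w)],
    that is, [(2 i pi)^2 (w - A) Y RB(w)]. Its integral is [(2 i pi)^3 (Y A' - A Y)], and it
    vanishes by the preceding lemma. *)
Lemma delta_null_riesz Y : delta fA fA' Y = zero -> delta A A' Y = zero.
Proof.
  intros hY.
  assert (hYc : bop_comp fA Y = bop_comp Y fA').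
  { replace (bop_comp fA Y) with (plus (delta fA fA' Y) (bop_comp Y fA')) by (unfold delta; bop_eq).
    rewrite hY; bop_eq. }
  set (l := fun P : B => scal (Cmult tpi tpi : C_AbsRing) (bop_comp Y P) : B).
  set (m := fun P : B => scal (Cmult tpi tpi : C_AbsRing) (bop_comp (bop_comp A Y) P) : B).
  assert (hl : is_linear (U := E) (V := E) l).
  { exact (is_linear_comp _ _ (is_linear_comp_l Y) (@is_linear_scal_C (bop_NormedModule X) (Cmult tpi tpi))). }
  assert (hm : is_linear (U := E) (V := E) m).
  { exact (is_linear_comp _ _ (is_linear_comp_l (bop_comp A Y)) (@is_linear_scal_C (bop_NormedModule X) (Cmult tpi tpi))). }
  assert (cid : cont_on (V := CV) (trace G') (fun z => z)) by (intros z _; apply continuous_id).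
  assert (c1 : cont_on (V := CV) (trace G') (fun _ => RtoC (-1))) by (intros z _; apply continuous_const).
  assert (e : plus (l (calc A' G' (fun z => z))) (m (calc A' G' (fun _ => RtoC (-1)))) = zero).
  { etransitivity; [|exact (int_inv_calc_slope_calc Y)].
    rewrite <- (calc_linear enc' hl cid), <- (calc_linear enc' hm c1).
    symmetry; etransitivity; [|apply (chain_int_plus (V := E))].
    - apply chain_int_ext; intros w hw; pose proof (enc_U enc' hw) as hwU; pose proof (enc_res enc' hw) as hwr.
      change (bop_comp (K w) (bop_comp Y (S' w)) = plus (scal (w : C_AbsRing) (l (RB w))) (scal (RtoC (-1) : C_AbsRing) (m (RB w)))).
      transitivity (scal tpi (bop_comp (bop_comp (K w) (minus (scal (f w : C_AbsRing) Id) fA)) (bop_comp Y (RB w))) : B).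
      + rewrite (slope_calc_resolvent_r enc' hfA' hwU hwr); comp_simp.
        rewrite <- (comp_assoc (K w) fA Y), hYc; comp_simp; bop_eq.
      + rewrite (inv_calc_spec enc hfA hwU); unfold l, m; comp_simp; bop_eq.
    - intros z hz; apply continuous_scal_C; [apply cid, hz|apply (continuous_linear hl), (resolvent_cont_on_trace enc'), hz].
    - intros z hz; apply continuous_scal_C; [apply c1, hz|apply (continuous_linear hm), (resolvent_cont_on_trace enc'), hz]. }
  assert (em : calc A' G' (fun _ => RtoC (-1)) = scal (RtoC (-1) : C_AbsRing) (scal tpi Id)).
  { rewrite <- (calc_one enc'), <- (calc_scal enc' (RtoC (-1)) (fun z _ => continuous_const _ _)); apply chain_int_ext; intros z _.
    f_equal; match goal with |- ?a = ?b => change (@eq C a b) end; ring. }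
  rewrite em, (calc_id enc') in e; unfold l, m in e.
  rewrite !comp_scal_r, comp_id_r in e.
  apply (scal_C_inj (k := Cmult (Cmult tpi tpi) tpi)).
  - repeat apply Cmult_neq_0; exact two_pi_i_neq_0.
  - etransitivity; [|etransitivity; [exact (f_equal (@opp (bop_AbelianGroup X)) e)|bop_eq]].
    unfold delta; bop_eq.
Qed.
End TwoOperators.
End InverseSlope.

(** * Injective functions and small circles *)

Section Injective.
Variables (U : C -> Prop) (f f' : C -> C).
Hypothesis U_open : open (U : CU -> Prop).
Hypothesis f_diff : forall z, U z -> cdiff f z (f' z).
Hypothesis f_inj : injective_on U f.
Notation h := (slope f f').

Lemma slope_neq_0_off_diag z w : U z -> U w -> z <> w -> h z w <> RtoC 0.
Proof.
  intros hz hw hzw h0; pose proof (slope_mult f f' z w) as e; rewrite h0 in e.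
  apply hzw, (f_inj hz hw), Cminus_eq_0; rewrite <- e; ring.
Qed.

(** If [f'] vanished around [a], then [f] would take the same value at both ends of a half circle
    about [a], against injectivity. *)
Lemma derivative_not_locally_zero a d : U a -> 0 < d -> exists w, U w /\ Cmod (Cminus w a) < d /\ w <> a /\ f' w <> RtoC 0.
Proof.
  intros ha d0; apply NNPP; intros hn.
  destruct (proj1 (open_Cmod U) U_open a ha) as [d1 [d10 hd1]].
  set (r := Rmin d d1 / 2); assert (hm : 0 < Rmin d d1) by (apply Rmin_pos; assumption).
  pose proof (Rmin_l d d1); pose proof (Rmin_r d d1).
  set (g := circle_arc PI a (RtoC r)).
  assert (hg : forall t, Cmod (Cminus (g t) a) = r).
  { intros t; simpl; replace (Cminus _ a) with (Cmult (RtoC r) (cis (PI * t))) by ring.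
    rewrite Cmod_mult, Cmod_R, Cmod_cis, Rabs_pos_eq; unfold r; lra. }
  assert (hgU : forall t, U (g t)) by (intros t; apply hd1; rewrite hg; unfold r; lra).
  assert (hgd : forall t, f' (g t) = RtoC 0).
  { intros t; apply NNPP; intros hne; apply hn; exists (g t); split; [apply hgU|split; [rewrite hg; unfold r; lra|split; [|exact hne]]].
    intros e; specialize (hg t); rewrite e, Cmod_minus_diag in hg; unfold r in hg; lra. }
  assert (e : arc_int (V := CV) (fun _ => RtoC 0) g = Cminus (f (g 1)) (f (g 0))).
  { apply arc_int_derive; intros t _; [rewrite <- (hgd t); apply f_diff, hgU|apply continuous_const]. }
  pose proof (chain_int_const_zero CV (g :: nil)) as e0; simpl in e0; rewrite plus_zero_r in e0.
  change (arc_int (V := CV) (fun _ => RtoC 0) g = RtoC 0) in e0.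
  rewrite e0 in e; symmetry in e; apply Cminus_eq_0, f_inj in e; [|apply hgU|apply hgU].
  assert (ec : cis (PI * 1) = cis (PI * 0)).
  { assert (hr : RtoC r <> RtoC 0) by (intros h0; apply RtoC_inj in h0; unfold r in h0; lra).
    simpl in e; apply (f_equal (fun z => Cdiv (Cminus z a) (RtoC r))) in e.
    replace (cis (PI * 1)) with (Cdiv (Cminus (Cplus a (Cmult (RtoC r) (cis (PI * 1)))) a) (RtoC r)) by (field; exact hr).
    rewrite e; field; exact hr. }
  unfold cis in ec; rewrite Rmult_1_r, Rmult_0_r, cos_PI, cos_0 in ec; injection ec; lra.
Qed.

(** Hurwitz: for [w] near [a] with [f' w <> 0] the zero-free function [1 / h(., w)] is bounded
    on a fixed circle around [a], hence at [a], uniformly in [w]. *)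
Lemma injective_slope_neq_0 z w : U z -> U w -> h z w <> RtoC 0.
Proof.
  intros hz hw; destruct (classic (z = w)) as [->|n]; [clear hz|apply slope_neq_0_off_diag; assumption].
  rename w into a; intros ha0.
  destruct (proj1 (open_Cmod U) U_open a hw) as [d1 [d10 hd1]].
  set (r := d1 / 2); assert (hr : 0 < r < d1) by (unfold r; lra).
  assert (hcU : forall t, U (circle_pt a r t)) by (intros t; apply hd1; rewrite Cmod_circle_pt; lra).
  assert (hne : forall t, Cminus (f (circle_pt a r t)) (f a) <> RtoC 0).
  { intros t; apply Cminus_neq_0; intros e; apply f_inj in e; [|apply hcU|exact hw].
    pose proof (@Cmod_circle_pt a r t ltac:(lra)) as hc; rewrite e, Cmod_minus_diag in hc; lra. }
  destruct (bounded_continuity (V := C_NormedModule) (fun t => Cinv (Cminus (f (circle_pt a r t)) (f a))) 0 1) as [N HN].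
  { intros t _; apply continuous_Cinv; [apply hne|].
    apply continuous_Cminus; [|apply continuous_const].
    apply (continuous_comp (circle_pt a r : R -> CU) (f : CU -> CU)); [apply continuous_circle_pt|].
    exact (cdiff_continuous (f_diff (hcU t))). }
  assert (N0 : 0 < N) by (apply Rle_lt_trans with (2 := HN 0 ltac:(lra)), norm_ge_0).
  assert (hN : forall t, 0 <= t <= 1 -> / N <= Cmod (Cminus (f (circle_pt a r t)) (f a))).
  { intros t ht; pose proof (HN t ht) as hb; change (Cmod (Cinv (Cminus (f (circle_pt a r t)) (f a))) < N) in hb.
    rewrite Cmod_inv in hb by apply hne; pose proof (proj1 (Cmod_gt_0 _) (hne t)).
    rewrite <- (Rinv_inv (Cmod (Cminus (f (circle_pt a r t)) (f a)))); apply Rlt_le, Rinv_lt_contravar; [|exact hb].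
    apply Rmult_lt_0_compat; [apply Rinv_0_lt_compat; assumption|exact N0]. }
  assert (i2 : 0 < / (2 * N)) by (apply Rinv_0_lt_compat; lra).
  destruct (proj1 (continuous_C_iff (V := C_NormedModule) f a) (cdiff_continuous (f_diff hw)) _ i2) as [d2 [d20 hd2]].
  (* On the circle [f z - f w] has modulus at least [/ (2 * N)] and [z - w] at most [2 * r], so the
     slope is at least [/ (4 * r * N)]. The mean value property carries this bound to [h(a, w)],
     against continuity at the supposed zero [h(a, a)]. *)
  assert (i4 : 0 < / (4 * r * N)) by (apply Rinv_0_lt_compat; repeat apply Rmult_lt_0_compat; lra).
  assert (hc : continuous (T := CU) (U := CU) (fun w => h a w) a).
  { apply (continuous_slice2 (S := CU) (T := CU) (U := CU) (F := h)), (slope_continuous U_open f_diff hw hw). }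
  destruct (proj1 (continuous_C_iff (V := C_NormedModule) (fun w => h a w) a) hc _ i4) as [d3 [d30 hd3]].
  (* [f' w <> 0] excludes a zero of [h(., w)] at [w] itself, the one place that injectivity does not
     settle. *)
  destruct (@derivative_not_locally_zero a (Rmin (Rmin d2 d3) r) hw) as [w [hwU [hwd [hwa hw0]]]]; [repeat apply Rmin_pos; lra|].
  assert (w2 : Cmod (Cminus w a) < d2) by (apply Rlt_le_trans with (1 := hwd), Rle_trans with (1 := Rmin_l _ _), Rmin_l).
  assert (w3 : Cmod (Cminus w a) < d3) by (apply Rlt_le_trans with (1 := hwd), Rle_trans with (1 := Rmin_l _ _), Rmin_r).
  assert (wr : Cmod (Cminus w a) < r) by (apply Rlt_le_trans with (1 := hwd), Rmin_r).
  specialize (hd2 w w2); change (Cmod (Cminus (f w) (f a)) < / (2 * N)) in hd2.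
  specialize (hd3 w w3); change (Cmod (Cminus (h a w) (h a a)) < / (4 * r * N)) in hd3.
  rewrite ha0 in hd3; replace (Cminus (h a w) (RtoC 0)) with (h a w) in hd3 by ring.
  assert (hnz : forall z, U z -> h z w <> RtoC 0).
  { intros z hz; destruct (classic (z = w)) as [->|n]; [rewrite slope_diag; exact hw0|apply slope_neq_0_off_diag; assumption]. }
  assert (hdk : forall z, U z -> exists d, cdiff (fun z => Cinv (h z w)) z d).
  { intros z hz; destruct (slope_cdiff U_open f_diff hz hwU) as [d hd]; eexists; exact (cdiff_inv (f := fun z => h z w) (hnz z hz) hd). }
  assert (hk : Cmod (Cinv (h a w)) <= 4 * r * N).
  { rewrite <- (@cmean_center (fun z => Cinv (h z w)) a a r d1 hr).
    - replace (4 * r * N) with (4 * r * N * (1 - 0)) by ring.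
      apply (norm_RInt_const (V := real_module CV)); [lra| |].
      + intros t _; apply (continuous_circle_comp (V := CV) (F := fun z => Cinv (h z w))); [lra|].
        intros z hz; destruct (hdk z (hd1 z ltac:(lra))) as [d hd]; exact (cdiff_continuous hd).
      + intros t ht; match goal with |- norm ?x <= ?y => change (Cmod (Cinv (h (circle_pt a r t) w)) <= y) end.
        pose proof (hnz _ (hcU t)) as hz0.
        rewrite Cmod_inv by exact hz0.
        pose proof (proj1 (Cmod_gt_0 _) hz0) as p0.
        assert (k1 : / (2 * N) <= Cmod (Cminus (f (circle_pt a r t)) (f w))).
        { pose proof (hN t ht) as k0; pose proof (Cmod_triangle (Cminus (f (circle_pt a r t)) (f w)) (Cminus (f w) (f a))) as k2.
          replace (Cplus (Cminus (f (circle_pt a r t)) (f w)) (Cminus (f w) (f a))) with (Cminus (f (circle_pt a r t)) (f a)) in k2 by ring.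
          assert (/ N = / (2 * N) + / (2 * N)) by (field; lra); lra. }
        assert (k3 : Cmod (Cminus (circle_pt a r t) w) <= 2 * r).
        { replace (Cminus (circle_pt a r t) w) with (Cminus (Cminus (circle_pt a r t) a) (Cminus w a)) by ring.
          apply Rle_trans with (1 := Cmod_triangle _ _); rewrite Cmod_opp, Cmod_circle_pt; lra. }
        rewrite <- (slope_mult f f'), Cmod_mult in k1.
        apply (Rmult_le_reg_l (Cmod (h (circle_pt a r t) w))); [exact p0|rewrite Rinv_r by lra].
        apply (Rmult_le_compat_l (2 * N)) in k1; [|lra]; rewrite Rinv_r in k1 by lra.
        assert (Cmod (h (circle_pt a r t) w) * Cmod (Cminus (circle_pt a r t) w) <= Cmod (h (circle_pt a r t) w) * (2 * r)) by (apply Rmult_le_compat_l; lra).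
        apply Rle_trans with (1 := k1).
        apply Rle_trans with (2 * N * (Cmod (h (circle_pt a r t) w) * (2 * r))); [apply Rmult_le_compat_l; lra|right; ring].
    - rewrite Cmod_minus_diag; lra.
    - intros z hz; destruct (hdk z (hd1 z hz)) as [d hd]; exact (cdiff_continuous hd).
    - intros z hz _; exact (hdk z (hd1 z hz)). }
  pose proof (hnz a hw) as haw; rewrite Cmod_inv in hk by exact haw.
  pose proof (proj1 (Cmod_gt_0 _) haw) as p0.
  apply Rinv_le_contravar in hk; [|apply Rinv_0_lt_compat, p0]; rewrite Rinv_inv in hk; lra.
Qed.
End Injective.

Section CircleEncloses.
Variable rho : R.
Hypothesis rho_pos : 0 < rho.
Notation G0 := (circle (RtoC 0) rho :: nil).

Lemma circle_is_cycle : is_cycle G0.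
Proof.
  unfold is_cycle; simpl.
  replace (cis (2 * PI * 1)) with (cis (2 * PI * 0)); [apply Permutation_refl|].
  rewrite <- (cis_period (2 * PI * 0) 1); f_equal; ring.
Qed.

Lemma winding_circle w : Cmod w <> rho ->
  winding G0 w = Cmult two_pi_i (cmeanC (fun z => Cdiv (Cminus z (RtoC 0)) (Cminus z w)) (RtoC 0) rho).
Proof.
  intros hw.
  assert (hne : forall z, Cmod (Cminus z (RtoC 0)) = rho -> Cminus z w <> RtoC 0).
  { intros z hz; apply Cminus_neq_0; intros ->; replace (Cminus w (RtoC 0)) with w in hz by ring; contradiction. }
  unfold winding; etransitivity; [|apply (circle_int_cmean (V := CV) (p := RtoC 0) (r := rho) (F := fun z => Cdiv (Cminus z (RtoC 0)) (Cminus z w)) rho_pos)].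
  - apply chain_int_ext; intros z hz; apply trace_circle in hz; [|lra].
    match goal with |- ?a = scal ?b ?c => change (@eq C a (Cmult b c)) end.
    field; split; [apply hne, hz|intros h0; rewrite h0, Cmod_minus_diag in hz; lra].
  - intros z hz; apply continuous_Cdiv; [apply hne, hz| |]; apply continuous_Csub.
Qed.

Lemma winding_circle_in w : Cmod w < rho -> winding G0 w = two_pi_i.
Proof.
  intros hw; rewrite winding_circle by lra; rewrite cmean_cauchy_weight; [cring|].
  replace (Cminus w (RtoC 0)) with w by ring; exact hw.
Qed.

Lemma winding_circle_out w : rho < Cmod w -> winding G0 w = RtoC 0.
Proof.
  intros hw; rewrite winding_circle by lra.
  assert (hd : forall z, Cmod (Cminus z (RtoC 0)) < Cmod w -> exists d, cdiff (fun z => Cdiv (Cminus z (RtoC 0)) (Cminus z w)) z d).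
  { intros z hz; eexists; apply cdiff_mult; [exact (cdiff_minus (cdiff_id z) (cdiff_const _ z))|].
    apply (cdiff_inv (f := fun z => Cminus z w)); [|exact (cdiff_minus (cdiff_id z) (cdiff_const _ z))].
    apply Cminus_neq_0; intros ->; replace (Cminus w (RtoC 0)) with w in hz by ring; lra. }
  rewrite (@cmean_center (fun z => Cdiv (Cminus z (RtoC 0)) (Cminus z w)) (RtoC 0) (RtoC 0) rho (Cmod w)).
  - unfold Cdiv; cring.
  - lra.
  - rewrite Cmod_minus_diag; exact rho_pos.
  - intros z hz; destruct (hd z hz) as [d h1]; exact (cdiff_continuous h1).
  - intros z hz _; exact (hd z hz).
Qed.

Lemma circle_encloses (X : CompleteNormedModule C_AbsRing) (A : bounded_op X) (U : C -> Prop) :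
  op_norm A < rho -> (forall z, Cmod z <= rho -> U z) -> encloses U G0 A.
Proof.
  intros hA hU.
  assert (htr : forall z, trace G0 z -> Cmod z = rho).
  { intros z hz; apply trace_circle in hz; [|lra]; replace (Cminus z (RtoC 0)) with z in hz by ring; exact hz. }
  split.
  - exact circle_is_cycle.
  - intros z hz; apply hU; rewrite (htr z hz); lra.
  - intros z hz; apply resolvent_set_large; rewrite (htr z hz); exact hA.
  - intros w hw; apply winding_circle_in; apply Rnot_le_lt; intros h.
    apply (proj1 (resolvent_set_large (A := A) (z := w) ltac:(lra)) hw).
  - intros w hw; apply winding_circle_out; apply Rnot_le_lt; intros h; apply hw, hU, h.
Qed.
End CircleEncloses.

(** * Angle and ascent *)

(** No range is imposed on [s]: [asin] is constant beyond [-1] and [1]. *)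
Lemma asin_pos_iff s : 0 < asin s <-> 0 < s.
Proof.
  pose proof PI_RGT_0 as hpi.
  unfold asin; destruct (Rle_dec s (-1)) as [h1|h1]; [split; lra|].
  destruct (Rle_dec 1 s) as [h2|h2]; [split; lra|].
  assert (hs : 0 < sqrt (1 - Rsqr s)) by (apply sqrt_lt_R0; unfold Rsqr; nra).
  assert (hi : 0 < / sqrt (1 - Rsqr s)) by (apply Rinv_0_lt_compat, hs).
  split; intros h.
  - apply Rnot_le_lt; intros hle.
    assert (hq : s / sqrt (1 - Rsqr s) <= 0) by (unfold Rdiv; nra).
    destruct (Req_dec (s / sqrt (1 - Rsqr s)) 0) as [e|n]; [rewrite e, atan_0 in h; lra|].
    pose proof (atan_increasing (s / sqrt (1 - Rsqr s)) 0 ltac:(lra)) as h3; rewrite atan_0 in h3; lra.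
  - rewrite <- atan_0; apply atan_increasing, Rdiv_lt_0_compat; assumption.
Qed.

Section AngleAscentFacts.
Variable V : NormedModule C_AbsRing.

Lemma norm_scal_C (k : C) (x : V) : norm (scal (k : C_AbsRing) x) = Cmod k * norm x.
Proof.
  apply Rle_antisym; [apply (norm_scal (k : C_AbsRing) x)|].
  destruct (classic (k = RtoC 0)) as [->|hk]; [rewrite Cmod_0, Rmult_0_l; apply norm_ge_0|].
  pose proof (norm_scal (Cinv k : C_AbsRing) (scal (k : C_AbsRing) x)) as h.
  change (norm (scal (Cinv k : C_AbsRing) (scal (k : C_AbsRing) x)) <= Cmod (Cinv k) * norm (scal (k : C_AbsRing) x)) in h.
  replace (scal (Cinv k : C_AbsRing) (scal (k : C_AbsRing) x)) with x in h by (mod_eq V; field; exact hk).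
  rewrite Cmod_inv in h by exact hk; pose proof (proj1 (Cmod_gt_0 k) hk).
  apply (Rmult_le_compat_l (Cmod k)) in h; [|lra]; rewrite <- Rmult_assoc, Rinv_r in h; lra.
Qed.

Lemma norm_pos_neq (x : V) : x <> zero -> 0 < norm x.
Proof.
  intros h; pose proof (norm_ge_0 x); destruct (Req_dec (norm x) 0) as [e|]; [|lra].
  elim h; apply norm_eq_zero, e.
Qed.

Lemma norm_normalized (x : V) : x <> zero -> norm (scal (RtoC (/ norm x) : C_AbsRing) x) = 1.
Proof.
  intros h; pose proof (norm_pos_neq h) as h0; rewrite norm_scal_C, Cmod_R, Rabs_pos_eq.
  - apply Rinv_l; lra. - apply Rlt_le, Rinv_0_lt_compat, h0.
Qed.

Lemma norm_minus_diag (x : V) : norm (minus x x) = 0.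
Proof. etransitivity; [exact (f_equal norm (minus_eq_zero x))|exact norm_zero]. Qed.

(** Positivity of the angle freed from [asin] and from the infimum; in this form it visibly passes
    to smaller subspaces, the trivial ones included. *)
Definition separated (K M : V -> Prop) : Prop := is_trivial K \/ is_trivial M \/
  exists e, 0 < e /\ forall x y, K x -> norm x = 1 -> M y -> e <= norm (minus x y).

Lemma not_trivial_ex (K : V -> Prop) : ~ is_trivial K -> exists x, K x /\ x <> zero.
Proof.
  intros h; apply NNPP; intros hn; apply h; intros x hx; apply NNPP; intros hx0; apply hn; exists x; split; assumption.
Qed.

Lemma angle_pos_iff (K M : V -> Prop) : (forall k x, K x -> K (scal (k : C_AbsRing) x)) ->
  0 < angle K M <-> separated K M.
Proof.
  intros hK; unfold angle; rewrite asin_pos_iff; unfold sin_angle, separated.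
  destruct excluded_middle_informative as [h|h]; [split; [tauto|lra]|].
  set (Q := fun r => exists x y : V, K x /\ norm x = 1 /\ M y /\ r = norm (minus x y)).
  destruct (Glb_Rbar_correct Q) as [lb glb].
  split.
  - intros hpos; right; right; exists (real (Glb_Rbar Q)); split; [exact hpos|intros x y hx hx1 hy].
    assert (hq : Q (norm (minus x y))) by (exists x, y; repeat split; assumption).
    specialize (lb _ hq); destruct (Glb_Rbar Q) as [s| |]; simpl in *; [exact lb|contradiction|lra].
  - intros [hk|[hm|[e [e0 he]]]]; [elim h; left; exact hk|elim h; right; exact hm|].
    assert (hle : Rbar_le e (Glb_Rbar Q)).
    { apply glb; intros r [x [y [hx [hx1 [hy ->]]]]]; apply he; assumption. }
    (* The infimum must be shown finite, since [real] would turn [p_infty] into [0]; a unit vector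
       of [K] and any vector of [M] do it. *)
    destruct (not_trivial_ex (K := K)) as [x [hx hx0]]; [intros hk; apply h; left; exact hk|].
    destruct (not_trivial_ex (K := M)) as [y [hy _]]; [intros hm; apply h; right; exact hm|].
    assert (hq : Q (norm (minus (scal (RtoC (/ norm x) : C_AbsRing) x) y))).
    { exists (scal (RtoC (/ norm x) : C_AbsRing) x), y; split; [apply hK, hx|split; [apply norm_normalized, hx0|split; [exact hy|reflexivity]]]. }
    specialize (lb _ hq); destruct (Glb_Rbar Q) as [s| |]; simpl in *; try contradiction; lra.
Qed.

Lemma separated_mono (K M K' M' : V -> Prop) : (forall x, K' x -> K x) -> (forall y, M' y -> M y) ->
  separated K M -> separated K' M'.
Proof.
  intros hK hM [h|[h|[e [e0 he]]]].
  - left; intros x hx; apply h, hK, hx.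
  - right; left; intros x hx; apply h, hM, hx.
  - right; right; exists e; split; [exact e0|intros x y hx hx1 hy; apply he; auto].
Qed.

(** If [T (T x)] is zero, then [T x] lies in the null space and in the range; unless it is zero, its
    normalisation is a unit vector at distance zero from the range. A nontrivial null space excludes
    ascent [0]. *)
Lemma asc_eq_1 (T : V -> V) : (forall (k : C) x, T (scal (k : C_AbsRing) x) = scal (k : C_AbsRing) (T x)) ->
  separated (null_space T) (range T) -> ~ is_trivial (null_space T) -> asc T = Some 1%nat.
Proof.
  intros hT hsep hnt.
  assert (T0 : T zero = zero).
  { transitivity (T (scal (RtoC 0 : C_AbsRing) zero)); [f_equal; symmetry; exact (scal_zero_l zero)|rewrite hT; exact (scal_zero_l (T zero))]. }
  assert (h1 : is_asc T 1).
  { split.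
    - intros x; unfold null_space; simpl; split; [intros ->; exact T0|intros h2].
      apply NNPP; intros hne.
      destruct hsep as [ht|[ht|[e [e0 he]]]].
      + apply hne, ht, h2.
      + apply hne, ht; exists x; reflexivity.
      + set (c := (RtoC (/ norm (T x)) : C_AbsRing)).
        assert (hle : e <= norm (minus (scal c (T x)) (T (scal c x)))).
        { apply he; [unfold null_space; rewrite hT, h2; apply (scal_zero_r (V := V))|apply norm_normalized, hne|exists (scal c x); reflexivity]. }
        rewrite hT, norm_minus_diag in hle; lra.
    - intros j hj; destruct j as [|j]; [|lia].
      elim hnt; intros x hx; apply (hj x), hx. }
  unfold asc; destruct excluded_middle_informative as [h|h]; [|elim h; exists 1%nat; exact h1].
  destruct (constructive_indefinite_description _ h) as [k [hk1 hk2]]; simpl; f_equal.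
  apply Nat.le_antisymm; [apply hk2, h1|apply h1, hk1].
Qed.
End AngleAscentFacts.

(** * Application to generalized derivations *)

Section Delta.
Variable X : CompleteNormedModule C_AbsRing.
Notation B := (bounded_op X).
Notation tpi := (two_pi_i : C_AbsRing).
Implicit Types P Q Y : B.

Lemma delta_scal P Q (k : C) Y : delta P Q (scal (k : C_AbsRing) Y) = scal (k : C_AbsRing) (delta P Q Y).
Proof. unfold delta; rewrite comp_scal_l, comp_scal_r; bop_eq. Qed.

Lemma delta_null_scal P Q (k : C) Y : null_space (delta P Q) Y -> null_space (delta P Q) (scal (k : C_AbsRing) Y).
Proof. unfold null_space; intros h; rewrite delta_scal, h; apply (scal_zero_r (V := bop_NormedModule X)). Qed.

Lemma delta_conclusion P Q : separated (null_space (delta P Q)) (range (delta P Q)) ->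
  0 < angle (null_space (delta P Q)) (range (delta P Q)) /\
  (~ is_trivial (null_space (delta P Q)) -> asc (delta P Q) = Some 1%nat).
Proof.
  intros h; split.
  - apply angle_pos_iff; [intros k Y; apply delta_null_scal|exact h].
  - apply asc_eq_1; [intros; apply delta_scal|exact h].
Qed.

Lemma is_riesz_calc U f (A T : B) : is_riesz U f A T ->
  exists G, encloses U G A /\ calc A G f = scal tpi T.
Proof.
  intros [G [hG hI]]; exists G; split; [apply surrounds_encloses, hG|].
  symmetry; exact (is_chain_int_unique (V := bop_Banach X) hI).
Qed.

Section Transfer.
Variables (U : C -> Prop) (f f' : C -> C).
Hypothesis U_open : open (U : CU -> Prop).
Hypothesis f_diff : forall z, U z -> cdiff f z (f' z).

Lemma delta_riesz_separated (A A' fA fA' : B) G G' : encloses U G A -> encloses U G' A' ->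
  calc A G f = scal tpi fA -> calc A' G' f = scal tpi fA' ->
  (forall z w, U z -> U w -> slope f f' z w <> RtoC 0) ->
  separated (null_space (delta A A')) (range (delta A A')) ->
  separated (null_space (delta fA fA')) (range (delta fA fA')).
Proof.
  intros enc enc' hfA hfA' hne; apply separated_mono.
  - intros Y hY; exact (delta_null_riesz U_open f_diff hne enc enc' hfA hfA' hY).
  - intros Z [Y ->]; eexists; exact (delta_riesz_range U_open f_diff enc enc' hfA hfA' Y).
Qed.

(** [delta A A] kills the identity, so [delta fA fA'] kills it too, and its value there is
    [fA - fA']. The two cycles of [delta_riesz_null] are unrelated, which is what makes this
    work. *)
Lemma riesz_unique (A fA fA' : B) G G' : encloses U G A -> encloses U G' A ->
  calc A G f = scal tpi fA -> calc A G' f = scal tpi fA' -> fA = fA'.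
Proof.
  intros enc enc' hfA hfA'.
  assert (h : delta fA fA' (bop_id X) = zero).
  { apply (delta_riesz_null U_open f_diff enc enc' hfA hfA').
    unfold delta; rewrite comp_id_l, comp_id_r; apply (minus_eq_zero (G := bop_AbelianGroup X)). }
  unfold delta in h; rewrite comp_id_l, comp_id_r in h.
  replace fA with (plus (minus fA fA') fA') by bop_eq.
  rewrite h; bop_eq.
Qed.
End Transfer.

Lemma encloses_mono (U D : C -> Prop) G (A : B) : (forall z, D z -> U z) -> encloses D G A -> encloses U G A.
Proof.
  intros hDU enc; split; [apply (enc_cycle enc)|intros z hz; apply hDU, (enc_U enc hz)|apply (enc_res enc)|apply (enc_in enc)|].
  intros w hw; apply (enc_out enc); intros h; apply hw, hDU, h.
Qed.

(** For nonzero [l] the null space and the range are those of [delta P Q]; for [l = 0] the range is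
    trivial. *)
Lemma delta_scaled_separated (l : C) P Q : separated (null_space (delta P Q)) (range (delta P Q)) ->
  separated (null_space (delta (bop_scal l P) (bop_scal l Q))) (range (delta (bop_scal l P) (bop_scal l Q))).
Proof.
  intros h.
  assert (e : forall Y, delta (bop_scal l P) (bop_scal l Q) Y = scal (l : C_AbsRing) (delta P Q Y)).
  { intros Y; unfold delta.
    change (bop_scal l P) with (scal (l : C_AbsRing) P); change (bop_scal l Q) with (scal (l : C_AbsRing) Q).
    rewrite comp_scal_l, comp_scal_r; bop_eq. }
  destruct (classic (l = RtoC 0)) as [->|hl].
  - right; left; intros Z [Y ->]; rewrite e; exact (scal_zero_l (delta P Q Y)).
  - revert h; apply separated_mono.
    + intros Y hY; unfold null_space in *; rewrite e in hY.
      apply (scal_C_inj hl); etransitivity; [exact hY|symmetry; apply (scal_zero_r (V := bop_NormedModule X))].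
    + intros Z [Y ->]; exists (scal (l : C_AbsRing) Y); rewrite e, delta_scal; reflexivity.
Qed.
End Delta.

Theorem corollary8 (X : CompleteNormedModule C_AbsRing) (A B : bounded_op X)
    (hAB : 0 < angle (null_space (delta A B)) (range (delta A B))) :
  (forall (U : C -> Prop) (f : C -> C),
     open (U : C_UniformSpace -> Prop) ->
     (forall z : C, spectrum A z \/ spectrum B z -> U z) ->
     holomorphic_on U f -> injective_on U f ->
     forall fA fB : bounded_op X, is_riesz U f A fA -> is_riesz U f B fB ->
       0 < angle (null_space (delta fA fB)) (range (delta fA fB)) /\
       (~ is_trivial (null_space (delta fA fB)) ->
          asc (delta fA fB) = Some 1%nat)) /\
  (forall (U : C -> Prop) (f : C -> C),
     open (U : C_UniformSpace -> Prop) -> U (RtoC 0) ->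
     holomorphic_on U f -> C_derive f (RtoC 0) <> RtoC 0 ->
     exists c : R, 0 < c /\
       forall l : C, Cmod l < c ->
         (forall z : C,
            spectrum (bop_scal l A) z \/ spectrum (bop_scal l B) z -> U z) /\
         forall flA flB : bounded_op X,
           is_riesz U f (bop_scal l A) flA -> is_riesz U f (bop_scal l B) flB ->
           0 < angle (null_space (delta flA flB)) (range (delta flA flB)) /\
           (~ is_trivial (null_space (delta flA flB)) ->
              asc (delta flA flB) = Some 1%nat)).
Proof.
  apply angle_pos_iff in hAB; [|intros k Y; apply delta_null_scal].
  assert (hdiff : forall U f, holomorphic_on U f -> forall z, U z -> cdiff f z (C_derive f z)).
  { intros U f hf z hz; apply ex_derive_cdiff, C_derive_correct; [exact z|apply hf, hz]. }
  split.
  - intros U f hU _ hf hinj fA fB hfA hfB.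
    apply is_riesz_calc in hfA; destruct hfA as [G [enc hG]].
    apply is_riesz_calc in hfB; destruct hfB as [G' [enc' hG']].
    apply delta_conclusion, (delta_riesz_separated hU (hdiff U f hf) enc enc' hG hG'); [|exact hAB].
    intros z w hz hw; exact (injective_slope_neq_0 hU (hdiff U f hf) hinj hz hw).
  - intros U f hU h0 hf hf0.
    set (f' := C_derive f); pose proof (hdiff U f hf) as fd; fold f' in fd.
    pose proof (slope_continuous hU fd h0 h0) as hc.
    assert (hs0 : 0 < Cmod (slope f f' (RtoC 0) (RtoC 0))) by (rewrite slope_diag; apply (proj1 (Cmod_gt_0 _)), hf0).
    destruct (proj1 (open_Cmod U) hU _ h0) as [d1 [d10 hd1]].
    destruct (proj1 (continuous_norm_iff (V := C_NormedModule) _ _) hc _ hs0) as [d2 hd2].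
    set (rho := Rmin d1 d2 / 2).
    assert (hrho : 0 < rho /\ rho < d1 /\ rho < d2).
    { assert (0 < Rmin d1 d2) by (apply Rmin_pos; [exact d10|apply cond_pos]).
      pose proof (Rmin_l d1 d2); pose proof (Rmin_r d1 d2); unfold rho; lra. }
    set (D := fun z => Cmod (Cminus z (RtoC 0)) < Rmin d1 d2).
    assert (hm0 : forall z, Cminus z (RtoC 0) = z) by (intros z; ring).
    assert (hDU : forall z, D z -> U z).
    { intros z hz; apply hd1, Rlt_le_trans with (1 := hz), Rmin_l. }
    assert (hDo : open (D : CU -> Prop)) by apply disc_open.
    assert (ball0 : forall z, D z -> ball (RtoC 0 : CU) d2 z).
    { intros z hz; assert (hz2 : Cmod z < d2) by (rewrite <- (hm0 z); apply Rlt_le_trans with (1 := hz), Rmin_r).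
      pose proof (Rmax_Cmod z) as hr; pose proof (Rmax_l (Rabs (fst z)) (Rabs (snd z))); pose proof (Rmax_r (Rabs (fst z)) (Rabs (snd z))).
      split; [change (Rabs (fst z - 0) < d2)|change (Rabs (snd z - 0) < d2)]; rewrite Rminus_0_r; lra. }
    assert (hne : forall z w, D z -> D w -> slope f f' z w <> RtoC 0).
    { intros z w hz hw hzw; specialize (hd2 (z, w) (conj (ball0 z hz) (ball0 w hw))).
      change (Cmod (Cminus (slope f f' z w) (slope f f' (RtoC 0) (RtoC 0))) < Cmod (slope f f' (RtoC 0) (RtoC 0))) in hd2.
      rewrite hzw in hd2; replace (Cminus (RtoC 0) (slope f f' (RtoC 0) (RtoC 0))) with (Copp (slope f f' (RtoC 0) (RtoC 0))) in hd2 by ring.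
      rewrite Cmod_opp in hd2; lra. }
    assert (fdD : forall z, D z -> cdiff f z (f' z)) by (intros z hz; apply fd, hDU, hz).
    pose proof (op_norm_ge_0 A) as nA; pose proof (op_norm_ge_0 B) as nB.
    (* One bound for both operators: their norms are at most the sum, and the [+ 1] keeps the
       denominator positive. Thus [l A] and [l B] have norm below [rho], so their spectra lie inside
       the circle. *)
    set (c := rho / (op_norm A + op_norm B + 1)).
    assert (c0 : 0 < c) by (apply Rdiv_lt_0_compat; lra).
    exists c; split; [exact c0|intros l hl].
    assert (small : forall P : bounded_op X, op_norm P <= op_norm A + op_norm B -> op_norm (bop_scal l P) < rho).
    { intros P hP; apply Rle_lt_trans with (1 := op_norm_scal (l : C_AbsRing) P).
      change (Cmod l * op_norm P < rho).
      apply Rle_lt_trans with (Cmod l * (op_norm A + op_norm B + 1)); [apply Rmult_le_compat_l; [apply Cmod_ge_0|lra]|].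
      replace rho with (c * (op_norm A + op_norm B + 1)) by (unfold c; field; lra).
      apply Rmult_lt_compat_r; lra. }
    pose proof (small A ltac:(lra)) as sA; pose proof (small B ltac:(lra)) as sB.
    assert (hsub : forall z, Cmod z <= rho -> D z).
    { intros z hz; unfold D; rewrite hm0; apply Rle_lt_trans with (1 := hz); unfold rho.
      assert (0 < Rmin d1 d2) by (apply Rmin_pos; [exact d10|apply cond_pos]); lra. }
    assert (hspec : forall P : bounded_op X, op_norm P < rho -> forall z, spectrum P z -> U z).
    { intros P hP z hz; apply hDU, hsub, Rnot_lt_le; intros h.
      apply (proj1 (resolvent_set_large (A := P) (z := z) ltac:(lra)) hz). }
    split; [intros z [hz|hz]; [exact (hspec _ sA z hz)|exact (hspec _ sB z hz)]|].
    intros flA flB hfA hfB.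
    (* The given value [T] comes from some cycle in [U], whereas [h] is known to be free of zeros on
       [D] only. Both cycles enclose the spectrum within [U], so [riesz_unique] identifies [T] with
       the value computed on the circle. *)
    assert (key : forall (P T : bounded_op X), op_norm P < rho -> is_riesz U f P T ->
      encloses D (circle (RtoC 0) rho :: nil) P /\ calc P (circle (RtoC 0) rho :: nil) f = scal (two_pi_i : C_AbsRing) T).
    { intros P T hP hT; apply is_riesz_calc in hT; destruct hT as [G [enc hG]].
      pose proof (circle_encloses (proj1 hrho) hP hsub) as encD; split; [exact encD|].
      set (Q := scal (Cinv two_pi_i : C_AbsRing) (calc P (circle (RtoC 0) rho :: nil) f) : bounded_op X).
      assert (hQ : calc P (circle (RtoC 0) rho :: nil) f = scal (two_pi_i : C_AbsRing) Q).
      { unfold Q; bop_eq; field; exact two_pi_i_neq_0. }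
      rewrite (riesz_unique hU fd enc (encloses_mono hDU encD) hG hQ); exact hQ. }
    destruct (key _ _ sA hfA) as [e1 k1]; destruct (key _ _ sB hfB) as [e2 k2].
    apply delta_conclusion, (delta_riesz_separated hDo fdD e1 e2 k1 k2 hne), delta_scaled_separated, hAB.
Qed.
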